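(* Let $\{\eta_k\}_{k\in\mathbb{N}}\subset\mathcal{E}$ and assume that there exist $\eta\in\mathcal{E}$ and a constant $E_0$, independent of $k$, such that $\eta_k\to\eta$ in $C^1(Q;\mathbb{R}^n)$, $E(\eta_k)\le E_0$ for all $k$, and $E(\eta)\le E_0$. For every $k$ let $\sigma_k\in M(\partial Q;\mathbb{R}^n)$ be a contact force for $\eta_k$, and assume $\sup_k\|\sigma_k\|_{M(\partial Q;\mathbb{R}^n)}<\infty$. Then there exist a subsequence (not relabelled) and a measure $\sigma\in M(\partial Q;\mathbb{R}^n)$ such that $\sigma_k\rightharpoonup^*\sigma$ in $M(\partial Q;\mathbb{R}^n)$. Moreover, $\sigma$ is a contact force for $\eta$, and if $\sigma_k$ satisfies the action-reaction principle at self-contact for all $k$, then so does $\sigma$.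
   Context: **Setting.** $Q\subset\mathbb{R}^n$ is a bounded $C^{1,\alpha}$ domain or a disjoint union of finitely many such domains; $\Omega\subset\mathbb{R}^n$ is a (possibly unbounded) $C^{1,\alpha}$ domain; $\Gamma\subset\partial Q$ is a fixed measurable subset; $p>n$. The class of admissible deformations is $$\mathcal{E}=\Big\{\eta\in W^{2,p}(Q;\mathbb{R}^n):\eta(Q)\subset\Omega,\ \eta|_\Gamma=\eta_0|_\Gamma,\ \det\nabla\eta>0,\ \mathcal{L}^n(\eta(Q))=\int_Q\det\nabla\eta\,dx\Big\},$$ where $\eta_0$ is a given admissible deformation with $\eta_0|_\Gamma$ injective and $\eta_0(\Gamma)\cap\partial\Omega=\emptyset$. Every $\eta\in\mathcal{E}$ is identified with its $C^{1,1-n/p}(\overline Q)$ representative. A subscript $\Gamma$ on a function space means vanishing trace on $\Gamma$. $M(\partial Q;\mathbb{R}^n)$ denotes $\mathbb{R}^n$-valued Radon measures, $M^+(\partial Q)$ non-negative Radon measures. **Elastic energy.** $E:W^{2,p}(Q;\mathbb{R}^n)\to(-\infty,\infty]$ satisfies: (a) there is $E_{\min}>-\infty$ with $E\ge E_{\min}$; and $E(\eta)<\infty$ whenever $\inf_Q\det\nabla\eta>0$; (b) for every $E_0\ge E_{\min}$ there is $\varepsilon_0>0$ with $\det\nabla\eta\ge\varepsilon_0$ for all $\eta$ with $E(\eta)\le E_0$; (c) for every $E_0\ge E_{\min}$ there is $C$ with $\|\nabla^2\eta\|_{L^p}\le C$ for all $\eta$ with $E(\eta)<E_0$; (d) $E$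 is weakly lower semicontinuous and strongly continuous on $W^{2,p}(Q;\mathbb{R}^n)$; (e) $E$ is differentiable in its effective domain with derivative $DE(\eta)\in(W^{2,p}(Q;\mathbb{R}^n))^*$; $DE$ is bounded on sublevel sets of $E$; and $DE(\eta_k)\langle\varphi\rangle\to DE(\eta)\langle\varphi\rangle$ whenever $\varphi\in W^{2,p}_\Gamma$ and $\eta_k\to\eta$ in $W^{2,p}(K;\mathbb{R}^n)$ for all $K$ compactly contained in $\overline Q$ with $\operatorname{dist}(K,\Gamma)>0$; (f) $\liminf_k(DE(\eta_k)-DE(\eta))\langle(\eta_k-\eta)\psi\rangle\ge0$ for all $\psi\in C^\infty_\Gamma(Q;[0,1])$ and all $\eta_k\rightharpoonup\eta$ in $W^{2,p}$; and if the corresponding $\limsup$ is $\le0$ for all such $\psi$, then $\eta_k\to\eta$ in $W^{2,p}(K;\mathbb{R}^n)$ for all $K$ compactly contained in $\overline Q$ with $\operatorname{dist}(K,\Gamma)>0$. **Normals, contact set, contact forces.** $n_Q$ is the interior unit normal of $\partial Q$ and $n_\eta(x)=\frac{\operatorname{cof}\nabla\eta(x)\,n_Q(x)}{|\operatorname{cof}\nabla\eta(x)\,n_Q(x)|}$ for $x\in\partial Q$. The contact set is $C_\eta=\{x\in\overline Q:\eta(x)\in\partial\Omega\text{ or }\eta^{-1}(\eta(x))\ne\{x\}\}$ (preimages in $\overline Q$); it is known that $C_\eta\subset\partial Q$. A contact force for $\eta$ is $\sigma\in M(\partial Q;\mathbb{R}^n)$ with $\operatorname{supp}\sigma\subset C_\eta$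 for which there is $|\sigma|\in M^+(\partial Q)$ with $d\sigma=n_\eta\,d|\sigma|$, i.e. $\int\varphi\cdot d\sigma=\int\varphi\cdot n_\eta\,d|\sigma|$ for all $\varphi\in C(\partial Q;\mathbb{R}^n)$. It satisfies the action-reaction principle at self-contact if $\int_{\partial Q}(\varphi\circ\eta)\cdot d\sigma=0$ for all $\varphi\in C_c(\Omega;\mathbb{R}^n)$. *)

(* Defs.v *)
From HB Require Import structures.
From mathcomp Require Import all_boot all_order all_algebra.
From mathcomp Require Import all_classical all_reals all_analysis.

Set Implicit Arguments.
Unset Strict Implicit.
Unset Printing Implicit Defensive.
Import Order.TTheory GRing.Theory Num.Theory.
Import numFieldNormedType.Exports.
Local Open Scope classical_set_scope.
Local Open Scope ring_scope.

(* R^n is 'rV[R]_n; [borel_rV R n] is that type with its Borel sigma-algebra. *)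
Definition borel_rV (R : realType) (n : nat) :=
  g_sigma_algebraType (@open 'rV[R]_n).

Section lebesgue_measure_tuple.
Variable R : realType.
Local Notation mR := (measurableTypeR R).

Definition cons_pair n (x : mR * n.-tuple mR) : n.+1.-tuple mR :=
  [tuple of x.1 :: x.2].

Lemma measurable_cons_pair n :
  measurable_fun [set: mR * n.-tuple mR] (@cons_pair n).
Proof. exact: measurable_cons. Qed.

Section step.
Variables (n : nat) (m : {sigma_finite_measure set (n.-tuple mR) -> \bar R}).

Definition tuple_leb_step : set (n.+1.-tuple mR) -> \bar R :=
  pushforward ((@lebesgue_measure R) \x m)%E (@cons_pair n).

Let step0 : tuple_leb_step set0 = 0%E.
Proof. by rewrite /tuple_leb_step /pushforward preimage_set0 measure0. Qed.

Let step_ge0 A : (0 <= tuple_leb_step A)%E.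
Proof. by rewrite /tuple_leb_step /pushforward; apply: measure_ge0. Qed.

Let step_sigma_additive : semi_sigma_additive tuple_leb_step.
Proof.
have mf := @measurable_cons_pair n.
move=> F mF tF mUF; rewrite /tuple_leb_step /pushforward preimage_bigcup.
apply: measure_semi_sigma_additive.
- by move=> i; rewrite -[X in measurable X]setTI; exact: mf.
- apply/trivIsetP => /= i j _ _ ij; rewrite -preimage_setI.
  by move/trivIsetP : tF => /(_ _ _ _ _ ij) ->//; rewrite preimage_set0.
- by rewrite -preimage_bigcup -[X in measurable X]setTI; exact: mf.
Qed.

HB.instance Definition _ := isMeasure.Build _ _ _
  tuple_leb_step step0 step_ge0 step_sigma_additive.

Let step_sigma_finite : sigma_finite setT tuple_leb_step.
Proof.
have /sigma_finiteP[F [TF ndF Foo]] := sigma_finiteT (@lebesgue_measure R).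
have /sigma_finiteP[G [TG ndG Goo]] := sigma_finiteT m.
pose g (t : n.+1.-tuple mR) : mR * n.-tuple mR :=
  (tnth t ord0, [tuple of behead t]).
have gK : cancel g (@cons_pair n).
  by move=> t; rewrite [in RHS](tuple_eta t); apply/val_inj.
have cK : cancel (@cons_pair n) g by move=> [x t]; congr (_, _); exact/val_inj.
have mg : measurable_fun [set: n.+1.-tuple mR] g.
  apply/measurable_fun_pairP; split => /=; first exact: measurable_tnth.
  exact: measurable_behead.
exists (fun i => g @^-1` (F i `*` G i)).
  rewrite -preimage_bigcup (_ : \bigcup_i _ = setT) ?preimage_setT//.
  apply/seteqP; split => // -[x y] _.
  have [k _ Fx] : (\bigcup_i F i) x by rewrite -TF.
  have [l _ Gy] : (\bigcup_i G i) y by rewrite -TG.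
  exists (maxn k l) => //; split.
    by move: x Fx; exact/subsetPset/ndF/leq_maxl.
  by move: y Gy; exact/subsetPset/ndG/leq_maxr.
move=> i; have [mFi Fi_oo] := Foo i; have [mGi Gi_oo] := Goo i; split.
  by rewrite -[X in measurable X]setTI; apply: mg => //; exact: measurableX.
rewrite /tuple_leb_step /pushforward (_ : _ @^-1` _ = F i `*` G i).
  by rewrite product_measure1E// lte_mul_pinfty// ge0_fin_numE.
by rewrite -comp_preimage (_ : g \o _ = id)//; exact/funext.
Qed.

HB.instance Definition _ := Measure_isSigmaFinite.Build _ _ _
  tuple_leb_step step_sigma_finite.

End step.

(* n-fold product of the one-dimensional Lebesgue measure. *)
Fixpoint tuple_leb n : {sigma_finite_measure set (n.-tuple mR) -> \bar R} :=
  match n with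
  | 0 => \d_([tuple] : 0.-tuple mR)
  | n'.+1 => tuple_leb_step (tuple_leb n')
  end.

Definition row_of_tuple n (t : n.-tuple mR) : borel_rV R n :=
  \row_i tnth t i.

Lemma measurable_row_of_tuple n :
  measurable_fun [set: n.-tuple mR] (@row_of_tuple n).
Proof.
apply: (@measurability _ _ _ (borel_rV R n) _ _ (@open 'rV[R]_n)) => //.
move=> _ [U oU <-]; rewrite setTI.
pose rat_row (q : 'rV[rat]_n) : 'rV[R]_n := map_mx ratr q.
pose B (qe : 'rV[rat]_n * rat) : set 'rV[R]_n :=
  if `[< ball (rat_row qe.1) (ratr qe.2) `<=` U >]
  then ball (rat_row qe.1) (ratr qe.2)
  else set0.
have -> : U = \bigcup_(qe in [set: 'rV[rat]_n * rat]) B qe.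
  apply/seteqP; split => [x Ux|x [qe _]]; last first.
    by rewrite /B; case: asboolP => [+ xB|//]; exact.
  have /nbhs_ballP[e /= e0 eU] := open_nbhs_nbhs (conj oU Ux).
  have e20 : 0 < e / 2 by rewrite divr_gt0.
  have [d] := rat_in_itvoo e20; rewrite in_itv/= => /andP[d0 de].
  have qP i : {q : rat | `|x 0 i - ratr q| < ratr d}.
    have xd : x 0 i - ratr d < x 0 i + ratr d.
      by rewrite ltrBlDr -addrA ltrDl addr_gt0.
    apply: cid; have [q] := rat_in_itvoo xd.
    rewrite in_itv/= => /andP[q1 q2]; exists q.
    by rewrite ltr_distlC q1 q2.
  pose q : 'rV[rat]_n := \row_i sval (qP i).
  have xq : ball (rat_row q) (ratr d) x.
    split=> // i j; rewrite ord1 !mxE /ball /= distrC.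
    exact: svalP (qP j).
  exists (q, d) => //; rewrite /B; case: asboolP => //= -[].
  apply: subset_trans eU => y qy.
  rewrite (splitr e).
  apply: ball_triangle (le_ball (ltW de) qy).
  exact/ball_sym/(le_ball (ltW de)).
rewrite preimage_bigcup; apply: countable_bigcupT_measurable => [|[q d]].
  exact: countableP.
rewrite /B; case: asboolP => _; last by rewrite preimage_set0.
rewrite (_ : _ @^-1` _ = if (0 < (ratr d : R)) then
   \bigcap_(i in [set: 'I_n]) ((fun t : n.-tuple mR => tnth t i) @^-1`
     (ball (rat_row q 0 i) (ratr d : R))) else set0); last first.
  case: ifPn => [d0|/negP d0]; apply/seteqP; split => t //=.
  - case=> _ tq i _; have := tq ord0 i; by rewrite [X in ball _ _ X]mxE.
  - by move=> tq; split=> // i j; rewrite ord1 [X in ball _ _ X]mxE; exact: tq.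
  - by case.
case: ifPn => // _; apply: fin_bigcap_measurable => [|i _].
  exact: finite_finset.
rewrite -[X in measurable X]setTI; apply: measurable_tnth => //.
by rewrite ball_itv.
Qed.

Definition lebesgue_rV n : set (borel_rV R n) -> \bar R :=
  pushforward (tuple_leb n) (@row_of_tuple n).

Section lebesgue_rV_measure.
Variable n : nat.

Let leb0 : @lebesgue_rV n set0 = 0%E.
Proof. by rewrite /lebesgue_rV /pushforward preimage_set0 measure0. Qed.

Let leb_ge0 A : (0 <= @lebesgue_rV n A)%E.
Proof. by rewrite /lebesgue_rV /pushforward; apply: measure_ge0. Qed.

Let leb_sigma_additive : semi_sigma_additive (@lebesgue_rV n).
Proof.
have mf := @measurable_row_of_tuple n.
move=> F mF tF mUF; rewrite /lebesgue_rV /pushforward preimage_bigcup.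
apply: measure_semi_sigma_additive.
- by move=> i; rewrite -[X in measurable X]setTI; exact: mf.
- apply/trivIsetP => /= i j _ _ ij; rewrite -preimage_setI.
  by move/trivIsetP : tF => /(_ _ _ _ _ ij) ->//; rewrite preimage_set0.
- by rewrite -preimage_bigcup -[X in measurable X]setTI; exact: mf.
Qed.

HB.instance Definition _ := isMeasure.Build _ _ _
  (@lebesgue_rV n) leb0 leb_ge0 leb_sigma_additive.

End lebesgue_rV_measure.

End lebesgue_measure_tuple.
Arguments lebesgue_rV {R n}.

Section euclidean_space.
Context {R : realType} {n : nat}.
Implicit Types x y : 'rV[R]_n.

(* [`|x|] is the library's sup norm; [enorm] is the Euclidean one. *)
Definition dotrV x y : R := \sum_i x 0 i * y 0 i.

Definition enorm x : R := Num.sqrt (dotrV x x).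

Definition bdry (A : set 'rV[R]_n) : set 'rV[R]_n := closure A `\` interior A.

Definition diameter (A : set 'rV[R]_n) : \bar R :=
  ereal_sup [set (enorm (xy.1 - xy.2))%:E | xy in A `*` A].

(* Up to the customary normalizing constant, which does not affect
   measurability. *)
Definition hausdorff_pre (s : nat) (delta : R) (A : set 'rV[R]_n) : \bar R :=
  ereal_inf [set (\sum_(0 <= k <oo)
                    (if U k == set0 then 0 else (diameter (U k)) ^+ s))%E
            | U in [set U : nat -> set 'rV[R]_n |
                      A `<=` \bigcup_k U k /\
                      forall k, (diameter (U k) <= delta%:E)%E]].

Definition hausdorff (s : nat) (A : set 'rV[R]_n) : \bar R :=
  ereal_sup [set hausdorff_pre s delta A | delta in [set delta | 0 < delta]].

End euclidean_space.

Section partial_derivatives.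
Context {R : realType} {n : nat}.

Definition partial (i : 'I_n) (f : 'rV[R]_n -> R) (x : 'rV[R]_n) : R :=
  'D_(delta_mx 0 i) f x.

Fixpoint Ck (k : nat) (f : 'rV[R]_n -> R) : Prop :=
  match k with
  | 0 => continuous f
  | k'.+1 => (forall x, differentiable f x) /\ forall i, Ck k' (partial i f)
  end.

Definition smooth (f : 'rV[R]_n -> R) : Prop := forall k, Ck k f.

Definition test_function (Q : set 'rV[R]_n) (f : 'rV[R]_n -> R) : Prop :=
  smooth f /\
  exists K : set 'rV[R]_n,
    [/\ compact K, K `<=` Q & forall x, ~ K x -> f x = 0].

Definition component (u : 'rV[R]_n -> 'rV[R]_n) (c : 'I_n) : 'rV[R]_n -> R :=
  fun x => u x 0 c.

Definition grad (u : 'rV[R]_n -> 'rV[R]_n) (x : 'rV[R]_n) : 'M[R]_n :=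
  \matrix_(i, j) partial j (component u i) x.

(* Continuous extension of [grad u] from Q to its closure. *)
Definition gradbar (Q : set 'rV[R]_n) (u : 'rV[R]_n -> 'rV[R]_n)
    (x : 'rV[R]_n) : 'M[R]_n :=
  \matrix_(i, j) lim (grad u y i j @[y --> within Q (nbhs x)]).

(* u is C^{1,beta} up to the boundary of Q; its values outside [closure Q] are
   irrelevant. The Hoelder bound on Q makes [grad u] extend continuously. *)
Definition C1Holder (Q : set 'rV[R]_n) (beta : R)
    (u : 'rV[R]_n -> 'rV[R]_n) : Prop :=
  [/\ {within closure Q, continuous u},
      forall x, Q x -> differentiable u x &
      exists L : R, forall x y i j, Q x -> Q y ->
        `|grad u x i j - grad u y i j| <= L * `|x - y| `^ beta].

Definition cvg_C1 (Q : set 'rV[R]_n) (u_ : nat -> 'rV[R]_n -> 'rV[R]_n)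
    (u : 'rV[R]_n -> 'rV[R]_n) : Prop :=
  forall e : R, 0 < e -> \forall k \near \oo, forall x, Q x ->
    `|u_ k x - u x| < e /\ `|grad (u_ k) x - grad u x| < e.

End partial_derivatives.

Section domains.
Context {R : realType} {n : nat}.

(* Near x0, in the orthonormal coordinates y = x *m A, the set U is the region
   above the graph of h over the hyperplane y_j = 0. *)
Definition graph_chart (U : set 'rV[R]_n) (x0 : 'rV[R]_n) (A : 'M[R]_n)
    (j : 'I_n) (h : 'rV[R]_n.-1 -> R) : Prop :=
  A *m A^T = 1%:M /\
  exists2 r : R, 0 < r & forall x, `|x - x0| < r ->
    (U x <-> h (col' j (x *m A)) < (x *m A) 0 j).

Definition C1Holder_scalar {m : nat} (alpha : R) (h : 'rV[R]_m -> R) : Prop :=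
  (forall y, differentiable h y) /\
  exists L : R, forall y z i,
    `|partial i h y - partial i h z| <= L * `|y - z| `^ alpha.

Definition C1alpha_domain (alpha : R) (U : set 'rV[R]_n) : Prop :=
  [/\ open U, connected U, U !=set0 &
      forall x, bdry U x ->
        exists A j h, graph_chart U x A j h /\ C1Holder_scalar alpha h].

(* The closures are required to be disjoint: otherwise neither the interior
   normal nor representatives continuous on [closure Q] make sense. *)
Definition reference_configuration (alpha : R) (Q : set 'rV[R]_n) : Prop :=
  exists (m : nat) (U : 'I_m.+1 -> set 'rV[R]_n),
    [/\ forall i, C1alpha_domain alpha (U i),
        forall i, bounded_set (U i),
        trivIset [set: 'I_m.+1] (fun i => closure (U i)) &
        Q = \bigcup_(i in [set: 'I_m.+1]) U i].

(* (- grad h, 1), normalized and expressed in the original coordinates. *)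
Definition graph_normal (A : 'M[R]_n) (j : 'I_n) (h : 'rV[R]_n.-1 -> R)
    (x : 'rV[R]_n) : 'rV[R]_n :=
  let w := \row_i (if unlift j i is Some k
                   then - partial k h (col' j (x *m A)) else 1) in
  (enorm w)^-1 *: (w *m A^T).

Definition inner_normal (U : set 'rV[R]_n) (x : 'rV[R]_n) : 'rV[R]_n :=
  xget 0 [set nu | exists A j h,
    [/\ graph_chart U x A j h, forall y, differentiable h y &
        nu = graph_normal A j h x]].

End domains.

Section sobolev.
Context {R : realType} {n : nat}.
Variables (Q : set 'rV[R]_n) (p : R).

Definition Lp (u : 'rV[R]_n -> R) : Prop :=
  measurable_fun (Q : set (borel_rV R n)) (u : borel_rV R n -> R) /\
  (@lebesgue_rV R n).-integrable Q (fun x => (`|u x| `^ p)%:E).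

Definition weak_partial (i : 'I_n) (u v : 'rV[R]_n -> R) : Prop :=
  forall phi, test_function Q phi ->
    \int[@lebesgue_rV R n]_(x in Q) (u x * partial i phi x) =
    - \int[@lebesgue_rV R n]_(x in Q) (v x * phi x).

Fixpoint Wkp (k : nat) (u : 'rV[R]_n -> R) : Prop :=
  Lp u /\
  match k with
  | 0 => True
  | k'.+1 => forall i, exists2 v, weak_partial i u v & Wkp k' v
  end.

(* A representative of the weak derivative, unique up to a null set. *)
Definition wpartial (i : 'I_n) (u : 'rV[R]_n -> R) : 'rV[R]_n -> R :=
  xget (fun=> 0) [set v | Lp v /\ weak_partial i u v].

(* Elements of W^{2,p}(Q; R^n) are handled through arbitrary representatives. *)
Definition W2p (u : 'rV[R]_n -> 'rV[R]_n) : Prop :=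
  forall c, Wkp 2 (component u c).

Definition Lp_pow (D : set 'rV[R]_n) (u : 'rV[R]_n -> R) : R :=
  \int[@lebesgue_rV R n]_(x in D) (`|u x| `^ p).

Definition hess_pow (D : set 'rV[R]_n) (u : 'rV[R]_n -> 'rV[R]_n) : R :=
  \sum_c \sum_i \sum_j Lp_pow D (wpartial j (wpartial i (component u c))).

Definition W2p_pow (D : set 'rV[R]_n) (u : 'rV[R]_n -> 'rV[R]_n) : R :=
  \sum_c Lp_pow D (component u c) +
  \sum_c \sum_i Lp_pow D (wpartial i (component u c)) + hess_pow D u.

Definition W2p_norm (u : 'rV[R]_n -> 'rV[R]_n) : R := W2p_pow Q u `^ p^-1.

Definition W2p_dual (l : ('rV[R]_n -> 'rV[R]_n) -> R) : Prop :=
  (forall (a : R) u v, W2p u -> W2p v ->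
     l (fun x => a *: u x + v x) = a * l u + l v) /\
  exists C : R, forall u, W2p u -> `|l u| <= C * W2p_norm u.

Definition W2p_cvg (u_ : nat -> 'rV[R]_n -> 'rV[R]_n)
    (u : 'rV[R]_n -> 'rV[R]_n) : Prop :=
  W2p_norm (fun x => u_ k x - u x) @[k --> \oo] --> (0 : R).

Definition W2p_weak_cvg (u_ : nat -> 'rV[R]_n -> 'rV[R]_n)
    (u : 'rV[R]_n -> 'rV[R]_n) : Prop :=
  forall l, W2p_dual l -> l (u_ k) @[k --> \oo] --> l u.

(* Convergence in W^{2,p}(K; R^n) for all K compactly contained in [closure Q]
   with dist(K, Gamma) > 0. *)
Definition W2p_local_cvg (Gamma : set 'rV[R]_n)
    (u_ : nat -> 'rV[R]_n -> 'rV[R]_n) (u : 'rV[R]_n -> 'rV[R]_n) : Prop :=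
  forall K : set 'rV[R]_n, compact K -> K `<=` closure Q ->
    (exists2 d : R, 0 < d & forall x y, K x -> Gamma y -> d <= `|x - y|) ->
    W2p_pow (K `&` Q) (fun x => u_ k x - u x) @[k --> \oo] --> (0 : R).

(* The representative provided by the Sobolev-Morrey embedding (p > n). *)
Definition Morrey_rep (u : 'rV[R]_n -> 'rV[R]_n) : Prop :=
  C1Holder Q (1 - n%:R / p) u.

Definition W2p_Gamma (Gamma : set 'rV[R]_n)
    (u : 'rV[R]_n -> 'rV[R]_n) : Prop :=
  [/\ W2p u, Morrey_rep u & forall x, Gamma x -> u x = 0].

Definition cutoff (Gamma : set 'rV[R]_n) (psi : 'rV[R]_n -> R) : Prop :=
  [/\ smooth psi, forall x, closure Q x -> 0 <= psi x <= 1 &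
      forall x, Gamma x -> psi x = 0].

End sobolev.

Record admissible {R : realType} {n : nat} (Q Omega Gamma : set 'rV[R]_n)
    (p : R) (eta0 eta : 'rV[R]_n -> 'rV[R]_n) : Prop := Admissible {
  adm_W2p : W2p Q p eta ;
  adm_rep : Morrey_rep Q p eta ;
  adm_image : eta @` Q `<=` Omega ;
  adm_trace : forall x, Gamma x -> eta x = eta0 x ;
  adm_det : forall x, Q x -> 0 < \det (grad eta x) ;
  adm_ciarlet_necas : (lebesgue_rV (eta @` Q) =
    \int[@lebesgue_rV R n]_(x in Q) (\det (grad eta x))%:E)%E
}.

Section elastic_energy.
Context {R : realType} {n : nat}.
Variables (Q Gamma : set 'rV[R]_n) (p : R).
Variables (E : ('rV[R]_n -> 'rV[R]_n) -> \bar R).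
Variables (DE : ('rV[R]_n -> 'rV[R]_n) -> ('rV[R]_n -> 'rV[R]_n) -> R).
Variable Emin : R.
Implicit Types u v phi : 'rV[R]_n -> 'rV[R]_n.

Definition finite_energy u : Prop := W2p Q p u /\ (E u < +oo)%E.

Record elastic_energy : Prop := ElasticEnergy {
  (* E is a function of classes modulo equality almost everywhere in Q *)
  energy_ae : forall u v, W2p Q p u -> W2p Q p v ->
    {ae (@lebesgue_rV R n), forall x, Q x -> u x = v x} -> E u = E v ;
  energy_ge : forall u, W2p Q p u -> (Emin%:E <= E u)%E ;
  energy_finite : forall u, W2p Q p u -> Morrey_rep Q p u ->
    (exists2 d : R, 0 < d & forall x, Q x -> d <= \det (grad u x)) ->
    (E u < +oo)%E ;
  energy_det : forall E0 : R, Emin <= E0 ->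
    exists2 e0 : R, 0 < e0 &
      forall u, W2p Q p u -> Morrey_rep Q p u -> (E u <= E0%:E)%E ->
        forall x, Q x -> e0 <= \det (grad u x) ;
  energy_coercive : forall E0 : R, Emin <= E0 ->
    exists C : R, forall u, W2p Q p u -> (E u < E0%:E)%E ->
      hess_pow Q p Q u `^ p^-1 <= C ;
  energy_wlsc : forall (u_ : nat -> 'rV[R]_n -> 'rV[R]_n) u,
    (forall k, W2p Q p (u_ k)) -> W2p Q p u ->
    W2p_weak_cvg Q p u_ u -> (E u <= limn_einf (fun k => E (u_ k)))%E ;
  energy_continuous : forall (u_ : nat -> 'rV[R]_n -> 'rV[R]_n) u,
    (forall k, W2p Q p (u_ k)) -> W2p Q p u ->
    W2p_cvg Q p u_ u -> E (u_ k) @[k --> \oo] --> E u ;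
  energy_deriv_dual : forall u, finite_energy u -> W2p_dual Q p (DE u) ;
  energy_deriv : forall u, finite_energy u ->
    forall e : R, 0 < e -> exists2 d : R, 0 < d &
      forall phi, W2p Q p phi -> W2p_norm Q p phi < d ->
        (E (fun x => u x + phi x)%R < +oo)%E /\
        `|fine (E (fun x => u x + phi x)) - fine (E u) - DE u phi|
          <= e * W2p_norm Q p phi ;
  energy_deriv_bounded : forall E0 : R, exists C : R,
    forall u, W2p Q p u -> (E u <= E0%:E)%E ->
      forall phi, W2p Q p phi -> `|DE u phi| <= C * W2p_norm Q p phi ;
  energy_deriv_continuous : forall (u_ : nat -> 'rV[R]_n -> 'rV[R]_n) u phi,
    (forall k, finite_energy (u_ k)) -> finite_energy u ->
    W2p_Gamma Q p Gamma phi -> W2p_local_cvg Q p Gamma u_ u ->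
    DE (u_ k) phi @[k --> \oo] --> DE u phi ;
  energy_liminf : forall (u_ : nat -> 'rV[R]_n -> 'rV[R]_n) u psi,
    (forall k, finite_energy (u_ k)) -> finite_energy u ->
    W2p_weak_cvg Q p u_ u -> cutoff Q Gamma psi ->
    (0 <= limn_einf (fun k =>
       (DE (u_ k) (fun x => psi x *: (u_ k x - u x))
        - DE u (fun x => psi x *: (u_ k x - u x)))%R%:E))%E ;
  energy_limsup : forall (u_ : nat -> 'rV[R]_n -> 'rV[R]_n) u,
    (forall k, finite_energy (u_ k)) -> finite_energy u ->
    W2p_weak_cvg Q p u_ u ->
    (forall psi, cutoff Q Gamma psi ->
       (limn_esup (fun k =>
          (DE (u_ k) (fun x => psi x *: (u_ k x - u x))
           - DE u (fun x => psi x *: (u_ k x - u x)))%R%:E) <= 0)%E) ->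
    W2p_local_cvg Q p Gamma u_ u
}.

End elastic_energy.

Section vector_measures.
Context {R : realType} {n : nat}.
Local Notation T := (borel_rV R n).

(* Integral against a signed measure, through its Jordan decomposition (which
   does not depend on the chosen Hahn decomposition). *)
Definition charge_integral (nu : {charge set T -> \bar R}) (D : set T)
    (f : T -> R) : R :=
  let hahn := svalP (cid (svalP (cid (Hahn_decomposition nu)))) in
  \int[jordan_pos hahn]_(x in D) f x - \int[jordan_neg hahn]_(x in D) f x.

(* R^n-valued measures, given by their components. On a compact subset of R^n
   the finite Borel measures are the Radon measures; M(S; R^n) consists of
   those concentrated on S. *)
Definition vmeasure := 'I_n -> {charge set T -> \bar R}.

Definition vmeasure_on (S : set 'rV[R]_n) (sigma : vmeasure) : Prop :=
  forall c (A : set T), measurable A -> A `&` S = set0 -> sigma c A = 0%E.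

Definition vmeasure_integral (sigma : vmeasure) (D : set 'rV[R]_n)
    (phi : 'rV[R]_n -> 'rV[R]_n) : R :=
  \sum_c charge_integral (sigma c) D (component phi c).

Definition vmeasure_at (sigma : vmeasure) (A : set T) : 'rV[R]_n :=
  \row_c fine (sigma c A).

Definition vmeasure_norm (sigma : vmeasure) : \bar R :=
  ereal_sup [set y | exists (m : nat) (A : 'I_m -> set T),
    [/\ forall i, measurable (A i), trivIset [set: 'I_m] A &
        y = (\sum_i enorm (vmeasure_at sigma (A i)))%:E]].

Definition vmeasure_supp (sigma : vmeasure) : set 'rV[R]_n :=
  [set x | forall U : set 'rV[R]_n, open U -> U x ->
     exists A : set T,
       [/\ measurable A, A `<=` U & vmeasure_at sigma A != 0]].

Definition weak_star_cvg (S : set 'rV[R]_n) (sigma_ : nat -> vmeasure)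
    (sigma : vmeasure) : Prop :=
  forall phi : 'rV[R]_n -> 'rV[R]_n, {within S, continuous phi} ->
    vmeasure_integral (sigma_ k) S phi @[k --> \oo]
      --> vmeasure_integral sigma S phi.

End vector_measures.
Arguments vmeasure : clear implicits.

Section contact_forces.
Context {R : realType} {n : nat}.
Variables (Q Omega : set 'rV[R]_n) (eta : 'rV[R]_n -> 'rV[R]_n).

Definition cofmx (A : 'M[R]_n) : 'M[R]_n := \matrix_(i, j) cofactor A i j.

(* The transpose is due to vectors being rows. *)
Definition deformed_normal (x : 'rV[R]_n) : 'rV[R]_n :=
  let w := inner_normal Q x *m (cofmx (gradbar Q eta x))^T in
  (enorm w)^-1 *: w.

Definition contact_set : set 'rV[R]_n :=
  [set x | closure Q x /\
    (bdry Omega (eta x) \/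
     [set y | closure Q y /\ eta y = eta x] <> [set x])].

Definition contact_force (sigma : vmeasure R n) : Prop :=
  [/\ vmeasure_on (bdry Q) sigma, vmeasure_supp sigma `<=` contact_set &
      exists mu : {finite_measure set (borel_rV R n) -> \bar R},
        (forall A : set (borel_rV R n), measurable A ->
           A `&` bdry Q = set0 -> mu A = 0%E) /\
        forall phi : 'rV[R]_n -> 'rV[R]_n, {within bdry Q, continuous phi} ->
          vmeasure_integral sigma (bdry Q) phi =
          \int[mu]_(x in bdry Q) dotrV (phi x) (deformed_normal x)].

Definition action_reaction (sigma : vmeasure R n) : Prop :=
  forall phi : 'rV[R]_n -> 'rV[R]_n, continuous phi ->
    (exists K : set 'rV[R]_n,
       [/\ compact K, K `<=` Omega & forall x, ~ K x -> phi x = 0]) ->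
    vmeasure_integral sigma (bdry Q) (phi \o eta) = 0.

End contact_forces.

(* Main.v *)
(** Along [eta_ k] the determinants are bounded below and the normals
    [deformed_normal Q (eta_ k)] converge uniformly on [bdry Q], so testing the
    [k]-th contact force with its own unit normal bounds the mass of the scalar
    measures [mu_ k] with [sigma_ k = n_k mu_ k].  A subsequence of [mu_ k]
    converges weakly to some [mu], and [sigma := n mu] is the weak limit of
    [sigma_ k], also against uniformly convergent test functions, which gives
    the action-reaction principle.  For the support, the contact sets are upper
    semicontinuous: a self-contact of [eta_ k] cannot collapse to one point,
    because the [eta_ k] are uniformly injective on small balls up to the
    boundary.

    Weak compactness is obtained without the Riesz representation theorem:
    binary digits carry measures on a compact subset of R^n to the Cantor
    space, where the limit of the measures of the (countably many) cylinders is
    finitely additive, hence sigma-additive by compactness. *)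

From HB Require Import structures.
Require Import Defs.
From mathcomp Require Import all_boot all_order all_algebra.
From mathcomp Require Import all_classical all_reals all_analysis.
From mathcomp Require Import measurable_realfun ring lra.

Set Implicit Arguments.
Unset Strict Implicit.
Unset Printing Implicit Defensive.
Import Order.TTheory GRing.Theory Num.Theory.
Import numFieldNormedType.Exports.
Local Open Scope classical_set_scope.
Local Open Scope ring_scope.

(** * Integrals against finite measures and charges *)

(** Two obstacles shape the proof. Digits jump, so [code_row] is not continuous, and the limit of
    the masses of a coded cylinder need not be its mass under the limit measure. This does no harm:
    the limit measure returns to R^n through [decode_row], and a continuous function is compared on
    both sides with one and the same function of finitely many digits, because [truncation_row]
    approximates a point from its code and a decoded point from its digits equally well. Near the
    boundary [Q] is not convex, so an increment of [eta_ k] cannot be estimated along a straight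
    segment. A path of three segments, of length comparable to the distance of its ends, replaces
    it; it exists because the boundary is locally a Lipschitz graph. Integrals against charges refer
    to an arbitrarily chosen Hahn decomposition. They are handled through step functions, for which
    only the values of the charge on finitely many cells matter, so that the Jordan parts never have
    to be computed. *)

Section finite_measure_integrals.
Context d (T : measurableType d) (R : realType).
Variable mu : {finite_measure set T -> \bar R}.
Implicit Types (D : set T) (f g : T -> R).

Lemma bounded_integrable D f (M : R) : measurable D -> measurable_fun D f ->
  (forall x, D x -> `|f x| <= M) -> mu.-integrable D (EFin \o f).
Proof.
move=> mD mf fM; apply: measurable_bounded_integrable => //.
  by rewrite ltey_eq fin_num_measure.
exists M; split; first exact: num_real.
by move=> N MN x Dx; exact: le_trans (fM x Dx) (ltW MN).
Qed.

Lemma le_Rintegral_bound D f (M : R) : measurable D -> measurable_fun D f ->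
  (forall x, D x -> `|f x| <= M) ->
  `|\int[mu]_(x in D) f x| <= M * fine (mu D).
Proof.
move=> mD mf fM; apply: le_trans (le_normr_Rintegral mD _) _.
  exact: bounded_integrable fM.
rewrite -Rintegral_cst//; apply: le_Rintegral => //.
- apply: (@bounded_integrable _ _ M) => //; first exact: measurableT_comp.
  by move=> x Dx; rewrite normr_id; exact: fM.
- exact: (@bounded_integrable _ _ `|M|).
Qed.

Lemma Rintegral_partition (W : finType) (w : T -> W) D f : measurable D ->
  (forall i, measurable (D `&` w @^-1` [set i])) ->
  mu.-integrable D (EFin \o f) ->
  \int[mu]_(x in D) f x = \sum_i \int[mu]_(x in D `&` w @^-1` [set i]) f x.
Proof.
move=> mD mw intf; set F := fun i => D `&` w @^-1` [set i].
have DE : D = \big[setU/set0]_(i <- enum W) F i.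
  rewrite -bigcup_seq; apply/seteqP; split=> [x Dx|x [i _ []]//].
  by exists (w x) => //=; rewrite mem_enum.
have := @integral_bigsetU_EFin _ _ _ mu W F f (enum W) mw (enum_uniq _).
rewrite /= -DE => intE; rewrite /Rintegral intE; last 2 first.
- by move=> i j _ _ [x [[_ <-] [_ <-]]].
- by apply: measurable_int intf.
rewrite big_enum/= sum_fine// => i _.
apply: (@integrable_fin_num _ _ _ mu (F i)) => //; first exact: mw.
by apply: (@integrableS _ _ _ _ D) => //; [exact: mw|move=> x []].
Qed.

(** Reduces an integral to finitely many numbers, with an error that depends on the measure only
    through its mass, so that the same cells and values [a] serve several measures. The weight [g]
    is a density in [charge_integral_density] and [cst 1] elsewhere. *)
Lemma Rintegral_step_approx (W : finType) (w : T -> W) (a : W -> R) D f g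
    (e G M : R) :
  measurable D -> (forall i, measurable (D `&` w @^-1` [set i])) ->
  measurable_fun D f -> measurable_fun D g ->
  (forall x, D x -> `|f x - a (w x)| <= e) -> (forall x, D x -> `|g x| <= G) ->
  (forall x, D x -> `|f x| <= M) ->
  `|\int[mu]_(x in D) (f x * g x) -
    \sum_i a i * \int[mu]_(x in D `&` w @^-1` [set i]) g x|
  <= e * G * fine (mu D).
Proof.
move=> mD mw mf mg fa gG fM.
have mfg : measurable_fun D (fun x => f x * g x) by exact: measurable_funM.
have ifg : mu.-integrable D (EFin \o (fun x => f x * g x)).
  apply: (@bounded_integrable _ _ (M * G)) => // x Dx.
  by rewrite normrM ler_pM// ?fM ?gG.
have iSg i : mu.-integrable (D `&` w @^-1` [set i]) (EFin \o g).
  apply: (@bounded_integrable _ _ G) => //; last by move=> x [/gG].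
  by apply: measurable_funS mg => // x [].
rewrite (@Rintegral_partition _ w D) // -sumrB.
apply: le_trans (ler_norm_sum _ _ _) _.
have -> : fine (mu D) = \sum_i fine (mu (D `&` w @^-1` [set i])).
  have := @Rintegral_partition _ w D (cst 1) mD mw.
  rewrite Rintegral_cst// mul1r => ->.
    by apply: eq_bigr => i _; rewrite Rintegral_cst// mul1r.
  by apply: (@bounded_integrable _ _ 1) => // x _ /=; rewrite normr1.
rewrite mulr_sumr; apply: ler_sum => i _.
rewrite -RintegralZl// -RintegralB//; last 2 first.
- by apply: (@integrableS _ _ _ _ D) => // x [].
- apply: (@bounded_integrable _ _ (`|a i| * G)) => //.
    apply: measurable_funM => //.
    by apply: measurable_funS mg => // x [].
  by move=> x [Dx _]; rewrite normrM ler_wpM2l// gG.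
apply: le_Rintegral_bound => //.
  apply: measurable_funB; first by apply: measurable_funS mfg => // x [].
  apply: measurable_funM => //.
  by apply: measurable_funS mg => // x [].
move=> x [Dx <-]; rewrite -mulrBl normrM ler_pM// ?gG//.
exact: fa.
Qed.

End finite_measure_integrals.

Section charges.
Context d (T : measurableType d) (R : realType).
Implicit Types (D : set T) (f g : T -> R).

Lemma step_approximation D f (M e : R) : measurable D -> measurable_fun D f ->
  (forall x, D x -> `|f x| <= M) -> 0 < e ->
  exists (N : nat) (w : T -> 'I_N) (a : 'I_N -> R),
    (forall i, measurable (D `&` w @^-1` [set i])) /\
    forall x, D x -> `|f x - a (w x)| <= e.
Proof.
move=> mD mf fM e0.
(* The cells are bands of height [e] of the values of [f + M], which lie in [[0, M + M]] on [D]; the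
   last band has index [truncn ((M + M) / e)], whence the successor. *)
pose N := (Num.truncn ((M + M) / e)).+1.
pose w x : 'I_N := inord (Num.truncn ((f x + M) / e)).
have fM0 x : D x -> 0 <= (f x + M) / e.
  by move=> /fM; rewrite ler_norml => /andP[? _]; rewrite divr_ge0 ?(ltW e0)//;
    lra.
have wE x : D x -> w x = Num.truncn ((f x + M) / e) :> nat.
  move=> Dx; rewrite inordK// ltnS; apply: le_truncn.
  rewrite ler_pM2r ?invr_gt0// lerD2r.
  exact: le_trans (ler_norm _) (fM x Dx).
have wP x : D x -> (w x)%:R * e <= f x + M < ((w x)%:R + 1) * e.
  by move=> Dx; rewrite natr1 wE// -ler_pdivlMr// -ltr_pdivrMr// truncn_itv//
    fM0.
exists N, w, (fun i => i%:R * e - M); split.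
- move=> i.
  have -> : D `&` w @^-1` [set i] =
      D `&` f @^-1` `[(i%:R * e - M), ((i%:R + 1) * e - M)[%classic.
    apply/seteqP; split=> x [Dx] /=; rewrite in_itv/=.
      by move=> <-; split=> //; have /andP[h1 h2] := wP x Dx; apply/andP;
        split; lra.
    move=> /andP[h1 h2]; split=> //; apply/val_inj => /=; rewrite wE//.
    apply: truncn_def; rewrite -natr1 ler_pdivlMr// ltr_pdivrMr//; apply/andP;
      split; lra.
  exact: mf.
- move=> x /wP; rewrite ler_norml => /andP[h1 h2]; apply/andP; split; lra.
Qed.

(** The very term by which [charge_integral] selects its Hahn decomposition. *)
Let hP (nu : {charge set T -> \bar R}) :=
  svalP (cid (svalP (cid (Hahn_decomposition nu)))).

Lemma jordan_hahnE (nu : {charge set T -> \bar R}) (A : set T) : measurable A ->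
  fine (nu A) = fine (jordan_pos (hP nu) A) - fine (jordan_neg (hP nu) A).
Proof.
move=> mA; rewrite (jordan_decomp (hP nu) mA) /cadd/= fineD//.
- by rewrite /cscale fineM//; [rewrite [fine (-1)%:E]/= mulN1r|exact:
  fin_num_measure].
- exact: fin_num_measure.
- by rewrite /cscale/= fin_numM// fin_num_measure.
Qed.

End charges.

(** The triangle inequality that ends [charge_integral_density]: [I] is the integral with the
    density, [P] and [N] are those against the Jordan parts, and [p], [q] are the step sums of the
    latter. *)
Lemma jordan_split_bound (R : realFieldType) (I P N p q e' e G m jp jn : R) :
  `|I - (p - q)| <= e' * G * m -> `|P - p| <= e' * jp -> `|N - q| <= e' * jn ->
  e' * (jp + jn + G * m) <= e -> `|P - N - I| <= e.
Proof.
rewrite !ler_norml => /andP[h1 h2] /andP[h3 h4] /andP[h5 h6].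
by rewrite !mulrDr mulrA => h7; apply/andP; split; lra.
Qed.

Section charge_integral.
Context (R : realType) (n : nat).
Local Notation T := (borel_rV R n).
Implicit Types (D : set T) (f g : T -> R) (nu : {charge set T -> \bar R}).

(** For a step function both sides are the same finite sum, since on each cell the Jordan parts
    differ by the integral of [g]. A general [f] is uniformly close to step functions. *)
Lemma charge_integral_density nu (mu : {finite_measure set T -> \bar R}) D f g
    (M G : R) :
  measurable D -> measurable_fun D f -> measurable_fun D g ->
  (forall x, D x -> `|f x| <= M) -> (forall x, D x -> `|g x| <= G) ->
  (forall A, measurable A -> A `<=` D ->
     fine (nu A) = \int[mu]_(x in A) g x) ->
  charge_integral nu D f = \int[mu]_(x in D) (f x * g x).
Proof.
move=> mD mf mg fM gG nuE; rewrite /charge_integral.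
set h := svalP (cid (svalP (cid (Hahn_decomposition nu)))).
set C := fine (jordan_pos h D) + fine (jordan_neg h D) + G * fine (mu D).
apply/eqP; rewrite -subr_eq0 -normr_le0; apply/ler_addgt0Pl => e e0.
rewrite addr0.
have C0 : 0 <= `|C| by [].
(* The three approximation errors add up to [C] times the step height; the absolute value and the
   [1] spare a discussion of the sign of [C]. *)
have e'0 : 0 < e / (`|C| + 1) by rewrite divr_gt0// ltr_pwDr.
have [N [w [a [mw fa]]]] := step_approximation mD mf fM e'0.
have intp (m : {finite_measure set T -> \bar R}) :
  `|\int[m]_(x in D) f x -
    \sum_i a i * fine (m (D `&` w @^-1` [set i]))| <=
    e / (`|C| + 1) * fine (m D).
  have m1 : measurable_fun D (cst (1 : R)) by exact: measurable_cst.
  have := @Rintegral_step_approx _ _ _ m _ w a D f (cst 1) _ 1 _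
    mD mw mf m1 fa _ fM.
  rewrite mulr1; under [X in `|X - _|]eq_Rintegral do rewrite mulr1.
  under eq_bigr do rewrite Rintegral_cst// mul1r.
  by apply => x _; rewrite normr1.
have intg := @Rintegral_step_approx _ _ _ mu _ w a D f g _ _ _
  mD mw mf mg fa gG fM.
have aE : \sum_i a i * \int[mu]_(x in D `&` w @^-1` [set i]) g x =
    \sum_i a i * fine (jordan_pos h (D `&` w @^-1` [set i])) -
    \sum_i a i * fine (jordan_neg h (D `&` w @^-1` [set i])).
  rewrite -sumrB; apply: eq_bigr => i _.
  by rewrite -mulrBr -jordan_hahnE// nuE// => x [].
rewrite aE in intg.
apply: (jordan_split_bound intg (intp _) (intp _)).
rewrite mulrAC ler_pdivrMr ?ltr_pwDr// ler_wpM2l ?(ltW e0)//.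
by rewrite -/C (le_trans (ler_norm _))// lerDl.
Qed.

End charge_integral.

(** * Weak compactness of finite measures *)

(* The limits are the coordinates of a cluster point in the product space. *)
Lemma diagonal_subsequence (R : realType) (a : nat -> nat -> R) (M : R) :
  (forall i k, `|a i k| <= M) ->
  exists s : nat -> nat, {homo s : i j / (i < j)%N} /\
    forall i, cvg (a i (s k) @[k --> \oo]).
Proof.
move=> aM.
pose X := prod_topology (fun _ : nat => R).
pose K := [set f : X | forall i, `[- M, M]%classic (f i)].
have cK : compact K.
  by apply: (@tychonoff _ (fun=> R) (fun=> `[- M, M]%classic)) => i;
    exact: segment_compact.
pose u k : X := fun i => a i k.
have [|l [_ lu]] := cK (u @ \oo) _ _.
  by exists 0%N => // k _ i; rewrite /u/= in_itv/= -ler_norml.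
(* The number of controlled coordinates grows while the tolerance shrinks, so a sequence with
   [u (s m)] in [P m] converges in every coordinate. *)
pose P m : set X := [set f | forall i, (i < m)%N -> `|f i - l i| < m.+1%:R^-1].
have FF : Filter (nbhs l) by exact: nbhs_filter.
have Pl m : nbhs l (P m).
  suff H e : 0 < e -> nbhs l [set f : X | forall i, (i < m)%N ->
    `|f i - l i| < e].
    by apply: H; rewrite invr_gt0.
  move=> e0; elim: m => [|m IH]; first by apply: filterS filterT => f _ i.
  have lm : nbhs l [set f : X | `|f m - l m| < e].
    apply: (@proj_continuous _ (fun _ : nat => R) m l [set r | `|r - l m| < e]).
    apply/nbhs_ballP; exists e => //= r.
    by rewrite -ball_normE /ball_/= distrC.
  apply: (@filterS2 _ _ FF _ _ _ _ IH lm) => f fm fm' i.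
  by rewrite ltnS leq_eqVlt => /predU1P[->//|]; exact: fm.
have ex m N : exists k, (N < k)%N && `[< P m (u k) >].
  have uN : (u @ \oo) [set u k | k in [set k | (N < k)%N]].
    by exists N.+1 => // k /= Nk; exists k.
  have [f [[k Nk <-] Pk]] := lu _ _ uN (Pl m).
  by exists k; rewrite Nk; apply/asboolP.
pose s := fix s m := if m is m'.+1 then xchoose (ex m (s m')) else xchoose (ex
  0 0).
have exP m N := xchooseP (ex m N).
have sP m : P m (u (s m)).
  by case: m => [|m] /=; [move: (exP 0%N 0%N)|move: (exP m.+1 (s m))] =>
    /andP[_ /asboolP].
have sS m : (s m < s m.+1)%N by move: (exP m.+1 (s m)) => /andP[].
exists s; split.
  by apply: homo_ltn => // ? ? ?; exact: ltn_trans.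
move=> i; apply/cvg_ex; exists (l i); apply/cvgrPdist_lt => e e0.
near=> k; rewrite distrC.
apply: (@lt_trans _ _ k.+1%:R^-1).
  by apply: sP; near: k; exact: nbhs_infty_gt.
by near: k; exact: near_infty_natSinv_lt (PosNum e0).
Unshelve. all: by end_near. Qed.

(** * Finite measures on the Cantor space from additive functions of cylinders *)

Section cantor_content.
Variable n : nat.

Definition bits := prod_topology (fun _ : 'I_n * nat => bool).

HB.instance Definition _ := Pointed.on bits.
HB.instance Definition _ := Topological.on bits.

Definition prefix_bits (m : nat) (b : bits) : {ffun 'I_n * 'I_m -> bool} :=
  [ffun ij : 'I_n * 'I_m => b (ij.1, ij.2 : nat)].

(** The code by a depth and a finite set of prefixes makes the cylinders countable, which the
    diagonal extraction needs. *)
Definition cylinder (m : nat) (W : {set {ffun 'I_n * 'I_m ->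
  bool}}) : set bits :=
  [set b | prefix_bits m b \in W].

Definition cylinders : set (set bits) :=
  [set A | exists m W, A = @cylinder m W].

Lemma prefix_bits_widen (m p : nat) (b c : bits) : (m <= p)%N ->
  prefix_bits p b = prefix_bits p c -> prefix_bits m b = prefix_bits m c.
Proof.
move=> mp /ffunP bc; apply/ffunP => -[i j]; rewrite !ffunE/=.
by have := bc (i, widen_ord mp j); rewrite !ffunE.
Qed.

(** Frees cylinders from their code: only the existence of a sufficient depth matters, and the
    maximum of two depths serves two cylinders. *)
Lemma cylindersP (A : set bits) : cylinders A <->
  exists m, forall b c, prefix_bits m b = prefix_bits m c -> A b -> A c.
Proof.
split=> [[m [W ->]]|[m Am]].
  by exists m => b c; rewrite /cylinder/= => ->.
exists m, [set w | `[< exists2 b, A b & prefix_bits m b = w >]]%SET.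
apply/seteqP; split=> [b Ab|b]; rewrite /cylinder/= inE.
  by apply/asboolP; exists b.
by move=> /asboolP[c Ac cb]; exact: Am cb Ac.
Qed.

Lemma cylinders0 : cylinders set0.
Proof. by apply/cylindersP; exists 0%N. Qed.

Lemma cylindersU : setU_closed cylinders.
Proof.
move=> A B /cylindersP[m Am] /cylindersP[p Bp]; apply/cylindersP.
exists (maxn m p) => b c bc [Ab|Bb]; [left|right].
  exact: Am (prefix_bits_widen (leq_maxl _ _) bc) Ab.
exact: Bp (prefix_bits_widen (leq_maxr _ _) bc) Bb.
Qed.

Lemma cylindersC : setC_closed cylinders.
Proof.
move=> A /cylindersP[m Am]; apply/cylindersP.
by exists m => b c bc nAb Ac; apply: nAb; apply: Am Ac.
Qed.

Lemma open_cylinder (A : set bits) : cylinders A -> open A.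
Proof.
move=> [m [W ->]]; rewrite openE => b Wb.
have : \forall c \near b, forall ij : 'I_n * 'I_m,
    c (ij.1, ij.2 : nat) = b (ij.1, ij.2 : nat).
  suff H : forall ij : 'I_n * 'I_m, nbhs b
      [set c : bits | c (ij.1, ij.2 : nat) = b (ij.1, ij.2 : nat)].
    have FF : Filter (nbhs b) by apply: nbhs_filter.
    exact: (@filter_forall _ ('I_n * 'I_m)%type _ _ FF H).
  move=> [i j] /=.
  have /= := @proj_continuous _ (fun _ : 'I_n * nat => bool) (i, j : nat) b.
  by move=> /(_ [set b (i, j : nat)]); apply; exact: discrete_set1.
rewrite /interior; apply: filterS => c cb; rewrite /cylinder/=.
by have -> : prefix_bits m c = prefix_bits m b;
   [apply/ffunP => ij; rewrite !ffunE; exact: cb|].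
Qed.

Lemma compact_cylinder (A : set bits) : cylinders A -> compact A.
Proof.
move=> cA; apply: (@subclosed_compact _ _ [set: bits]) => //.
  by rewrite -openC; apply/open_cylinder/cylindersC.
have := @tychonoff _ (fun _ : 'I_n * nat => bool) _ (fun=> bool_compact).
by congr (compact _); rewrite eqEsubset.
Qed.

Definition bits_display : measure_display. Proof. exact. Qed.

Definition bits_algebra : Type := bits.
HB.instance Definition _ := Pointed.on bits_algebra.
HB.instance Definition _ := @isAlgebraOfSets.Build bits_display bits_algebra
  cylinders cylinders0 cylindersU cylindersC.

Definition bits_borel := g_sigma_algebraType (@measurable _ bits_algebra).

Section extension.
Variables (R : realType) (nu : set bits -> R).
Hypothesis nu_ge0 : forall A, cylinders A -> 0 <= nu A.
Hypothesis nuU : forall A B, cylinders A -> cylinders B -> A `&` B = set0 ->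
  nu (A `|` B) = nu A + nu B.

Let nu0 : nu set0 = 0.
Proof.
have := nuU cylinders0 cylinders0 (setI0 set0); rewrite setU0 => /eqP.
by rewrite -subr_eq0 opprD addrA subrr sub0r oppr_eq0 => /eqP.
Qed.

(** A measure has to be non-negative on every set, and [nu] is known to be so on cylinders only;
    there the absolute value changes nothing. *)
Let f (A : set bits_algebra) : \bar R := (`|nu A|)%:E.

Let f0 : f set0 = 0%E. Proof. by rewrite /f nu0 normr0. Qed.

Let f_ge0 A : (0 <= f A)%E. Proof. by rewrite /f lee_fin. Qed.

Let fU A B : cylinders A -> cylinders B -> A `&` B = set0 ->
  f (A `|` B) = (f A + f B)%E.
Proof.
move=> cA cB AB; rewrite /f nuU// !ger0_norm// ?addr_ge0//; by exact: nu_ge0.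
Qed.

(* A cylinder that is a countable disjoint union of cylinders is, by
   compactness, a finite one. *)
Let f_sigma_additive : semi_sigma_additive f.
Proof.
move=> F mF tF mUF.
have [N FN] : exists N, \bigcup_i F i `<=` \bigcup_(i < N) F i.
  have := compact_cylinder mUF.
  move=> /compact_near_coveringP/(_ nat \oo
    (fun N b => (\bigcup_(i < N) F i) b)) [].
    move=> b [i _ Fib]; near=> c N; exists i => /=.
      by near: N; exact: nbhs_infty_gt.
    near: c; apply: open_nbhs_nbhs; split=> //.
    exact: open_cylinder (mF i).
  by move=> N _ FN; exists N; exact: (FN N (leqnn N)).
have F0 i : (N <= i)%N -> F i = set0.
  move=> Ni; apply/seteqP; split=> // b Fb.
  have [j /= jN Fj] := FN b (ex_intro2 _ _ i I Fb).
  have ij : i = j by apply: tF => //; exists b.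
  by move: jN; rewrite -ij ltnNge Ni.
have cylUF k : cylinders (\big[setU/set0]_(i < k) F i).
  elim/big_ind : _ => //; [exact: cylinders0|exact: cylindersU|].
  by move=> i _; exact: mF.
have fF : forall p, f (\big[setU/set0]_(i < p) F i) = (\sum_(0 <= i < p) f (F
  i))%E.
  elim=> [|j IH]; first by rewrite big_ord0 big_nil f0.
  rewrite big_ord_recr big_nat_recr//= fU;
    [by rewrite IH|exact: cylUF|exact: mF|].
  apply/seteqP; split=> // b []; rewrite -bigcup_mkord => -[i /= ij Fib] Fjb.
  have eij : i = j by apply: tF => //; exists b.
  by rewrite eij ltnn in ij.
apply: cvg_near_cst; near=> k.
rewrite -fF; congr f.
apply/seteqP; split=> b; first by rewrite -bigcup_mkord => -[i _ ?]; exists i.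
move=> /FN[i /= iN Fi]; rewrite -bigcup_mkord; exists i => //=.
by apply: leq_trans iN _; near: k; exact: nbhs_infty_ge.
Unshelve. all: by end_near. Qed.

HB.instance Definition _ := isMeasure.Build _ _ _ f f0 f_ge0 f_sigma_additive.

(** Carathéodory extension from the algebra of cylinders, where [f] is sigma-additive by
    compactness; the mass [nu setT] is a real number, so the extension is finite. *)
Lemma cylinder_measure_exists :
  exists mu : {finite_measure set bits_borel -> \bar R},
    forall A, cylinders A -> mu A = (nu A)%:E.
Proof.
pose mu := [the {measure set bits_borel -> \bar R} of measure_extension f].
have muE A : cylinders A -> mu A = (nu A)%:E.
  by move=> cA; rewrite /mu/= /measure_extension measurable_mu_extE//= /f
    ger0_norm// nu_ge0.
have fin_mu : fin_num_fun mu.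
  have cT : cylinders setT by apply/cylindersP; exists 0%N.
  by apply: lty_fin_num_fun; have := ltry (nu setT); rewrite -muE.
pose m : {finite_measure set bits_borel -> \bar R} :=
  HB.pack (Measure.sort mu) (Measure_isFinite.Build _ _ _ mu fin_mu).
by exists m.
Qed.

End extension.
End cantor_content.

Section row_norms.
Variables (R : realType) (m n : nat).
Implicit Types (x : 'M[R]_(m, n)) (e : R).

Lemma coord_le_norm x i j : `|x i j| <= `|x|.
Proof.
rewrite [leRHS]/Num.norm /= mx_normrE; apply/bigmax_geP; right.
by exists (i, j).
Qed.

Lemma norm_le_coord x e : 0 <= e -> (forall i j, `|x i j| <= e) -> `|x| <= e.
Proof.
move=> e0 xe; rewrite [leLHS]/Num.norm /= mx_normrE.
by apply/bigmax_leP; split=> // -[i j] _; exact: xe.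
Qed.

End row_norms.

Section borel_measurability.
Variables (R : realType) (n : nat).
Local Notation T := (borel_rV R n).

Lemma open_measurable_rV (U : set T) : open (U : set 'rV[R]_n) -> measurable U.
Proof. by move=> oU; exact: sub_sigma_algebra. Qed.

Lemma closed_measurable_rV (K : set T) :
  closed (K : set 'rV[R]_n) -> measurable K.
Proof.
move=> cK; rewrite -(setCK K); apply: measurableC.
by apply: open_measurable_rV; rewrite openC.
Qed.

Lemma within_continuous_measurable (K : set 'rV[R]_n) (f : 'rV[R]_n -> R) :
  measurable (K : set T) -> {within K, continuous f} ->
  measurable_fun (K : set T) (f : T -> R).
Proof.
move=> mK /continuousP cf.
apply: (measurability _ (RGenOpens.measurableE R)) => _ [_ [a [b ->]] <-].
have /open_subspaceP[V oV VK] := cf _ (@interval_open R (BSide false a) (BSide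
  true b) isT isT).
rewrite setIC -VK; apply: measurableI => //; exact: open_measurable_rV.
Qed.

Lemma measurable_coord (i : 'I_n) :
  measurable_fun [set: T] (fun x : T => (x : 'rV[R]_n) 0 i).
Proof.
apply: within_continuous_measurable => //.
by apply: continuous_subspaceT; exact: coord_continuous.
Qed.

End borel_measurability.

(* A point [t] of [-M, M] is expanded greedily as the sum of the
   [+- M / 2 ^ (m + 1)], the sign being that of the current remainder;
   [residual t m] is [2 ^ m] times the remainder after [m] digits. *)
Section signed_binary_expansion.
Variables (R : realType) (M : R).
Hypothesis M0 : 0 <= M.

Let term (b : bool) : R := if b then M else - M.

Fixpoint residual (t : R) (m : nat) : R :=
  if m is m'.+1 then 2 * residual t m' - term (0 <= residual t m') else t.

Definition digit (t : R) (m : nat) : bool := 0 <= residual t m.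

Fixpoint truncation (b : nat -> bool) (m : nat) : R :=
  if m is m'.+1 then truncation b m' + term (b m') / 2 ^+ m'.+1 else 0.

(** The intervals of centre [truncation b m] and radius [M / 2 ^+ m] are nested, so the supremum of
    their left ends belongs to all of them. Every sequence of digits thus has a value, whether or
    not it is the expansion of a point. *)
Definition decode (b : nat -> bool) : R :=
  sup (range (fun m => truncation b m - M / 2 ^+ m)).

Lemma norm_residual (t : R) m : `|t| <= M -> `|residual t m| <= M.
Proof.
move=> tM; elim: m => //= m; rewrite /term !ler_norml => /andP[h1 h2].
by case: ifPn => [h|]; [|rewrite -ltNge => h]; apply/andP; split; lra.
Qed.

Lemma truncation_residual (t : R) m :
  truncation (digit t) m + residual t m / 2 ^+ m = t.
Proof.
elim: m => [|m IH] /=; first by rewrite expr0 divr1 add0r.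
rewrite -[RHS]IH /digit exprS; field.
by rewrite expf_neq0.
Qed.

Lemma truncation_digit (t : R) m :
  `|t| <= M -> `|t - truncation (digit t) m| <= M / 2 ^+ m.
Proof.
move=> tM; rewrite -{1}(truncation_residual t m) addrAC subrr add0r.
rewrite normrM normfV (@ger0_norm _ (2 ^+ m)) ?exprn_ge0//.
by rewrite ler_wpM2r ?norm_residual// invr_ge0 exprn_ge0.
Qed.

Lemma eq_truncation (b c : nat -> bool) m :
  (forall j, (j < m)%N -> b j = c j) -> truncation b m = truncation c m.
Proof.
elim: m => //= m IH bc; rewrite IH ?bc// => j jm.
by apply: bc; exact: ltnW.
Qed.

Let lower_upper (b : nat -> bool) m p :
  truncation b m - M / 2 ^+ m <= truncation b p + M / 2 ^+ p.
Proof.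
(* Each digit selects one half of the current interval: left ends increase, right ends decrease, and
   depth [maxn m p] compares the two. *)
have step q : M / 2 ^+ q = M / 2 ^+ q.+1 + M / 2 ^+ q.+1.
  by rewrite exprS; field; rewrite expf_neq0.
have pos q : 0 <= M / 2 ^+ q by rewrite divr_ge0// exprn_ge0.
have low : {homo (fun q => truncation b q - M / 2 ^+ q) : i j / (i <= j)%N >->
  i <= j}.
  apply: homo_leq => [//|? ? ?|q]; first exact: le_trans.
  rewrite /= (step q) /term; have := pos q.+1.
  by case: (b q); rewrite ?mulNr; lra.
have up : {homo (fun q => truncation b q + M / 2 ^+ q) : i j / (i <= j)%N >-> j
  <= i}.
  apply: homo_leq => [//|? ? ? ? h|q]; first exact: le_trans h _.
  rewrite /= (step q) /term; have := pos q.+1.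
  by case: (b q); rewrite ?mulNr; lra.
have := low _ _ (leq_maxl m p); have := up _ _ (leq_maxr m p) => /=.
by have := pos (maxn m p); lra.
Qed.

Lemma decode_truncation (b : nat -> bool) m :
  `|decode b - truncation b m| <= M / 2 ^+ m.
Proof.
rewrite ler_distl; apply/andP; split.
- apply: ub_le_sup; last by exists m.
  by exists (truncation b 0 + M / 2 ^+ 0) => _ [p _ <-]; exact: lower_upper.
- apply: ge_sup; first by exists (truncation b 0 - M / 2 ^+ 0); exists 0%N.
  by move=> _ [p _ <-]; exact: lower_upper.
Qed.

Section rows.
Variable n : nat.
Local Notation T := (borel_rV R n).

Definition code_row (x : 'rV[R]_n) : bits n := fun ij => digit (x 0 ij.1) ij.2.

Definition truncation_row (m : nat) (b : bits n) : 'rV[R]_n :=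
  \row_i truncation (fun j => b (i, j)) m.

Definition decode_row (b : bits n) : 'rV[R]_n :=
  \row_i decode (fun j => b (i, j)).

Lemma truncation_row_prefix m (b c : bits n) :
  prefix_bits m b = prefix_bits m c -> truncation_row m b = truncation_row m c.
Proof.
move=> /ffunP bc; apply/rowP => i; rewrite !mxE.
apply: eq_truncation => j jm.
by have := bc (i, Ordinal jm); rewrite !ffunE.
Qed.

Lemma truncation_code_row m (x : 'rV[R]_n) :
  `|x| <= M -> `|x - truncation_row m (code_row x)| <= M / 2 ^+ m.
Proof.
move=> xM; apply: norm_le_coord => [|i j].
  by rewrite divr_ge0// exprn_ge0.
rewrite ord1 !mxE; apply: truncation_digit.
by apply: le_trans xM; exact: coord_le_norm.
Qed.

Lemma truncation_decode_row m (b : bits n) :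
  `|decode_row b - truncation_row m b| <= M / 2 ^+ m.
Proof.
apply: norm_le_coord => [|i j].
  by rewrite divr_ge0// exprn_ge0.
by rewrite ord1 !mxE; exact: decode_truncation.
Qed.

Lemma measurable_digit (i : 'I_n) (j : nat) (v : bool) :
  measurable [set x : T | digit ((x : 'rV[R]_n) 0 i) j = v].
Proof.
have mr : measurable_fun [set: T] (fun x : T =>
  residual ((x : 'rV[R]_n) 0 i) j).
  elim: j => [|j IH] /=; first exact: measurable_coord.
  apply: measurable_funB; first exact: measurable_funM.
  rewrite /term; apply: measurable_fun_ifT => //.
  exact: measurable_fun_ler.
rewrite (_ : [set _ | _] = setT `&` (fun x : T =>
  residual ((x : 'rV[R]_n) 0 i) j)
    @^-1` (if v then `[0, +oo[%classic else `]-oo, 0[%classic)).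
  by apply: mr => //; case: v.
apply/seteqP; split=> x /=; rewrite /digit.
  by move=> <-; split=> //; case: (lerP 0) => /= h; rewrite in_itv/= ?h.
by case: v => -[_] /=; rewrite in_itv/= ?andbT// ltNge => /negbTE.
Qed.

Lemma measurable_code_cylinder (A : set (bits n)) :
  cylinders A -> measurable (code_row @^-1` A : set T).
Proof.
move=> [m [W ->]].
rewrite (_ : _ @^-1` _ = \bigcup_(w in [set` W])
    \bigcap_(ij in [set: 'I_n * 'I_m])
      [set x : T | digit ((x : 'rV[R]_n) 0 ij.1) ij.2 = w ij]).
  apply: fin_bigcup_measurable; first exact: finite_finset.
  move=> w _; apply: fin_bigcap_measurable; first exact: finite_finset.
  by move=> ij _; exact: measurable_digit.
apply/seteqP; split=> x.
  move=> xW; exists (prefix_bits m (code_row x)) => // -[i j] _.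
  by rewrite /= ffunE.
move=> [w wW xw]; rewrite /cylinder/=.
suff -> : prefix_bits m (code_row x) = w by [].
by apply/ffunP => -[i j]; rewrite ffunE; exact: (xw (i, j)).
Qed.

Lemma small_expn2_exists (e : R) : 0 < e -> exists m, M / 2 ^+ m < e.
Proof.
move=> e0; have := @cvg_geometric R M 2^-1 _.
rewrite ger0_norm// invf_lt1// => /(_ (ltr1n _ 2)) /cvgrPdist_lt/(_ e e0)[m _
  h].
exists m; have := h m (leqnn m); rewrite sub0r normrN /geometric/= exprVn.
by rewrite ger0_norm// divr_ge0// exprn_ge0.
Qed.

Lemma decode_row_open (U : set 'rV[R]_n) (b : bits n) : open U ->
  U (decode_row b) ->
  exists m, forall y, `|y - truncation_row m b| <= M / 2 ^+ m -> U y.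
Proof.
move=> oU Ub; have /nbhs_ballP[e /= e0 eU] := open_nbhs_nbhs (conj oU Ub).
have [m me] := small_expn2_exists (divr_gt0 e0 (ltr0n _ 2)).
exists m => y ym; apply: eU; rewrite -ball_normE /ball_/=.
rewrite (splitr e); apply: le_lt_trans (ler_distD (truncation_row m b) _ _) _.
apply: ltrD; first exact: le_lt_trans (truncation_decode_row m b) me.
by rewrite distrC; exact: le_lt_trans ym me.
Qed.

(** Each set of the union depends on a truncation only and is a cylinder. This makes [decode_row]
    measurable and, for the complement of a compact set, shows that the limit measure does not
    charge it. *)
Lemma decode_row_preimage (U : set 'rV[R]_n) : open U ->
  decode_row @^-1` U = \bigcup_m
    [set b | forall y, `|y - truncation_row m b| <= M / 2 ^+ m -> U y].
Proof.
move=> oU; apply/seteqP; split=> b; first by move=> /(decode_row_open oU)[m];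
  exists m.
by move=> [m _]; apply; exact: truncation_decode_row.
Qed.

Lemma truncation_cylinder m (P : 'rV[R]_n -> Prop) :
  cylinders [set b | P (truncation_row m b)].
Proof.
apply/cylindersP; exists m => b c bc /=.
by rewrite (truncation_row_prefix bc).
Qed.

Lemma measurable_decode_row :
  measurable_fun [set: bits_borel n] (decode_row : bits_borel n -> T).
Proof.
apply: (@measurability _ _ (bits_borel n) T _ _ (@open 'rV[R]_n)) => //.
move=> _ [U oU <-]; rewrite setTI (decode_row_preimage oU).
apply: bigcup_measurable => m _; apply: sub_sigma_algebra.
exact: (truncation_cylinder m (fun z => forall y, `|y - z| <= M / 2 ^+ m ->
  U y)).
Qed.

End rows.
End signed_binary_expansion.

Lemma finite_pushforward d1 d2 (T1 : measurableType d1) (T2 : measurableType d2)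
    (R : realType) (mu : {finite_measure set T1 -> \bar R}) (h : T1 -> T2) :
  measurable_fun [set: T1] h ->
  exists nu : {finite_measure set T2 -> \bar R},
    (forall A, nu A = mu (h @^-1` A)) /\
    forall (D : set T2) (f : T2 -> R) (M : R), measurable D ->
      measurable_fun D f -> (forall x, D x -> `|f x| <= M) ->
      \int[nu]_(x in D) f x = \int[mu]_(x in h @^-1` D) f (h x).
Proof.
move=> mh.
have mpre A : measurable A -> measurable (h @^-1` A).
  by move=> mA; rewrite -[X in measurable X]setTI; exact: mh.
pose m0 := [the {measure set T2 -> \bar R} of pushforward mu h].
pose m := m0 mh.
have fm : fin_num_fun m by move=> A mA;
  rewrite /m/= /pushforward fin_num_measure//; exact: mpre.
pose nu : {finite_measure set T2 -> \bar R} :=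
  HB.pack (Measure.sort m) (Measure_isFinite.Build _ _ _ m fm).
exists nu; split=> // D f M mD mf fM.
(* The change of variables is applied to the extension of [f] by zero, because [f] is measurable on
   [D] only. *)
have mfD : measurable_fun [set: T2] (EFin \o (f \_ D)).
  apply/measurable_EFinP.
  by move/(measurable_restrictT _ _).1 : mf; exact.
transitivity (fine (\int[nu]_(x in D) ((EFin \o (f \_ D)) x))%E).
  congr fine; apply: eq_integral => x xD /=; by rewrite patchT.
have := @integral_pushforward _ _ _ _ _ h mh mu D (EFin \o (f \_ D)) mfD _ mD.
rewrite /nu/= /m/= => ->; last first.
  apply: (@bounded_integrable _ _ _ mu _ _ M); first exact: mpre.
    by apply: measurable_funTS; apply: (measurableT_comp _ mh);
      exact/measurable_EFinP.
  by move=> x /= hx; rewrite patchT ?inE//; exact: fM.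
by congr fine; apply: eq_integral => x; rewrite inE/= => xD;
  rewrite patchT ?inE.
Qed.

Section compact_continuity.
Variables (R : realType) (V W : normedModType R) (K D : set V) (f : V -> W).
Hypotheses (cK : compact K) (KD : K `<=` D) (cf : {within D, continuous f}).

Lemma within_continuous_ball (x : V) (e : R) : D x -> 0 < e ->
  exists2 r : R, 0 < r & forall y, D y -> `|x - y| < r -> `|f x - f y| < e.
Proof.
move=> Dx e0; have := (subspace_continuousP D f).1 cf x Dx.
move=> /cvgrPdist_lt /(_ e e0).
rewrite near_withinE => /nbhs_ballP[r /= r0 rP]; exists r => // y Dy xy.
by apply: rP => //; rewrite -ball_normE.
Qed.

Lemma compact_within_bounded : exists2 B : R, 0 <= B & forall x, K x ->
  `|f x| <= B.
Proof.
have /compact_bounded[B [Breal BP]] :=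
  continuous_compact (continuous_subspaceW KD cf) cK.
exists (`|B| + 1); first by rewrite addr_ge0.
move=> x Kx; apply: (BP (`|B| + 1)); last by exists x.
by rewrite (le_lt_trans (ler_norm B))// ltrDl.
Qed.

(** Only one of the two points has to lie in [K]. For the action-reaction principle [K] is the image
    of the boundary under the limit deformation, and the other point, an image under [eta_ k], may
    leave it. *)
Lemma compact_within_unif_continuous (e : R) : 0 < e ->
  exists2 d : R, 0 < d & forall x y, K x -> D y -> `|x - y| < d ->
    `|f x - f y| < e.
Proof.
move=> e0.
have /(_ R (0^'+)) H := (compact_near_coveringP K).1 cK.
have : \forall d \near 0^'+, K `<=` [set x | K x -> forall y, D y ->
  `|x - y| < d -> `|f x - f y| < e].
  apply: H => x Kx.
  have [r r0 rP] := within_continuous_ball (KD Kx) (divr_gt0 e0 (ltr0n _ 2)).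
  have r20 : 0 < r / 2 by rewrite divr_gt0.
  near=> x' d => /= Kx' y Dy xyd.
  have Dx' := KD Kx'.
  have xx' : `|x - x'| < r / 2.
    by near: x'; apply/nbhs_ballP; exists (r / 2) => //= z; rewrite -ball_normE.
  have dr : d <= r / 2 by near: d; exact: nbhs_right_le.
  rewrite (splitr e) (le_lt_trans (ler_distD (f x) _ _))// ltrD//.
    by rewrite distrC rP// (lt_trans xx')// ltr_pdivrMr// ltr_pMr// ltr1n.
  apply: rP => //; rewrite (splitr r) (le_lt_trans (ler_distD x' _ _))// ltrD//.
  exact: lt_le_trans xyd dr.
move=> Hd; near (0 : R)^'+ => d.
exists d => [|x y Kx Dy]; first by near: d; exact: nbhs_right_gt.
by apply: (near Hd d).
Unshelve. all: by end_near. Qed.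

End compact_continuity.

(** * Weak subsequential limits of finite measures on a compact subset of R^n *)

Section weak_compactness.
Variables (R : realType) (n : nat).
Local Notation T := (borel_rV R n).

Let cylinder_of (i : nat) : set (bits n) :=
  if @unpickle {m : nat & {set {ffun 'I_n * 'I_m -> bool}}} i is Some t
  then cylinder (tagged t) else set0.

Let cylinder_of_surj (A : set (bits n)) : cylinders A ->
  exists i, A = cylinder_of i.
Proof.
move=> [m [W ->]].
exists (pickle (Tagged (fun m => {set {ffun 'I_n * 'I_m -> bool}}) W)).
by rewrite /cylinder_of pickleK.
Qed.

Let cylinder_ofP i : cylinders (cylinder_of i).
Proof.
rewrite /cylinder_of; case: unpickle => [[m W]|]; last exact: cylinders0.
by exists m, W.
Qed.

Theorem finite_measures_weakly_compact (K : set 'rV[R]_n)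
    (mu_ : nat -> {finite_measure set T -> \bar R}) (C : R) :
  compact K -> (forall k, fine (mu_ k K) <= C) ->
  exists (s : nat -> nat) (mu : {finite_measure set T -> \bar R}),
    [/\ {homo s : i j / (i < j)%N}, mu (~` K) = 0%E &
        forall f : 'rV[R]_n -> R, {within K, continuous f} ->
          \int[mu_ (s k)]_(x in K) f x @[k --> \oo] --> \int[mu]_(x in K) f x].
Proof.
move=> cK muC.
have clK : closed K by apply: compact_closed => //; exact: norm_hausdorff.
have mK : measurable (K : set T) by exact: closed_measurable_rV.
have [M M0 KM] : exists2 M : R, 0 <= M & forall x, K x -> `|x| <= M.
  apply: (@compact_within_bounded _ _ _ K K id cK) => //.
  by apply: continuous_subspaceT => ?; exact: cvg_id.
have C0 : 0 <= C by apply: le_trans (muC 0%N); exact: fine_ge0.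
pose e := @code_row R M n; pose d := @decode_row R M n.
have me A : cylinders A -> measurable (K `&` e @^-1` A : set T).
  by move=> cA; apply: measurableI => //; exact: measurable_code_cylinder.
pose a k (A : set (bits n)) := fine (mu_ k (K `&` e @^-1` A)).
have a_ge0 k A : 0 <= a k A by exact: fine_ge0.
have a_leC k A : cylinders A -> a k A <= C.
  move=> cA; apply: le_trans (muC k); apply: fine_le.
  - by apply: fin_num_measure; exact: me.
  - exact: fin_num_measure.
  - by apply: le_measure; rewrite ?inE//; exact: me.
have aU k A B : cylinders A -> cylinders B -> A `&` B = set0 ->
    a k (A `|` B) = a k A + a k B.
  move=> cA cB AB; rewrite /a preimage_setU setIUr measureU;
    [|exact: me|exact: me|].
  - by rewrite fineD//; apply: fin_num_measure; exact: me.
  - by rewrite setIACA -(@preimage_setI _ _ e) AB preimage_set0 setI0.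
have [i k|s [s_incr cvg_s]] :=
    @diagonal_subsequence R (fun i k => a k (cylinder_of i)) C.
  by rewrite ger0_norm// a_leC.
pose nu A := limn (fun k => a (s k) A).
have cvg_nu A : cylinders A -> a (s k) A @[k --> \oo] --> nu A.
  by move=> /cylinder_of_surj[i ->]; exact: cvg_s.
have nu_ge0 A : cylinders A -> 0 <= nu A.
  by move=> /cvg_nu nuA; apply: limr_ge; [apply/cvg_ex; exists (nu A)|near=> k].
have nuU A B : cylinders A -> cylinders B -> A `&` B = set0 ->
    nu (A `|` B) = nu A + nu B.
  move=> cA cB AB; apply/cvg_lim => //.
  under eq_fun do rewrite aU//.
  by apply: cvgD; exact: cvg_nu.
have [lam lamE] := cylinder_measure_exists nu_ge0 nuU.
have [mu [muE mu_int]] := finite_pushforward lam (measurable_decode_row M0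
  (n:=n)).
have cT : cylinders [set: bits n] by rewrite -setC0; apply: cylindersC;
  exact: cylinders0.
have mcyl A : cylinders A -> measurable (A : set (bits_borel n)).
  by move=> cA; exact: sub_sigma_algebra.
(* A code that decodes outside [K] has a truncation whose whole cube misses [K], that is, it lies in
   some [P m]. No point of [K] has its code in [P m], so this cylinder has mass zero before the
   limit and hence in the limit. *)
have lam_null : lam (d @^-1` (~` K)) = 0%E.
  have oK : open (~` K) by rewrite openC.
  pose P m := [set b : bits n |
    forall y, `|y - truncation_row M m b| <= M / 2 ^+ m -> (~` K) y].
  have cP m : cylinders (P m).
    exact: (truncation_cylinder M m
      (fun z => forall y : 'rV[R]_n, `|y - z| <= M / 2 ^+ m -> (~` K) y)).
  have -> : d @^-1` (~` K) = \bigcup_m P m by exact: decode_row_preimage.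
  apply/eqP; rewrite -measure_le0.
  apply: le_trans (measure_sigma_subadditive _ _ _ (@subset_refl _ _)) _.
  - by move=> m; exact: mcyl.
  - by apply: bigcupT_measurable => m; exact: mcyl.
  suff lamP m : lam (P m) = 0%E by rewrite eseries0// => m _ _; exact: lamP.
  rewrite lamE//; congr EFin; apply/cvg_lim => //; apply: cvg_near_cst;
    near=> k.
  rewrite /a (_ : _ `&` _ = set0) ?measure0//.
  apply/seteqP; split=> // x [Kx /= Px]; apply: (Px x) => //.
  by apply: truncation_code_row => //; exact: KM.
have mpre (D : set T) : measurable D ->
  measurable (d @^-1` D : set (bits_borel n)).
  move=> mD; rewrite -[X in measurable X]setTI.
  exact: (measurable_decode_row M0 (n:=n)).
exists s, mu; split => //; first by rewrite muE.
move=> f cf.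
have [B B0 fB] := compact_within_bounded cK (@subset_refl _ K) cf.
have mf := within_continuous_measurable mK cf.
apply/cvgrPdist_le => eps eps0.
(* Each of the two step approximations costs [eps' * C], together at most [eps / 2]; the convergence
   of finitely many cylinder masses takes the other half. *)
have eps'0 : 0 < eps / (4 * (C + 1)) by rewrite divr_gt0// mulr_gt0// ltr_wpDl.
set eps' := eps / (4 * (C + 1)) in eps'0.
have [del del0 fdel] := compact_within_unif_continuous cK (@subset_refl _ K) cf
  eps'0.
have [m mdel] := small_expn2_exists M0 (divr_gt0 del0 (ltr0n _ 2)).
pose w := @prefix_bits n m.
pose near_w v x := K x /\ exists2 b, w b = v & `|x - truncation_row M m b| <= M
  / 2 ^+ m.
(* The value of [f] at some point of [K] in the cube with digits [v]. The default [0] belongs to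
   cubes that miss [K] and never enters [valP]. *)
pose val v := if pselect (exists x, near_w v x) is left h then f (sval (cid h))
  else 0.
have valP x b : K x -> `|x - truncation_row M m b| <= M / 2 ^+ m ->
    `|f x - val (w b)| <= eps'.
  move=> Kx xb; rewrite /val; case: pselect => [h|]; last first.
    by case; exists x; split=> //; exists b.
  case: (cid h) => /= y [Ky [c cb yc]]; apply/ltW/fdel => //.
  have bc : truncation_row M m b = truncation_row M m c.
    exact/truncation_row_prefix/esym.
  rewrite bc in xb.
  rewrite (splitr del) (le_lt_trans (ler_distD (truncation_row M m c) _ _))//.
  by apply: ltrD; [|rewrite distrC]; apply: le_lt_trans mdel.
pose L := \sum_v val v * fine (lam [set b | w b = v]).
have wcyl v : cylinders [set b | w b = v].
  by apply/cylindersP; exists m => b c bc /= <-.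
have muK : fine (mu K) <= C.
  have lamT : fine (lam setT) <= C.
    rewrite lamE//=; apply: limr_le; first by apply/cvg_ex; exists (nu setT);
      exact: cvg_nu.
    by near=> k; exact: a_leC.
  apply: le_trans lamT; apply: fine_le; rewrite ?fin_num_measure//.
  by rewrite muE; apply: le_measure; rewrite ?inE//; exact: mpre.
have eps'C : eps' * C + eps' * C <= eps / 2.
  have : eps' * C + eps' = eps / 4.
    by rewrite /eps'; field; rewrite gt_eqF// ltr_wpDl.
  by move: eps'0; lra.
have stepK k : `|\int[mu_ k]_(x in K) f x -
    \sum_v val v * a k [set b | w b = v]| <= eps' * C.
  have mcell v : measurable (K `&` (w \o e) @^-1` [set v] : set T) by exact:
    (me _ (wcyl v)).
  have m1 : measurable_fun (K : set T) (cst (1 : R)) by exact: measurable_cst.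
  have := @Rintegral_step_approx _ _ _ (mu_ k) _ (w \o e) val K f (cst 1) eps'
    1 B
    mK mcell mf m1 _ _ fB.
  under [X in `|X - _|]eq_Rintegral do rewrite mulr1.
  under eq_bigr do rewrite Rintegral_cst// mul1r.
  rewrite mulr1 => H; apply: le_trans (H _ _) _.
  - by move=> x Kx; apply: valP => //; apply: truncation_code_row => //;
    exact: KM.
  - by move=> x _; rewrite normr1.
  - by rewrite ler_wpM2l// ltW.
have stepL : `|\int[mu]_(x in K) f x - L| <= eps' * C.
  have mdK : measurable (d @^-1` K : set (bits_borel n)) by exact: mpre.
  have mcell v : measurable (d @^-1` K `&` w @^-1` [set v] : set (bits_borel
    n)).
    by apply: measurableI => //; exact: (mcyl _ (wcyl v)).
  have m1 : measurable_fun (d @^-1` K : set (bits_borel n)) (cst (1 : R)) by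
    exact: measurable_cst.
  have mfd : measurable_fun (d @^-1` K : set (bits_borel n)) (f \o d).
    by apply: measurable_comp mf _ => //;
      [move=> _ [b Kb <-]|apply: measurable_funTS;
        exact: (measurable_decode_row M0 (n:=n))].
  have := @Rintegral_step_approx _ _ _ lam _ w val (d @^-1` K) (f \o d) (cst 1)
    eps' 1 B
    mdK mcell mfd m1 _ _ _.
  under [X in `|X - _|]eq_Rintegral do rewrite mulr1.
  under eq_bigr do rewrite Rintegral_cst// mul1r.
  rewrite mulr1 (mu_int _ _ B)// => H.
  (* [L] uses the masses of whole cylinders, the only ones known to be limits; cutting them down to
     the codes of points of [K] removes a null set, by [lam_null]. *)
  have -> : L = \sum_v val v * fine (lam (d @^-1` K `&` w @^-1` [set v])).
    apply: eq_bigr => v _; congr (_ * fine _).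
    rewrite (measureDI lam (mcyl _ (wcyl v)) mdK) setIC; apply/esym.
    rewrite -[LHS]add0e; congr (_ + _)%E; apply/esym/eqP.
    rewrite -measure_le0 -lam_null; apply: le_measure; rewrite ?inE.
    - by apply: measurableD => //; exact: (mcyl _ (wcyl v)).
    - by apply: mpre; exact: measurableC.
    - by move=> b [].
  apply: le_trans (H _ _ _) _.
  - by move=> b Kb; apply: valP => //; exact: truncation_decode_row.
  - by move=> x _; rewrite normr1.
  - by move=> b; exact: fB.
  - by rewrite -muE ler_wpM2l// ltW.
have cvgL : \sum_v val v * a (s k) [set b | w b = v] @[k --> \oo] --> L.
  apply: cvg_big => [|v _]; first exact: add_continuous.
  apply: cvgM; first exact: cvg_cst.
  by rewrite lamE//; exact: cvg_nu.
have eps20 : 0 < eps / 2 by rewrite divr_gt0.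
move/cvgrPdist_le : cvgL => /(_ _ eps20); apply: filterS => k Lk.
have := stepK (s k); move: stepL Lk; rewrite !ler_norml.
move=> /andP[h1 h2] /andP[h3 h4] /andP[h5 h6]; apply/andP; split; lra.
Unshelve. all: by end_near.
Qed.
End weak_compactness.

(** * Normals and gradients up to the boundary *)

Section metric_limits.
Variables (R : realType) (V W : normedModType R).
Implicit Types (f : V -> W) (x y : V).

Lemma nbhs_normP (P : set V) x :
  nbhs x P <-> exists2 r : R, 0 < r & forall y, `|x - y| < r -> P y.
Proof.
split=> [/nbhs_ballP[r /= r0 rP]|[r r0 rP]].
  by exists r => // y xy; apply: rP; rewrite -ball_normE.
by apply/nbhs_ballP; exists r => //= y; rewrite -ball_normE; exact: rP.
Qed.

Lemma cvg_withinP (K : set V) f x (l : W) :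
  f y @[y --> within K (nbhs x)] --> l <->
  forall e : R, 0 < e -> exists2 r : R, 0 < r &
    forall y, K y -> `|x - y| < r -> `|l - f y| < e.
Proof.
rewrite cvgrPdist_lt; split=> fl e /fl => [|[r r0 rP]].
  rewrite near_withinE => /nbhs_normP[r r0 rP].
  by exists r => // y Ky xy; exact: rP.
rewrite near_withinE; apply/nbhs_normP; exists r => // y xy Ky; exact: rP.
Qed.

Lemma cvg_nbhsP f x (l : W) :
  f y @[y --> x] --> l <->
  forall e : R, 0 < e -> exists2 r : R, 0 < r &
    forall y, `|x - y| < r -> `|l - f y| < e.
Proof.
rewrite cvgrPdist_lt; split=> fl e /fl => [/nbhs_normP//|fe].
exact/nbhs_normP.
Qed.

Lemma closure_normP (K : set V) x :
  closure K x <-> forall r : R, 0 < r -> exists2 y, K y & `|x - y| < r.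
Proof.
split=> [clx r r0|clx B /nbhs_normP[r r0 rB]].
  have [|y [Ky xy]] := clx [set y | `|x - y| < r]; last by exists y.
  by apply/nbhs_normP; exists r.
by have [y Ky xy] := clx r r0; exists y; split=> //; exact: rB.
Qed.

Lemma open_norm_ball x (r : R) : open [set y | `|x - y| < r].
Proof.
rewrite openE => y /= xy; apply/nbhs_normP.
exists (r - `|x - y|) => [|z yz]; first by rewrite subr_gt0.
by rewrite /= (le_lt_trans (ler_distD y _ _))// addrC -ltrBrDr.
Qed.

Lemma closed_norm_ball x (r : R) : closed [set y | `|x - y| <= r].
Proof.
rewrite -openC openE => y /= /negP; rewrite -ltNge => xy; apply/nbhs_normP.
exists (`|x - y| - r) => [|z yz]; first by rewrite subr_gt0.
apply/negP; rewrite -ltNge -(ltrD2r `|y - z|).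
apply: lt_le_trans (_ : `|x - y| <= _); first by rewrite -ltrBrDl.
by rewrite [`|y - z|]distrC ler_distD.
Qed.

(** Twice the positive part of [3 / 4 * r - |x - y|]. The radius [3 / 4 * r] lies strictly between
    [r / 2], where a positive lower bound is wanted, and [r], so that the closed ball containing the
    support stays in the open ball of radius [r]. *)
Lemma bump_function x (r : R) : 0 < r -> exists psi : V -> R,
  [/\ continuous psi, forall y, 0 <= psi y <= 2 * r,
      forall y, `|x - y| < r / 2 -> r / 2 <= psi y &
      forall y, 3 / 4 * r <= `|x - y| -> psi y = 0].
Proof.
move=> r0; exists (fun y => `|3 / 4 * r - `|x - y| | + (3 / 4 * r - `|x - y|)).
split=> [y|y|y xy|y xy].
- have c : 3 / 4 * r - `|x - z| @[z --> y] --> 3 / 4 * r - `|x - y|.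
    apply: cvgB; first exact: cvg_cst.
    by apply: cvg_norm; apply: cvgB; [exact: cvg_cst|exact: cvg_id].
  by apply: cvgD => //; exact: cvg_norm.
- have := normr_ge0 (x - y); case: (ger0P (3 / 4 * r - `|x - y|)) => h1 h2;
  apply/andP; split; lra.
- by rewrite ger0_norm; lra.
- by rewrite ler0_norm; [rewrite addNr|lra].
Qed.

End metric_limits.

Section matrix_limits.
Variables (R : realType) (m n : nat).

Lemma cvg_mx_coord T (F : set_system T) {FF : Filter F} (f : T -> 'M[R]_(m, n))
    (l : 'M[R]_(m, n)) :
  (forall i j, f x i j @[x --> F] --> l i j) -> f x @[x --> F] --> l.
Proof.
move=> fl; apply/cvgrPdist_le => e e0.
suff : \forall x \near F, forall ij : 'I_m * 'I_n,
    `|l ij.1 ij.2 - f x ij.1 ij.2| <= e.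
  apply: filterS => x fx; apply: norm_le_coord => [|i j]; first exact: ltW.
  by rewrite !mxE; exact: (fx (i, j)).
apply: filter_forall => -[i j] /=.
by have /cvgrPdist_le/(_ e e0) := fl i j.
Qed.

Lemma cvg_coord T (F : set_system T) {FF : Filter F} (f : T -> 'M[R]_(m, n))
    (l : 'M[R]_(m, n)) i j :
  f x @[x --> F] --> l -> f x i j @[x --> F] --> l i j.
Proof.
move=> fl; apply: (cvg_comp f (fun M : 'M[R]_(m, n) => M i j) fl).
exact: coord_continuous.
Qed.

End matrix_limits.

Section matrix_products.
Variables (R : realType) (m n p : nat).

Lemma cvg_mulmx T (F : set_system T) {FF : Filter F} (f : T -> 'M[R]_(m, n))
    (g : T -> 'M[R]_(n, p)) (l : 'M[R]_(m, n)) (k : 'M[R]_(n, p)) :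
  f x @[x --> F] --> l -> g x @[x --> F] --> k ->
  f x *m g x @[x --> F] --> l *m k.
Proof.
move=> fl gk; apply: cvg_mx_coord => i j; rewrite mxE.
under eq_fun do rewrite mxE.
apply: cvg_big => [|q _]; first exact: add_continuous.
by apply: cvgM; exact: cvg_coord.
Qed.

Lemma norm_mulmx_le (A : 'M[R]_(m, n)) (B : 'M[R]_(n, p)) :
  `|A *m B| <= n%:R * `|A| * `|B|.
Proof.
apply: norm_le_coord => [|i j]; first by rewrite !mulr_ge0.
rewrite mxE; apply: le_trans (ler_norm_sum _ _ _) _.
apply: le_trans (_ : _ <= \sum_(q < n) `|A| * `|B|) _.
  by apply: ler_sum => q _; rewrite normrM ler_pM// coord_le_norm.
by rewrite sumr_const card_ord -mulrA mulr_natl.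
Qed.

End matrix_products.

Section directional_derivatives.
Variables (R : realType) (n : nat).
Implicit Types (f : 'rV[R]_n -> R) (x v : 'rV[R]_n).

Lemma derive_partials f x v : differentiable f x ->
  'D_v f x = \sum_i v 0 i * partial i f x.
Proof.
move=> df; rewrite deriveE// [in LHS](row_sum_delta v) linear_sum.
by apply: eq_bigr => i _; rewrite linearZ /partial deriveE.
Qed.

Lemma mean_value_rV f x y :
  (forall s : R, 0 <= s <= 1 -> differentiable f (x + s *: (y - x))) ->
  exists2 s : R, 0 <= s <= 1 &
    f y - f x = \sum_i (y - x) 0 i * partial i f (x + s *: (y - x)).
Proof.
move=> df; pose g (t : R) := f (t *: (y - x) + x).
pose dg t := 'D_(y - x) f (t *: (y - x) + x).
have dfg t : 0 <= t <= 1 -> differentiable f (t *: (y - x) + x).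
  by move=> /df; rewrite addrC.
have gd (t : R) : 0 <= t <= 1 -> is_derive t 1 g (dg t).
  move=> t01; have dft := dfg t t01.
  (* The difference quotient of [g] is literally that of [f] in the direction [y - x], so no chain
     rule is involved. *)
  have gE : (fun h : R => h^-1 *: ((g \o shift t) (h *: 1) - g t)) =
      (fun h => h^-1 *: ((f \o shift (t *: (y - x) + x)) (h *: (y - x)) -
                         f (t *: (y - x) + x))).
    apply/funext => h; rewrite /g/= addrA -scalerDl.
    by rewrite [h *: 1]mulr1.
  apply: DeriveDef; rewrite /derivable /derive gE//.
  exact: diff_derivable.
have [||s s01] := @MVT_segment R g dg 0 1 ler01.
- by move=> t; rewrite in_itv/= => /andP[t0 t1]; apply: gd; rewrite !ltW.
- apply/subspace_continuousP => t /=; rewrite in_itv/= => t01.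
  apply: cvg_within_filter.
  apply/differentiable_continuous/derivable1_diffP.
  by have [] := gd t t01.
- rewrite /g /dg subr0 mulr1 scale0r add0r scale1r subrK => ->.
  exists s; first by move: s01; rewrite in_itv.
  rewrite derive_partials; last by apply: dfg; move: s01; rewrite in_itv.
  by rewrite [s *: _ + x]addrC.
Qed.

Lemma norm_mean_value_le f x y (B : R) :
  (forall s : R, 0 <= s <= 1 -> differentiable f (x + s *: (y - x)) /\
    forall i, `|partial i f (x + s *: (y - x))| <= B) ->
  `|f y - f x| <= n%:R * B * `|y - x|.
Proof.
move=> fB; have [s s01|s s01 ->] := @mean_value_rV f x y;
  first by have [] := fB s s01.
apply: le_trans (ler_norm_sum _ _ _) _.
apply: le_trans (_ : _ <= \sum_(i < n) `|y - x| * B) _.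
  apply: ler_sum => i _; rewrite normrM ler_pM// ?coord_le_norm//.
  by have [_] := fB s s01; exact.
by rewrite sumr_const card_ord -mulrA mulr_natl mulrC.
Qed.

End directional_derivatives.

Section dot_product.
Variables (R : realType) (n : nat).
Implicit Types x y z : 'rV[R]_n.

Lemma dotrVE x y : dotrV x y = (x *m y^T) 0 0.
Proof. by rewrite mxE; apply: eq_bigr => i _; rewrite mxE. Qed.

Lemma dotrVC x y : dotrV x y = dotrV y x.
Proof. by apply: eq_bigr => i _; rewrite mulrC. Qed.

Lemma dotrVBl x y z : dotrV (x - y) z = dotrV x z - dotrV y z.
Proof. by rewrite !dotrVE mulmxBl !mxE. Qed.

Lemma dotrVBr x y z : dotrV x (y - z) = dotrV x y - dotrV x z.
Proof. by rewrite dotrVC dotrVBl !(dotrVC x). Qed.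

Lemma dotrVZl (a : R) x y : dotrV (a *: x) y = a * dotrV x y.
Proof. by rewrite !dotrVE -scalemxAl !mxE. Qed.

Lemma dotrVZr (a : R) x y : dotrV x (a *: y) = a * dotrV x y.
Proof. by rewrite dotrVC dotrVZl dotrVC. Qed.

Lemma dotrV_ge0 x : 0 <= dotrV x x.
Proof. by apply: sumr_ge0 => i _; rewrite -expr2 sqr_ge0. Qed.

Lemma dotrV_eq0 x : (dotrV x x == 0) = (x == 0).
Proof.
apply/eqP/eqP => [x0|->]; last by rewrite /dotrV big1// => i _;
  rewrite mxE mul0r.
apply/rowP => i; rewrite mxE; apply/eqP.
rewrite -sqrf_eq0 expr2; apply/eqP.
by apply: (psumr_eq0P _ x0) => // k _; rewrite -expr2 sqr_ge0.
Qed.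

Lemma enorm_sqr x : enorm x ^+ 2 = dotrV x x.
Proof. by rewrite sqr_sqrtr// dotrV_ge0. Qed.

Lemma enorm_ge0 x : 0 <= enorm x. Proof. exact: sqrtr_ge0. Qed.

Lemma enorm_eq0 x : (enorm x == 0) = (x == 0).
Proof. by rewrite sqrtr_eq0 -dotrV_eq0 eq_le dotrV_ge0 andbT. Qed.

Lemma enorm_gt0 x : (0 < enorm x) = (x != 0).
Proof. by rewrite lt_def enorm_ge0 andbT enorm_eq0. Qed.

Lemma dot_normalize x : x != 0 ->
  dotrV ((enorm x)^-1 *: x) ((enorm x)^-1 *: x) = 1.
Proof.
move=> x0; rewrite dotrVZl dotrVZr -enorm_sqr mulrA -expr2 -exprMn mulVf
  ?expr1n//.
by rewrite enorm_eq0.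
Qed.

Lemma coord_le_enorm x i : `|x 0 i| <= enorm x.
Proof.
rewrite -(@ler_pXn2r _ 2)// ?nnegrE ?enorm_ge0// enorm_sqr real_normK
  ?num_real//.
rewrite /dotrV (bigD1 i)//= -expr2 lerDl.
by apply: sumr_ge0 => k _; rewrite -expr2 sqr_ge0.
Qed.

Lemma dotrV_le x y : `|dotrV x y| <= n%:R * `|x| * `|y|.
Proof.
apply: le_trans (ler_norm_sum _ _ _) _.
apply: le_trans (_ : _ <= \sum_(q < n) `|x| * `|y|) _.
  by apply: ler_sum => q _; rewrite normrM ler_pM// coord_le_norm.
by rewrite sumr_const card_ord -mulrA mulr_natl.
Qed.

Lemma cvg_dotrV T (F : set_system T) {FF : Filter F} (f g : T -> 'rV[R]_n)
    (k l : 'rV[R]_n) :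
  f t @[t --> F] --> k -> g t @[t --> F] --> l ->
  dotrV (f t) (g t) @[t --> F] --> dotrV k l.
Proof.
move=> fk gl; apply: cvg_big => [|q _]; first exact: add_continuous.
by apply: cvgM; exact: cvg_coord.
Qed.

Lemma cvg_enorm T (F : set_system T) {FF : Filter F} (f : T -> 'rV[R]_n)
    (l : 'rV[R]_n) :
  f t @[t --> F] --> l -> enorm (f t) @[t --> F] --> enorm l.
Proof.
move=> fl; apply: (cvg_comp (fun t => dotrV (f t) (f t)) Num.sqrt).
  exact: (cvg_dotrV fl fl).
exact: sqrt_continuous.
Qed.

Lemma cvg_normalize T (F : set_system T) {FF : Filter F} (f : T -> 'rV[R]_n)
    (l : 'rV[R]_n) : l != 0 ->
  f t @[t --> F] --> l ->
  (enorm (f t))^-1 *: f t @[t --> F] --> (enorm l)^-1 *: l.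
Proof.
move=> l0 fl; apply: cvgZ => //; apply: cvgV; first by rewrite enorm_eq0.
exact: cvg_enorm.
Qed.

End dot_product.

(** * Local defining functions of a domain and independence of the normal from the chart *)

Section charts.
Variables (R : realType) (n : nat).
Implicit Types (U : set 'rV[R]_n) (x y v : 'rV[R]_n) (A : 'M[R]_n) (j : 'I_n)
  (h : 'rV[R]_n.-1 -> R).

(** A local defining function: in a chart of [U], the points of [U] are those of positive
    [height]. *)
Definition height A j h y : R := (y *m A) 0 j - h (col' j (y *m A)).

(** The gradient of [height] in the original coordinates, that is, [graph_normal] before
    normalization. *)
Definition height_grad A j h x : 'rV[R]_n :=
  (\row_i (if unlift j i is Some k
           then - partial k h (col' j (x *m A)) else 1)) *m A^T.

Lemma orth_mulmx_tr A : A *m A^T = 1%:M -> A^T *m A = 1%:M.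
Proof. exact: mulmx1C. Qed.

Lemma dot_orth A x y : A *m A^T = 1%:M ->
  dotrV (x *m A^T) (y *m A^T) = dotrV x y.
Proof.
move=> /orth_mulmx_tr AA.
by rewrite !dotrVE trmx_mul trmxK mulmxA -(mulmxA x) AA mulmx1.
Qed.

Lemma graph_normalE A j h x : A *m A^T = 1%:M ->
  graph_normal A j h x =
  (enorm (height_grad A j h x))^-1 *: height_grad A j h x.
Proof. by move=> AA; rewrite /graph_normal /height_grad /enorm dot_orth. Qed.

Lemma height_grad_neq0 A j h x : A *m A^T = 1%:M -> height_grad A j h x != 0.
Proof.
move=> AA; rewrite -dotrV_eq0 dot_orth// dotrV_eq0.
apply/eqP => /rowP /(_ j); rewrite !mxE unlift_none => /eqP.
by rewrite oner_eq0.
Qed.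

Lemma dot_height_grad A j h x v :
  dotrV v (height_grad A j h x) =
  (v *m A) 0 j - \sum_k (col' j (v *m A)) 0 k * partial k h (col' j (x *m A)).
Proof.
rewrite dotrVE trmx_mul trmxK mulmxA mxE (bigD1_ord j)//= !mxE unlift_none
  mulr1.
congr (_ + _); rewrite -sumrN; apply: eq_bigr => k _.
by rewrite !mxE liftK mulrN.
Qed.

Lemma height_derivative A j h x v : differentiable h (col' j (x *m A)) ->
  t^-1 * (height A j h (x + t *: v) - height A j h x) @[t --> 0^'] -->
  dotrV v (height_grad A j h x).
Proof.
move=> dh; rewrite dot_height_grad -derive_partials//.
set y := col' j (x *m A); set u := col' j (v *m A).
have lim_h : t^-1 *: (h (t *: u + y) - h y) @[t --> 0^'] --> 'D_u h y.
  by have := @diff_derivable _ _ _ h y u dh.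
have -> : (fun t => t^-1 * (height A j h (x + t *: v) - height A j h x)) =
    (fun t => t^-1 * (t * (v *m A) 0 j) - t^-1 *: (h (t *: u + y) - h y)).
  apply/funext => t; rewrite /height mulmxDl -scalemxAl raddfD/= linearZ/=.
  rewrite [X in h X]addrC -/u -/y -[t^-1 *: _]/(t^-1 * _) -mulrBr !mxE.
  by congr (_ * _); ring.
apply: cvgB => //; apply: cvg_near_cst.
by near=> t; rewrite mulKf//; near: t; exact: nbhs_dnbhs_neq.
Unshelve. all: by end_near. Qed.

Lemma height_near_pos A j h x v : differentiable h (col' j (x *m A)) ->
  height A j h x = 0 -> 0 < dotrV v (height_grad A j h x) ->
  \forall t \near 0^'+, 0 < height A j h (x + t *: v).
Proof.
move=> dh h0 pos; have := height_derivative (v := v) dh; rewrite h0.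
move=> /cvg_dnbhs_at_right/cvgr_gt/(_ _ pos) ht; near=> t.
have t0 : 0 < t by near: t; exact: nbhs_right_gt.
have : 0 < t^-1 * (height A j h (x + t *: v) - 0) by near: t.
by rewrite subr0 pmulr_rgt0// invr_gt0.
Unshelve. all: by end_near. Qed.

Lemma height_near_neg A j h x v : differentiable h (col' j (x *m A)) ->
  height A j h x = 0 -> dotrV v (height_grad A j h x) < 0 ->
  \forall t \near 0^'+, height A j h (x + t *: v) < 0.
Proof.
move=> dh h0 neg; have := height_derivative (v := v) dh; rewrite h0.
move=> /cvg_dnbhs_at_right/cvgr_lt/(_ _ neg) ht; near=> t.
have t0 : 0 < t by near: t; exact: nbhs_right_gt.
have : t^-1 * (height A j h (x + t *: v) - 0) < 0 by near: t.
by rewrite subr0 pmulr_rlt0// invr_gt0.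
Unshelve. all: by end_near. Qed.

Lemma height_continuous A j h x : {for col' j (x *m A), continuous h} ->
  {for x, continuous (height A j h)}.
Proof.
move=> ch; have cA : y *m A @[y --> x] --> x *m A.
  apply: (@cvg_mulmx _ _ _ _ _ (nbhs x) _ id (cst A) x A).
    exact: cvg_id.
  exact: cvg_cst.
have c1 : (y *m A) 0 j @[y --> x] --> (x *m A) 0 j by exact: cvg_coord cA.
have c2 : h (col' j (y *m A)) @[y --> x] --> h (col' j (x *m A)).
  apply: (@cvg_comp _ _ _ (fun y : 'rV[R]_n => col' j (y *m A)) h) ch.
  apply: (@cvg_mx_coord _ _ _ _ (nbhs x) _ (fun y => col' j (y *m A))) => i k.
  under eq_fun do rewrite mxE.
  by rewrite mxE; exact: cvg_coord cA.
exact: (cvgB c1 c2).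
Qed.

Lemma chart_height U x A j h : graph_chart U x A j h ->
  exists2 r : R, 0 < r &
    forall y, `|y - x| < r -> (U y <-> 0 < height A j h y).
Proof. by move=> [_ [r r0 rU]]; exists r => // y /rU ->; rewrite subr_gt0. Qed.

Lemma chart_height0 U x A j h : open U -> bdry U x -> graph_chart U x A j h ->
  {for col' j (x *m A), continuous h} -> height A j h x = 0.
Proof.
move=> oU [clx nx] /chart_height[r r0 rU] ch.
have nUx : ~ U x by move=> Ux; apply: nx; exact: open_nbhs_nbhs.
have cH := height_continuous ch.
apply/eqP; rewrite eq_le; apply/andP; split.
  rewrite leNgt; apply/negP => H0; apply: nUx; apply/rU => //.
  by rewrite subrr normr0.
rewrite leNgt; apply/negP => Hx; have Hneg :=
  @cvgr_lt _ _ (nbhs x) _ (height A j h) _ cH 0 Hx.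
have [y [Uy]] : (U `&` [set y | height A j h y < 0 /\ `|y - x| < r]) !=set0.
  apply: clx; apply: filterI; first exact: Hneg.
  by apply/nbhs_ballP; exists r => //= y; rewrite -ball_normE /ball_/= distrC.
by move=> [Hy /rU[/(_ Uy) + _]]; rewrite ltNge (ltW Hy).
Qed.

(* If the two unit normals [u] and [w] were different, then moving from [x] in
   the direction [u - w] would enter [U] according to the first chart and leave it
   according to the second one. *)
Lemma graph_normal_unique U x A j h B k g : open U -> bdry U x ->
  graph_chart U x A j h -> differentiable h (col' j (x *m A)) ->
  graph_chart U x B k g -> differentiable g (col' k (x *m B)) ->
  graph_normal A j h x = graph_normal B k g x.
Proof.
move=> oU bUx hA dh gB dg.
have AA := hA.1; have BB := gB.1.
rewrite !graph_normalE//.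
set a := height_grad A j h x; set b := height_grad B k g x.
have a0 : a != 0 by exact: height_grad_neq0.
have b0 : b != 0 by exact: height_grad_neq0.
set u := _ *: a; set w := _ *: b.
have uu : dotrV u u = 1 by exact: dot_normalize.
have ww : dotrV w w = 1 by exact: dot_normalize.
apply/eqP; rewrite -subr_eq0 -dotrV_eq0; apply/negPn/negP => uw.
have {uw}uw : 0 < dotrV (u - w) (u - w) by rewrite lt_def uw dotrV_ge0.
(* The strict Cauchy-Schwarz inequality for distinct unit vectors, read off from the square of
   [u - w]. It fixes the signs of the products of [u - w] with [u] and [w]. *)
have uw1 : dotrV u w < 1.
  by move: uw; rewrite dotrVBl !dotrVBr uu ww (dotrVC w u); lra.
have pos : 0 < dotrV (u - w) a.
  have : 0 < dotrV (u - w) u by rewrite dotrVBl uu (dotrVC w) subr_gt0.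
  by rewrite dotrVZr pmulr_rgt0// invr_gt0 enorm_gt0.
have neg : dotrV (u - w) b < 0.
  have : dotrV (u - w) w < 0 by rewrite dotrVBl ww subr_lt0.
  by rewrite dotrVZr pmulr_rlt0// invr_gt0 enorm_gt0.
have hx : height A j h x = 0.
  by apply: (chart_height0 oU bUx hA); exact: differentiable_continuous.
have gx : height B k g x = 0.
  by apply: (chart_height0 oU bUx gB); exact: differentiable_continuous.
have [r r0 rU] := chart_height hA; have [q q0 qU] := chart_height gB.
have d_gt0 e : 0 < e -> 0 < e / (`|u - w| + 1).
  by move=> e0; rewrite divr_gt0// ltr_wpDl.
near (0 : R)^'+ => t.
have t0 : 0 < t by near: t; exact: nbhs_right_gt.
have dist e : 0 < e -> t < e / (`|u - w| + 1) -> `|x + t *: (u - w) - x| < e.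
  move=> e0; rewrite ltr_pdivlMr ?ltr_wpDl//; apply: le_lt_trans.
  rewrite addrC addKr normrZ gtr0_norm// ler_wpM2l ?(ltW t0)//.
  by rewrite lerDl.
have : 0 < height A j h (x + t *: (u - w)).
  by near: t; exact: height_near_pos.
have : height B k g (x + t *: (u - w)) < 0.
  by near: t; exact: height_near_neg.
have /rU <- : `|x + t *: (u - w) - x| < r.
  by apply: dist => //; near: t; apply: nbhs_right_lt; exact: d_gt0.
move=> H /qU H2.
have /H2 : `|x + t *: (u - w) - x| < q.
  by apply: dist => //; near: t; apply: nbhs_right_lt; exact: d_gt0.
by rewrite ltNge ltW.
Unshelve. all: by end_near. Qed.

End charts.

Lemma holder_modulus (R : realType) (L beta e : R) : 0 < beta -> 0 < e ->
  exists2 d : R, 0 < d & forall t, 0 <= t -> t < d -> L * t `^ beta < e.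
Proof.
move=> b0 e0; have L0 : 0 < `|L| + 1 by rewrite ltr_wpDl.
have e'0 : 0 < e / (`|L| + 1) by rewrite divr_gt0.
exists ((e / (`|L| + 1)) `^ beta^-1); first exact: powR_gt0.
move=> t t0 td.
have : t `^ beta < e / (`|L| + 1).
  have -> : e / (`|L| + 1) = ((e / (`|L| + 1)) `^ beta^-1) `^ beta.
    by rewrite -powRrM mulVf ?gt_eqF// powRr1// ltW.
  by apply: gt0_ltr_powR => //; rewrite nnegrE powR_ge0.
rewrite ltr_pdivlMr// mulrC; apply: le_lt_trans.
by rewrite ler_wpM2r ?powR_ge0// (le_trans (ler_norm L))// lerDl.
Qed.

Section inner_normals.
Variables (R : realType) (n : nat) (alpha : R).
Hypothesis alpha_gt0 : 0 < alpha.
Implicit Types (U Q : set 'rV[R]_n) (x y v : 'rV[R]_n) (A : 'M[R]_n)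
  (j : 'I_n) (h : 'rV[R]_n.-1 -> R).

Lemma C1Holder_scalar_continuous m (h : 'rV[R]_m -> R) i :
  C1Holder_scalar alpha h -> continuous (partial i h).
Proof.
move=> [_ [L hL]] y.
apply/cvg_nbhsP => e e0.
have [d d0 dP] := holder_modulus L alpha_gt0 e0.
exists d => // z yz; apply: le_lt_trans (hL y z i) _; exact: dP.
Qed.

Lemma graph_chart_near U x A j h : graph_chart U x A j h ->
  exists2 r : R, 0 < r & forall y, `|y - x| < r -> graph_chart U y A j h.
Proof.
move=> [AA [r r0 rU]]; exists (r / 2) => [|y yx]; first by rewrite divr_gt0.
split=> //; exists (r / 2) => [|z zy]; first by rewrite divr_gt0.
apply: rU; rewrite (splitr r); apply: le_lt_trans (ler_distD y _ _) _.
exact: ltrD.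
Qed.

Lemma reference_open Q : reference_configuration alpha Q -> open Q.
Proof.
move=> [m [U [dom _ _ ->]]]; apply: bigcup_open => i _.
by have [] := dom i.
Qed.

Lemma reference_compact_closure Q :
  reference_configuration alpha Q -> compact (closure Q).
Proof.
move=> [m [U [_ bd _ QU]]]; apply: bounded_closed_compact;
  last exact: closed_closure.
have /choice[B BP] i : exists B : R, forall x, U i x -> `|x| <= B.
  have [M [Mr MP]] := bd i; exists (`|M| + 1) => x Ux.
  by apply: (MP (`|M| + 1)) => //; rewrite (le_lt_trans (ler_norm M))// ltrDl.
pose C := \sum_i `|B i|.
exists (C + 1); split; first exact: num_real.
move=> N CN x clx; apply: le_trans (ltW CN).
have [y Qy xy] := (closure_normP _ _).1 clx 1 ltr01.
have yC : `|y| <= C.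
  move: Qy; rewrite QU => -[i _ Uy]; apply: le_trans (BP i y Uy) _.
  apply: le_trans (ler_norm _) _; rewrite /C (bigD1 i)//= lerDl.
  by apply: sumr_ge0 => k _.
rewrite -(subrK y x) (le_trans (ler_normD _ _))// addrC lerD// ltW//.
Qed.

Lemma bdry_closed Q : closed (bdry Q).
Proof.
rewrite /bdry setDE; apply: closedI; first exact: closed_closure.
by rewrite closedC; exact: open_interior.
Qed.

Lemma reference_compact_bdry Q :
  reference_configuration alpha Q -> compact (bdry Q).
Proof.
move=> rQ; apply: subclosed_compact (reference_compact_closure rQ) _.
  exact: bdry_closed.
by move=> x [].
Qed.

(** The closures of the components are disjoint and finite in number, so near a boundary point [Q]
    coincides with a single component, whose chart is used. *)
Lemma reference_chart Q x : reference_configuration alpha Q -> bdry Q x ->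
  exists A j h, graph_chart Q x A j h /\ C1Holder_scalar alpha h.
Proof.
move=> [m [U [dom _ tU QU]]] [clx nx].
have away i : ~ closure (U i) x -> \forall y \near x, ~ U i y.
  move=> ncl; apply: contrapT => nU; apply: ncl => B xB.
  apply: contrapT => UB; apply: nU; apply: filterS xB => y By Uy.
  by apply: UB; exists y.
have [i Ui] : exists i, closure (U i) x.
  apply: contrapT => /forallNP nU.
  have /clx[y []] : \forall y \near x, forall i, ~ U i y.
    apply: (@filter_forall _ _ (fun i y =>
      ~ U i y) (nbhs x) (nbhs_filter x)) => i.
    exact/away/nU.
  by rewrite QU => -[i _ Uy] /(_ i).
have oU k : open (U k) by have [] := dom k.
have bU : bdry (U i) x.
  split=> // xU; apply: nx; apply: filterS xU => y Uy.
  by rewrite QU; exists i.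
have others : \forall y \near x, forall k, k != i -> ~ U k y.
  apply: (@filter_forall _ _ (fun k y => k != i -> ~ U k y) (nbhs x)
    (nbhs_filter x)) => k; have [->|ki] := eqVneq k i.
    by near=> y.
  suff /away : ~ closure (U k) x by apply: filterS => y + _.
  move=> Uk; move/eqP: ki; apply; apply: tU => //; exists x => //.
have [_ _ _ /(_ x bU)[A [j [h [[AA [r r0 rU]] hC]]]]] := dom i.
have /nbhs_normP[q q0 qU] := others.
exists A, j, h; split=> //; split=> //.
exists (Num.min r q); first by rewrite lt_min r0.
move=> y; rewrite lt_min => /andP[yr yq]; rewrite -rU//; split.
  rewrite QU => -[k _ Uky]; have [<-//|ki] := eqVneq k i.
  by rewrite distrC in yq; case: (qU _ yq k ki).
by move=> Uiy; rewrite QU; exists i.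
Unshelve. all: by end_near. Qed.

(** [inner_normal] takes an arbitrary chart; by uniqueness of the normal, any chart at hand computes
    it. *)
Lemma inner_normalE U x A j h : open U -> bdry U x -> graph_chart U x A j h ->
  (forall z, differentiable h z) -> inner_normal U x = graph_normal A j h x.
Proof.
move=> oU bU hA dh; rewrite /inner_normal.
case: xgetP => [nu _ [B [k [g [gB dg ->]]]]|none].
  exact: (graph_normal_unique oU bU gB (dg _) hA (dh _)).
by exfalso; apply: (none (graph_normal A j h x)); exists A, j, h.
Qed.

Lemma inner_normal_neq0 Q x : reference_configuration alpha Q -> bdry Q x ->
  inner_normal Q x != 0.
Proof.
move=> rQ bQ; have [A [j [h [hA [dh _]]]]] := reference_chart rQ bQ.
rewrite (inner_normalE (reference_open rQ) bQ hA dh) graph_normalE;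
  last exact: hA.1.
have g0 := height_grad_neq0 j h x hA.1.
by rewrite scaler_eq0 negb_or g0 invr_eq0 enorm_eq0 g0.
Qed.

(** One chart serves all nearby boundary points, and in it the normal is the normalized gradient of
    [height], built from the Hölder continuous partial derivatives of the graph. *)
Lemma inner_normal_continuous Q : reference_configuration alpha Q ->
  {within bdry Q, continuous (inner_normal Q)}.
Proof.
move=> rQ; have oQ := reference_open rQ.
apply/subspace_continuousP => x bx.
have [A [j [h [hA hC]]]] := reference_chart rQ bx.
have dh := hC.1; have AA := hA.1.
have [r r0 rA] := graph_chart_near hA.
have cyA : y *m A @[y --> x] --> x *m A.
  apply: (@cvg_mulmx _ _ _ _ _ (nbhs x) _ id (cst A) x A); first exact: cvg_id.
  exact: cvg_cst.
have cG : height_grad A j h y @[y --> x] --> height_grad A j h x.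
  apply: (@cvg_mulmx _ _ _ _ _ (nbhs x) _ (fun y => \row_i
    (if unlift j i is Some k then - partial k h (col' j (y *m A)) else 1))
    (cst A^T)); last exact: cvg_cst.
  apply: (@cvg_mx_coord _ _ _ _ (nbhs x)) => i k.
  under eq_fun do rewrite mxE.
  rewrite mxE; case: unlift => [l|]; last exact: cvg_cst.
  apply: cvgN.
  apply: (@cvg_comp _ _ _ (fun y : 'rV[R]_n => col' j (y *m A)) (partial l h));
    last first.
    exact: C1Holder_scalar_continuous hC _.
  apply: (@cvg_mx_coord _ _ _ _ (nbhs x) _ (fun y => col' j (y *m A))) => a b.
  under eq_fun do rewrite mxE.
  by rewrite mxE; exact: cvg_coord cyA.
suff : inner_normal Q y @[y --> within (bdry Q) (nbhs x)] --> inner_normal Q x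
  by [].
rewrite (inner_normalE oQ bx hA dh) graph_normalE//.
have : (enorm (height_grad A j h y))^-1 *: height_grad A j h y @[y --> within
  (bdry Q) (nbhs x)]
    --> (enorm (height_grad A j h x))^-1 *: height_grad A j h x.
  apply: cvg_normalize; first exact: height_grad_neq0.
  exact: cvg_within_filter cG.
apply: cvg_trans; apply: near_eq_cvg; rewrite near_withinE.
near=> y => by_; rewrite (@inner_normalE Q y A j h)// ?graph_normalE//.
apply: rA; near: y; apply/nbhs_normP; exists r => // y.
by rewrite distrC.
Unshelve. all: by end_near. Qed.

End inner_normals.

Section limits_from_subset.
Variables (R : realType) (V W : normedModType R) (K : set V).
Implicit Types (f : V -> W) (x : V).

Lemma within_limit_near f x (l : W) (e r : R) : closure K x ->
  f y @[y --> within K (nbhs x)] --> l -> 0 < e -> 0 < r ->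
  exists y, [/\ K y, `|x - y| < r & `|l - f y| < e].
Proof.
move=> /closure_normP clx /cvg_withinP fl e0 r0; have [q q0 qP] := fl e e0.
have [|y Ky] := clx (Num.min r q); first by rewrite lt_min r0.
by rewrite lt_min => /andP[yr yq]; exists y; split=> //; exact: qP.
Qed.

Lemma within_limit_norm_le f x (l : W) (e : R) : closure K x ->
  f y @[y --> within K (nbhs x)] --> l -> (forall y, K y -> `|f y| <= e) ->
  `|l| <= e.
Proof.
move=> clx fl fe; apply/ler_addgt0Pr => d d0.
have [y [Ky _ ly]] := within_limit_near clx fl d0 ltr01.
rewrite -(subrK (f y) l) (le_trans (ler_normD _ _))// addrC lerD ?fe//.
exact: ltW.
Qed.

End limits_from_subset.

Section determinant_limits.
Variables (R : realType).

Lemma cvg_det T (F : set_system T) {FF : Filter F} n (f : T -> 'M[R]_n)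
    (l : 'M[R]_n) :
  f t @[t --> F] --> l -> \det (f t) @[t --> F] --> \det l.
Proof.
move=> fl; apply: cvg_big => [|s _]; first exact: add_continuous.
apply: cvgM; first exact: cvg_cst.
apply: cvg_big => [|i _]; first exact: mul_continuous.
exact: cvg_coord.
Qed.

Lemma cvg_cofmx T (F : set_system T) {FF : Filter F} n (f : T -> 'M[R]_n)
    (l : 'M[R]_n) :
  f t @[t --> F] --> l -> cofmx (f t) @[t --> F] --> cofmx l.
Proof.
move=> fl; apply: cvg_mx_coord => i j; rewrite mxE.
under eq_fun do rewrite mxE.
apply: cvgM; first exact: cvg_cst.
apply: cvg_det; apply: cvg_mx_coord => a b; rewrite !mxE.
under eq_fun do rewrite !mxE.
exact: cvg_coord.
Qed.

Lemma cvg_trmx T (F : set_system T) {FF : Filter F} m n (f : T -> 'M[R]_(m, n))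
    (l : 'M[R]_(m, n)) :
  f t @[t --> F] --> l -> (f t)^T @[t --> F] --> l^T.
Proof.
move=> fl; apply: cvg_mx_coord => i j; rewrite mxE.
under eq_fun do rewrite mxE.
exact: cvg_coord.
Qed.

(** The transposed cofactor matrix is the adjugate, and a further product with [A] gives back [nu]
    times the determinant. *)
Lemma cofmx_mul_neq0 n (nu : 'rV[R]_n) (A : 'M[R]_n) :
  nu != 0 -> \det A != 0 -> nu *m (cofmx A)^T != 0.
Proof.
move=> nu0 dA; have -> : (cofmx A)^T = \adj A.
  by apply/matrixP => i j; rewrite !mxE.
apply: contra nu0 => /eqP nuA.
have : nu *m \adj A *m A = 0 by rewrite nuA mul0mx.
rewrite -mulmxA mul_adj_mx mul_mx_scalar => /eqP.
by rewrite scaler_eq0 (negbTE dA).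
Qed.

End determinant_limits.

(** * Gradients and determinants on the closure of the reference configuration *)

Section extended_gradients.
Variables (R : realType) (n : nat) (Q : set 'rV[R]_n) (beta : R).
Hypothesis beta_gt0 : 0 < beta.
Implicit Types (u v : 'rV[R]_n -> 'rV[R]_n) (x y : 'rV[R]_n).

Lemma within_closure_proper x : closure Q x -> ProperFilter (within Q (nbhs x)).
Proof. exact: within_nbhs_proper. Qed.

(** The Hölder bound makes the entries of the gradient Cauchy as [y] tends to [x] inside [Q], so the
    [lim] in [gradbar] is a true limit. *)
Lemma cvg_gradbar u x : C1Holder Q beta u -> closure Q x ->
  grad u y @[y --> within Q (nbhs x)] --> gradbar Q u x.
Proof.
move=> [_ _ [L hL]] clx.
have PF := within_closure_proper clx.
apply: cvg_mx_coord => i j; rewrite mxE.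
apply/cauchy_cvgP/cauchy_exP => e e0.
have [d d0 dP] := holder_modulus L beta_gt0 e0.
have d20 : 0 < d / 2 by rewrite divr_gt0.
have [z Qz xz] := (closure_normP _ _).1 clx _ d20.
exists (grad u z i j).
suff : \forall y \near within Q (nbhs x),
  ball (grad u z i j) e (grad u y i j) by [].
rewrite near_withinE; apply/nbhs_normP.
exists (d / 2) => // y xy Qy; rewrite -ball_normE /ball_/=.
apply: le_lt_trans (hL z y i j Qz Qy) _; apply: dP => //.
by rewrite (splitr d) (le_lt_trans (ler_distD x _ _))// ltrD// distrC.
Qed.

Lemma gradbar_continuous u : C1Holder Q beta u ->
  {within closure Q, continuous (gradbar Q u)}.
Proof.
move=> Hu; apply/subspace_continuousP => x clx.
apply/cvg_withinP => e e0.
have e20 : 0 < e / 2 by rewrite divr_gt0.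
have [r r0 rP] := (cvg_withinP _ _ _ _).1 (cvg_gradbar Hu clx) _ e20.
exists (r / 2) => [|z clz xz]; first by rewrite divr_gt0.
have r20 : 0 < r / 2 by rewrite divr_gt0.
have [y [Qy zy yl]] := within_limit_near clz (cvg_gradbar Hu clz) e20 r20.
apply: le_lt_trans (ler_distD (grad u y) _ _) _.
rewrite (splitr e); apply: ltrD; last by rewrite distrC.
apply: rP => //; apply: le_lt_trans (ler_distD z _ _) _.
by rewrite (splitr r); exact: ltrD.
Qed.

Lemma gradbar_dist_le u v x (e : R) : C1Holder Q beta u -> C1Holder Q beta v ->
  closure Q x -> (forall y, Q y -> `|grad u y - grad v y| <= e) ->
  `|gradbar Q u x - gradbar Q v x| <= e.
Proof.
move=> Hu Hv clx.
apply: (within_limit_norm_le clx (f := fun y => grad u y - grad v y)).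
by have PF := within_closure_proper clx; apply: cvgB; exact: cvg_gradbar.
Qed.

Lemma gradbar_det_ge u x (e : R) : C1Holder Q beta u -> closure Q x ->
  (forall y, Q y -> e <= \det (grad u y)) -> e <= \det (gradbar Q u x).
Proof.
move=> Hu clx ue; apply/ler_addgt0Pr => d d0.
have cd : (\det (grad u y) : R) @[y --> within Q (nbhs x)] --> \det (gradbar Q
  u x).
  have PF := within_closure_proper clx.
  exact: (cvg_det (cvg_gradbar Hu clx)).
have [y [Qy _ ly]] := within_limit_near clx cd d0 ltr01.
have := ue y Qy; move: ly; rewrite ltr_distl => /andP[h1 h2]; lra.
Qed.

Lemma closure_dist_le u v x (e : R) : {within closure Q, continuous u} ->
  {within closure Q, continuous v} -> closure Q x ->
  (forall y, Q y -> `|u y - v y| <= e) -> `|u x - v x| <= e.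
Proof.
move=> cu cv clx; apply: (within_limit_norm_le clx (f := fun y => u y - v y)).
have cw (w : 'rV[R]_n -> 'rV[R]_n) : {within closure Q, continuous w} ->
    w y @[y --> within Q (nbhs x)] --> w x.
  move=> /subspace_continuousP/(_ x clx)/cvg_withinP cw.
  apply/cvg_withinP => d /cw[r r0 rP]; exists r => // y Qy; apply: rP.
  exact: subset_closure.
by have PF := within_closure_proper clx; apply: cvgB; exact: cw.
Qed.

End extended_gradients.

Section deformed_normals.
Variables (R : realType) (n : nat) (alpha beta : R) (Q : set 'rV[R]_n).
Hypotheses (alpha_gt0 : 0 < alpha) (beta_gt0 : 0 < beta).
Hypothesis Q_ref : reference_configuration alpha Q.
Implicit Types (u : 'rV[R]_n -> 'rV[R]_n) (x y : 'rV[R]_n).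

Let S_closure x : bdry Q x -> closure Q x. Proof. by case. Qed.

(** The form in which the energy bound enters: [energy_det] yields one [e0] for all [eta_ k] and
    [eta]. *)
Definition nondegenerate (e0 : R) u :=
  C1Holder Q beta u /\ forall x, Q x -> e0 <= \det (grad u x).

Lemma gradbar_det_neq0 (e0 : R) u x : 0 < e0 -> nondegenerate e0 u ->
  closure Q x -> \det (gradbar Q u x) != 0.
Proof.
move=> e00 [Hu ue] clx; rewrite gt_eqF//.
exact: lt_le_trans (gradbar_det_ge beta_gt0 Hu clx ue).
Qed.

Lemma deformed_normal_unit (e0 : R) u x : 0 < e0 -> nondegenerate e0 u ->
  bdry Q x -> dotrV (deformed_normal Q u x) (deformed_normal Q u x) = 1.
Proof.
move=> e00 ndu bx; apply: dot_normalize; apply: cofmx_mul_neq0.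
  exact: (inner_normal_neq0 Q_ref bx).
exact: gradbar_det_neq0 ndu (S_closure bx).
Qed.

Lemma deformed_normal_le1 (e0 : R) u x : 0 < e0 -> nondegenerate e0 u ->
  bdry Q x -> `|deformed_normal Q u x| <= 1.
Proof.
move=> e00 ndu bx; apply: norm_le_coord => // i j; rewrite ord1.
apply: le_trans (coord_le_enorm _ _) _.
by rewrite /enorm (deformed_normal_unit e00 ndu bx) sqrtr1.
Qed.

(** The arbitrary filter covers both the limit in the point alone, for continuity, and the joint
    limit in point and index, for uniform convergence. *)
Lemma cvg_deformed_normal T (F : set_system T) {FF : Filter F} (e0 : R) u x
    (f : T -> 'rV[R]_n) (g : T -> 'M[R]_n) :
  0 < e0 -> nondegenerate e0 u -> bdry Q x ->
  f t @[t --> F] --> inner_normal Q x ->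
  g t @[t --> F] --> gradbar Q u x ->
  (enorm (f t *m (cofmx (g t))^T))^-1 *: (f t *m (cofmx (g t))^T) @[t --> F]
    --> deformed_normal Q u x.
Proof.
move=> e00 ndu bx fl gl; apply: cvg_normalize.
  apply: cofmx_mul_neq0; first exact: (inner_normal_neq0 Q_ref bx).
  exact: gradbar_det_neq0 ndu (S_closure bx).
by apply: cvg_mulmx => //; apply: cvg_trmx; exact: cvg_cofmx.
Qed.

Lemma deformed_normal_continuous (e0 : R) u : 0 < e0 -> nondegenerate e0 u ->
  {within bdry Q, continuous (deformed_normal Q u)}.
Proof.
move=> e00 ndu; apply/subspace_continuousP => x bx.
apply: (cvg_deformed_normal e00 ndu bx).
  exact: (subspace_continuousP _ _).1 (inner_normal_continuous alpha_gt0 Q_ref)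
    x bx.
have /subspace_continuousP/(_ x (S_closure bx)) :=
  gradbar_continuous beta_gt0 ndu.1.
move=> /cvg_withinP gu; apply/cvg_withinP => e /gu[r r0 rP].
by exists r => // y by_; apply: rP; exact: S_closure.
Qed.

Variables (eta_ : nat -> 'rV[R]_n -> 'rV[R]_n) (eta : 'rV[R]_n -> 'rV[R]_n).
Variable e0 : R.
Hypotheses (e0_gt0 : 0 < e0) (eta_k_nd : forall k, nondegenerate e0 (eta_ k)).
Hypotheses (eta_nd : nondegenerate e0 eta) (eta_cvg : cvg_C1 Q eta_ eta).

Lemma cvg_C1_closure (e : R) : 0 < e -> \forall k \near \oo,
  forall x, closure Q x -> `|eta_ k x - eta x| <= e /\
    `|gradbar Q (eta_ k) x - gradbar Q eta x| <= e.
Proof.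
move=> /eta_cvg; apply: filterS => k etak x clx; split.
  apply: closure_dist_le clx _ => [||y /etak[/ltW]//].
  - by have [[]] := eta_k_nd k.
  - by have [[]] := eta_nd.
apply: (gradbar_dist_le beta_gt0 (eta_k_nd k).1 eta_nd.1 clx).
by move=> y /etak[_ /ltW].
Qed.

(** The normals converge jointly as [y] tends to a boundary point and [k] to infinity; compactness
    of the boundary makes this uniform, without a quantitative estimate of the normalization. *)
Lemma deformed_normal_uniform (e : R) : 0 < e -> \forall k \near \oo,
  forall x, bdry Q x ->
    `|deformed_normal Q (eta_ k) x - deformed_normal Q eta x| < e.
Proof.
move=> ep; have ep2 : 0 < e / 2 by rewrite divr_gt0.
suff : \forall k \near \oo, bdry Q `<=` [set x | bdry Q x ->
    `|deformed_normal Q (eta_ k) x - deformed_normal Q eta x| < e].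
  by apply: filterS => k kP x bx; exact: kP.
apply: (compact_near_coveringP _).1 (reference_compact_bdry Q_ref) nat \oo
  (fun k x => bdry Q x ->
    `|deformed_normal Q (eta_ k) x - deformed_normal Q eta x| < e) _ _ => x bx.
pose F := filter_prod (within (bdry Q) (nbhs x)) (\oo : set_system nat).
have FF : Filter F by exact: filter_prod_filter.
have normal_x : inner_normal Q z.1 @[z --> F] --> inner_normal Q x.
  have c := (subspace_continuousP _ _).1 (inner_normal_continuous alpha_gt0
    Q_ref) x bx.
  by apply: (cvg_comp fst (inner_normal Q) _ c); exact: cvg_fst.
have gb : gradbar Q eta y @[y --> within (bdry Q) (nbhs x)] --> gradbar Q eta x.
  have /subspace_continuousP/(_ x (S_closure bx)) :=
    gradbar_continuous beta_gt0 eta_nd.1.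
  move=> /cvg_withinP gu; apply/cvg_withinP => d /gu[r r0 rP].
  by exists r => // y by_; apply: rP; exact: S_closure.
have gb1 : gradbar Q eta z.1 @[z --> F] --> gradbar Q eta x.
  by apply: (cvg_comp fst (gradbar Q eta) _ gb); exact: cvg_fst.
have gb2 : gradbar Q (eta_ z.2) z.1 @[z --> F] --> gradbar Q eta x.
  apply/cvgrPdist_lt => d d0; have d20 : 0 < d / 2 by rewrite divr_gt0.
  have H1 : \forall z \near F, `|gradbar Q eta x - gradbar Q eta z.1| < d / 2.
    by move/cvgrPdist_lt : gb1; exact.
  have H2 : \forall z \near F, bdry Q z.1 /\ forall y, closure Q y ->
      `|gradbar Q (eta_ z.2) y - gradbar Q eta y| <= d / 2.
    exists (bdry Q, [set k | forall y, closure Q y ->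
      `|gradbar Q (eta_ k) y - gradbar Q eta y| <= d / 2]) => //=.
    split; first exact: withinT.
    by apply: filterS (cvg_C1_closure d20) => k kP y /kP[].
  apply: filterS2 H1 H2 => z h1 [bz /(_ z.1 (S_closure bz)) h2].
  apply: le_lt_trans (ler_distD (gradbar Q eta z.1) _ _) _.
  rewrite distrC in h2; rewrite [ltRHS]splitr; exact: (ltr_leD h1 h2).
have dn1 := cvg_deformed_normal e0_gt0 eta_nd bx normal_x gb1.
have dn2 := cvg_deformed_normal e0_gt0 eta_nd bx normal_x gb2.
have H1 := (cvgrPdist_lt _ _).1 (dn1 FF) _ ep2.
have H2 := (cvgrPdist_lt _ _).1 (dn2 FF) _ ep2.
have [[A B] [/= xA oB] AB] := filterI (H1 FF) (H2 FF).
exists ([set y | bdry Q y -> A y], B) => //= -[y k] /= [Ay Bk] by_.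
have [h1 h2] := AB (y, k) (conj (Ay by_) Bk).
apply: le_lt_trans (ler_distD (deformed_normal Q eta x) _ _) _.
by rewrite [ltRHS]splitr; rewrite distrC in h2; exact: (ltrD h2 h1).
Qed.

End deformed_normals.

(** * Local injectivity and contact sets *)

Section segments.
Variables (R : realType) (V : normedModType R).
Implicit Types (x y z : V).

Lemma segment_in_ball x y z (r s : R) : 0 <= s <= 1 ->
  `|x - y| < r -> `|x - z| < r -> `|x - (y + s *: (z - y))| < r.
Proof.
move=> /andP[s0 s1] xy xz.
have -> : x - (y + s *: (z - y)) = (1 - s) *: (x - y) + s *: (x - z).
  rewrite scalerBl scale1r -addrA -scalerN -scalerDr opprD addrA.
  congr (_ + _); rewrite -scalerN; congr (s *: _).
  by rewrite !opprB addrA subrK.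
apply: le_lt_trans (ler_normD _ _) _.
rewrite !normrZ (ger0_norm s0) ger0_norm ?subr_ge0//.
have [->|s_neq0] := eqVneq s 0; first by rewrite subr0 mul1r mul0r addr0.
have s_gt0 : 0 < s by rewrite lt_def s_neq0.
have -> : r = (1 - s) * r + s * r by ring.
by apply: ler_ltD; [rewrite ler_wpM2l ?subr_ge0 ?(ltW xy)|rewrite ltr_pM2l].
Qed.

End segments.

(** The decisive inequality of [local_quasiconvexity]: [u] is the graph below a point of the
    horizontal segment, [a] and [b] the graph below its ends, [c] and [d] the heights of the ends
    before the lift, and [T] the lift. *)
Lemma convex_comb_lt (R : realFieldType) (s u T a b c d : R) : 0 <= s <= 1 ->
  u <= a + T -> u <= b + T -> a < c -> b < d -> u < c + s * (d - c) + T.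
Proof.
move=> /andP[s0 s1] ua ub ac bd.
have h1 : (1 - s) * (u - T) <= (1 - s) * a.
  by rewrite ler_wpM2l ?subr_ge0// lerBlDr.
have h2 : s * (u - T) <= s * b by rewrite ler_wpM2l// lerBlDr.
have h3 : (1 - s) * a <= (1 - s) * c by rewrite ler_wpM2l ?subr_ge0// ltW.
have h4 : s * b <= s * d by rewrite ler_wpM2l// ltW.
have [->|s_neq0] := eqVneq s 0; first by lra.
have h5 : s * b < s * d by rewrite ltr_pM2l// lt_def s_neq0.
lra.
Qed.

Section local_paths.
Variables (R : realType) (n : nat) (alpha : R) (Q : set 'rV[R]_n).
Hypothesis alpha_gt0 : 0 < alpha.
Hypothesis Q_ref : reference_configuration alpha Q.
Implicit Types (x y z : 'rV[R]_n).

Lemma locally_lipschitz m (h : 'rV[R]_m ->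
  R) (p : 'rV[R]_m) : C1Holder_scalar alpha h ->
  exists M d : R, [/\ 0 <= M, 0 < d & forall a b, `|p - a| < d ->
    `|p - b| < d ->
    `|h b - h a| <= M * `|b - a|].
Proof.
move=> hC; have dh := hC.1.
(* The sum dominates every single term and so bounds all partial derivatives at once near [p]. *)
pose B : R := \sum_(k < m) (`|partial k h p| + 1).
have B0 : 0 <= B by apply: sumr_ge0 => k _; rewrite addr_ge0.
have : nbhs p [set q | forall k : 'I_m, `|partial k h q| <= B].
  apply: (@filter_forall _ _ (fun k q => `|partial k h q| <= B) (nbhs p)
    (nbhs_filter p)) => k.
  have ck : continuous (partial k h).
    exact: (C1Holder_scalar_continuous alpha_gt0).
  have [r r0 rP] := (cvg_nbhsP _ _ _).1 (ck p) 1 ltr01.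
  apply/nbhs_normP; exists r => // q /rP; rewrite distrC => pq.
  apply: (@le_trans _ _ (`|partial k h p| + 1)).
    rewrite -(subrK (partial k h p) (partial k h q)) (le_trans (ler_normD _
      _))//.
    by rewrite addrC lerD2l ltW.
  by rewrite /B (bigD1 k)//= lerDl sumr_ge0// => l _; rewrite addr_ge0.
move=> /nbhs_normP[d d0 dP]; exists (m%:R * B), d; split=> //.
  by rewrite mulr_ge0.
move=> a b pa pb; apply: norm_mean_value_le => s s01; split; first exact: dh.
by move=> i; apply: dP; exact: segment_in_ball.
Qed.

(* A point above the graph is first lifted by a multiple [tau] of the vertical
   direction that dominates the oscillation of the graph between the two points,
   so that the horizontal segment between the lifted points stays above it. *)
Lemma local_quasiconvexity x : closure Q x ->
  exists2 C : R, 0 <= C & forall rho : R, 0 < rho -> exists2 r : R, 0 < r &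
    forall y z, Q y -> Q z -> `|x - y| < r -> `|x - z| < r ->
    exists2 tau : 'rV[R]_n, `|tau| <= C * `|z - y| &
      forall (s : R) w, 0 <= s <= 1 ->
        w \in [:: y + s *: tau; z + s *: tau; (y + tau) + s *: (z - y)] ->
        Q w /\ `|x - w| < rho.
Proof.
move=> clx; have oQ := reference_open Q_ref.
have [Qx|nQx] := pselect (Q x).
  exists 0 => // rho rho0.
  have /nbhs_normP[q q0 qQ] := open_nbhs_nbhs (conj oQ Qx).
  exists (Num.min q rho) => [|y z Qy Qz xy xz]; first by rewrite lt_min q0.
  exists 0 => [|s w s01]; first by rewrite normr0 mul0r.
  rewrite scaler0 !addr0 !inE => wE.
  suff : `|x - w| < Num.min q rho by rewrite lt_min => /andP[/qQ].
  by case/or3P: wE => /eqP -> //; exact: segment_in_ball.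
have bx : bdry Q x by split=> // /interior_subset.
have [A [j [h [[AA [r0 r0_gt0 rQ]] hC]]]] := reference_chart Q_ref bx.
pose L y := col' j (y *m A).
have [M [d [M0 d0 hL]]] := locally_lipschitz (L x) hC.
pose cA := n%:R * `|A| + 1.
have cA0 : 0 < cA by rewrite ltr_wpDl// mulr_ge0.
have L_lin y z (s : R) : L (y + s *: z) = L y + s *: L z.
  by rewrite /L mulmxDl -scalemxAl raddfD/= linearZ.
have L_le y z : `|L y - L z| <= cA * `|y - z|.
  have -> : L y - L z = L (y - z) by rewrite /L mulmxBl raddfB.
  apply: (@le_trans _ _ `|(y - z) *m A|).
    apply: norm_le_coord => // a b; rewrite mxE; exact: coord_le_norm.
  apply: le_trans (norm_mulmx_le _ _) _.
  by rewrite mulrAC ler_wpM2r// lerDl.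
(* The vertical direction of the chart: moving along [e] leaves the horizontal coordinates [L]
   unchanged. *)
pose e := delta_mx 0 j *m A^T : 'rV[R]_n.
have eA : e *m A = delta_mx 0 j by rewrite -mulmxA (orth_mulmx_tr AA) mulmx1.
have Le : L e = 0.
  apply/rowP => k; rewrite /L eA !mxE eqxx /=.
  by rewrite eq_sym (negbTE (neq_lift _ _)).
exists (M * cA * `|e|) => [|rho rho0]; first by rewrite !mulr_ge0// ltW.
set C := M * cA * `|e|.
have C0 : 0 <= C by rewrite !mulr_ge0// ltW.
pose rho' := Num.min rho r0.
have rho'0 : 0 < rho' by rewrite lt_min rho0.
have C1 : 0 < 1 + 2 * C by rewrite ltr_pwDl// mulr_ge0.
(* The first bound keeps the horizontal coordinates where the graph is Lipschitz. With [q] the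
   second one, [|z - y| < 2 * q], so a lifted point is within [q + C * (2 * q) = rho'] of [x]. *)
exists (Num.min (d / cA) (rho' / (1 + 2 * C))).
  by rewrite lt_min !divr_gt0.
move=> y z Qy Qz; rewrite !lt_min => /andP[xyd xyr] /andP[xzd xzr].
have Ly : `|L x - L y| < d.
  by apply: le_lt_trans (L_le x y) _; rewrite mulrC -ltr_pdivlMr.
have Lz : `|L x - L z| < d.
  by apply: le_lt_trans (L_le x z) _; rewrite mulrC -ltr_pdivlMr.
have zy : `|z - y| < 2 * (rho' / (1 + 2 * C)).
  apply: le_lt_trans (ler_distD x _ _) _.
  rewrite mulr_natl mulr2n; rewrite distrC in xzr.
  rewrite [X in X + _]distrC; rewrite distrC in xzr; exact: ltrD.
pose T := M * `|L z - L y|.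
have T0 : 0 <= T by rewrite mulr_ge0.
exists (T *: e) => [|s w s01 wE].
  rewrite normrZ ger0_norm// /C /T -!mulrA ler_wpM2l//.
  by rewrite [`|e| * _]mulrC mulrA ler_wpM2r// L_le.
set q := rho' / (1 + 2 * C) in xyr xzr zy.
have q_le : q <= rho'.
  by rewrite /q ler_pdivrMr// ler_peMr ?(ltW rho'0)// lerDl mulr_ge0.
have tau_lt : `|T *: e| <= C * (2 * q).
  apply: le_trans (_ : _ <= C * `|z - y|) _; last by rewrite ler_wpM2l// ltW.
  rewrite normrZ ger0_norm// /C /T -!mulrA ler_wpM2l//.
  by rewrite [`|e| * _]mulrC mulrA ler_wpM2r// L_le.
have above p : Q p -> `|x - p| < q -> h (L p) < (p *m A) 0 j.
  move=> Qp xp; apply/(rQ p) => //; rewrite distrC (lt_le_trans xp)//.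
  by rewrite (le_trans q_le)// ge_min lexx orbT.
(* A common form for the three segments: a point [p] near [x], lifted by the fraction [s'] of
   [T *: e], with [s' = s] on the vertical ones and [s' = 1] on the horizontal one. *)
have [p [s' [-> xp /andP[s'0 s'1] hp]]] : exists p s',
  [/\ w = p + s' *: (T *: e),
    `|x - p| < q, 0 <= s' <= 1 & h (L p) < (p *m A) 0 j + s' * T].
  move: wE; rewrite !inE => /or3P[]/eqP->.
  - exists y, s; split=> //; apply: ltr_wpDr; last exact: above.
    by rewrite mulr_ge0//; case/andP: s01.
  - exists z, s; split=> //; apply: ltr_wpDr; last exact: above.
    by rewrite mulr_ge0//; case/andP: s01.
  - exists (y + s *: (z - y)), 1; split.
    + by rewrite scale1r addrAC.
    + exact: segment_in_ball.
    + by rewrite ler01 lexx.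
    + rewrite mul1r; set u := h _.
      have -> : ((y + s *: (z - y)) *m A) 0 j =
          (y *m A) 0 j + s * ((z *m A) 0 j - (y *m A) 0 j).
        rewrite mulmxDl -scalemxAl mulmxBl.
        by move: (y *m A) (z *m A) => a b; rewrite !mxE.
      have Ls : L (y + s *: (z - y)) = L y + s *: (L z - L y).
        by rewrite L_lin /L mulmxBl raddfB.
      have ball_s : `|L x - L (y + s *: (z - y))| < d.
        by rewrite Ls; exact: segment_in_ball.
      have s_le1 : `|s| <= 1 by case/andP: s01 => s0 s1; rewrite ger0_norm.
      have hy : u <= h (L y) + T.
        rewrite addrC -lerBlDr; apply: le_trans (ler_norm _) _.
        apply: le_trans (hL _ _ Ly ball_s) _; rewrite ler_wpM2l//.
        by rewrite Ls addrC addKr normrZ ler_piMl.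
      have hz : u <= h (L z) + T.
        rewrite addrC -lerBlDr; apply: le_trans (ler_norm _) _.
        apply: le_trans (hL _ _ Lz ball_s) _; rewrite ler_wpM2l//.
        rewrite Ls (_ : _ - _ = (s - 1) *: (L z - L y)).
          rewrite normrZ ler_piMl//; case/andP: s01 => s0 s1.
          by rewrite ler0_norm ?subr_le0// opprB gerBl.
        by rewrite scalerBl scale1r addrAC opprB addrC.
      exact: (convex_comb_lt s01 hy hz (above y Qy xyr) (above z Qz xzr)).
have xw : `|x - (p + s' *: (T *: e))| < rho'.
  rewrite opprD addrA; apply: le_lt_trans (ler_normB _ _) _.
  have -> : rho' = q + C * (2 * q).
    by rewrite /q; field; rewrite gt_eqF.
  apply: ltr_leD => //; apply: le_trans tau_lt.
  by rewrite normrZ ger0_norm// ler_piMl.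
move: xw; rewrite lt_min => /andP[xw1 xw2]; split=> //.
apply/rQ; first by rewrite distrC.
rewrite -/(L _) scalerA L_lin Le scaler0 addr0 mulmxDl -scalemxAl eA.
suff -> : (p *m A + (s' * T) *: delta_mx 0 j) 0 j = (p *m A) 0 j + s' * T by [].
by move: (p *m A) => a; rewrite !mxE !eqxx mulr1.
Qed.

End local_paths.

Section local_injectivity.
Variables (R : realType) (n : nat) (alpha beta : R) (Q : set 'rV[R]_n).
Hypotheses (alpha_gt0 : 0 < alpha) (beta_gt0 : 0 < beta).
Hypothesis Q_ref : reference_configuration alpha Q.
Implicit Types (u : 'rV[R]_n -> 'rV[R]_n) (x y z : 'rV[R]_n).

Lemma segment_linearization u (G : 'M[R]_n) y z (e : R) :
  (forall s : R, 0 <= s <= 1 -> differentiable u (y + s *: (z - y)) /\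
     `|grad u (y + s *: (z - y)) - G| <= e) ->
  `|u z - u y - (z - y) *m G^T| <= n%:R * e * `|z - y|.
Proof.
move=> uG; have e0 : 0 <= e.
  by apply: le_trans (uG 0 _).2; rewrite ?lexx ?ler01.
apply: norm_le_coord => [|a i]; first by rewrite !mulr_ge0.
rewrite ord1.
have [s s01|s s01 uE] := @mean_value_rV _ _ (component u i) y z.
  apply: (@differentiable_comp _ _ _ _ u (fun v : 'rV[R]_n => v 0 i)).
    by have [] := uG s s01.
  exact: differentiable_coord.
have -> : (u z - u y - (z - y) *m G^T) 0 i =
    component u i z - component u i y - ((z - y) *m G^T) 0 i.
  by move: ((z - y) *m G^T) => b; rewrite !mxE.
rewrite uE mxE -sumrB; apply: le_trans (ler_norm_sum _ _ _) _.
apply: le_trans (_ : _ <= \sum_(j < n) `|z - y| * e) _; last first.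
  by rewrite sumr_const card_ord -mulrA mulr_natl mulrC.
apply: ler_sum => j _; rewrite [G^T _ _]mxE -mulrBr normrM ler_pM
  ?coord_le_norm//.
have [_] := uG s s01; apply: le_trans.
have := coord_le_norm (grad u (y + s *: (z - y)) - G) i j.
by rewrite !mxE.
Qed.

Variables (eta_ : nat -> 'rV[R]_n -> 'rV[R]_n) (eta : 'rV[R]_n -> 'rV[R]_n).
Variable e0 : R.
Hypotheses (e0_gt0 : 0 < e0).
Hypothesis eta_k_nd : forall k, nondegenerate beta Q e0 (eta_ k).
Hypotheses (eta_nd : nondegenerate beta Q e0 eta) (eta_cvg : cvg_C1 Q eta_ eta).

(** Along the path of [local_quasiconvexity] the gradient of [eta_ k] is within [e] of the
    invertible matrix [G]. Hence the increment of [eta_ k] differs from the linear one by a small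
    multiple of [|z - y|], which is absorbed into the left-hand side. *)
Lemma uniform_local_injectivity x : closure Q x ->
  exists C r : R, [/\ 0 <= C, 0 < r & \forall k \near \oo,
    forall y z, Q y -> Q z -> `|x - y| < r -> `|x - z| < r ->
      `|z - y| <= C * `|eta_ k z - eta_ k y|].
Proof.
move=> clx; set G := gradbar Q eta x.
have GU : G^T \in unitmx.
  by rewrite unitmx_tr unitmxE unitfE (gradbar_det_neq0 beta_gt0 e0_gt0 eta_nd).
pose c := n%:R * `|invmx G^T| + 1.
have c0 : 0 < c by rewrite ltr_wpDl// mulr_ge0.
have cG (v : 'rV[R]_n) : `|v| <= c * `|v *m G^T|.
  rewrite -{1}(mulmxK GU v); apply: le_trans (norm_mulmx_le _ _) _.
  by rewrite mulrAC ler_wpM2r// lerDl.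
have [K K0 paths] := local_quasiconvexity alpha_gt0 Q_ref clx.
(* The path is at most [(2 * K + 1) * |z - y|] long, so [e = 1 / (2 * D)] makes the error, after
   inverting [G], at most half of [|z - y|]. *)
pose D := c * (n%:R * (2 * K + 1)) + 1.
have D0 : 0 < D by rewrite ltr_wpDl// mulr_ge0 ?(ltW c0)// mulr_ge0//
  addr_ge0// mulr_ge0.
pose e := (2 * D)^-1.
have e0' : 0 < e by rewrite invr_gt0 mulr_gt0.
have e20 : 0 < e / 2 by rewrite divr_gt0.
have eD : c * (n%:R * (2 * K + 1)) * e <= 2^-1.
  rewrite /e invfM mulrCA -{2}[2^-1]mulr1 ler_wpM2l// ?invr_ge0//.
  by rewrite ler_pdivrMr// mul1r /D lerDl.
have [rho rho0 gradG] := (cvg_withinP _ _ _ _).1 (cvg_gradbar beta_gt0 eta_nd.1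
  clx) _ e20.
have [r r0 path_r] := paths rho rho0.
exists (2 * c), r; split=> //; first by rewrite mulr_ge0// ltW.
have := eta_cvg e20; apply: filterS => k etak y z Qy Qz xy xz.
have grad_k w : Q w -> `|x - w| < rho ->
    differentiable (eta_ k) w /\ `|grad (eta_ k) w - G| <= e.
  move=> Qw xw; split; first by have [[_ + _] _] := eta_k_nd k; exact.
  apply: le_trans (ler_distD (grad eta w) _ _) _.
  rewrite [leRHS]splitr; apply: lerD; first by have [_ /ltW] := etak w Qw.
  by have := gradG w Qw xw; rewrite distrC => /ltW.
have [tau tauK path] := path_r y z Qy Qz xy xz.
have h1 : `|eta_ k (y + tau) - eta_ k y - tau *m G^T| <= n%:R * e * `|tau|.
  have := @segment_linearization (eta_ k) G y (y + tau) e.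
  rewrite [y + tau - y]addrC addKr; apply=> s s01.
  have [|] := path s (y + s *: tau) s01; first by rewrite !inE eqxx.
  exact: grad_k.
have h2 : `|eta_ k (z + tau) - eta_ k z - tau *m G^T| <= n%:R * e * `|tau|.
  have := @segment_linearization (eta_ k) G z (z + tau) e.
  rewrite [z + tau - z]addrC addKr; apply=> s s01.
  have [|] := path s (z + s *: tau) s01; first by rewrite !inE eqxx orbT.
  exact: grad_k.
have h3 : `|eta_ k (z + tau) - eta_ k (y + tau) - (z - y) *m G^T|
    <= n%:R * e * `|z - y|.
  have := @segment_linearization (eta_ k) G (y + tau) (z + tau) e.
  have -> : z + tau - (y + tau) = z - y by rewrite opprD addrACA subrr addr0.
  apply=> s s01.
  have [|] := path s (y + tau + s *: (z - y)) s01;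
    first by rewrite !inE eqxx !orbT.
  exact: grad_k.
set d := eta_ k z - eta_ k y.
(* The linear contributions of the two vertical segments cancel. *)
have dE : (z - y) *m G^T = d + (eta_ k (z + tau) - eta_ k z - tau *m G^T)
    - (eta_ k (z + tau) - eta_ k (y + tau) - (z - y) *m G^T)
    - (eta_ k (y + tau) - eta_ k y - tau *m G^T).
  rewrite /d; move: (_ *m _) (tau *m _) (eta_ k _) (eta_ k z) (eta_ k y) (eta_
    k _).
  move=> a b p q t o; apply/rowP => i; rewrite !mxE; ring.
have zyd : `|(z - y) *m G^T| <= `|d| + n%:R * (2 * K + 1) * e * `|z - y|.
  rewrite dE; apply: le_trans (ler_normB _ _) _.
  have -> : n%:R * (2 * K + 1) * e * `|z - y| =
     n%:R * e * (K * `|z - y|) + n%:R * e * `|z - y| + n%:R * e * (K * `|z -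
       y|).
    by ring.
  have tau_le : n%:R * e * `|tau| <= n%:R * e * (K * `|z - y|).
    by rewrite ler_wpM2l// mulr_ge0// ltW.
  rewrite [leRHS]addrA; apply: lerD; last exact: le_trans h1 tau_le.
  apply: le_trans (ler_normB _ _) _; rewrite [leRHS]addrA; apply: lerD => //.
  apply: le_trans (ler_normD _ _) _; rewrite lerD2l; exact: le_trans h2 tau_le.
have : `|z - y| <= c * `|d| + 2^-1 * `|z - y|.
  apply: le_trans (cG (z - y)) _.
  apply: le_trans (ler_wpM2l (ltW c0) zyd) _.
  by rewrite mulrDr lerD2l mulrA ler_wpM2r// mulrA.
rewrite -lerBlDr -{1}[`|z - y|]mul1r -mulrBl => H.
have : 2 * ((1 - 2^-1) * `|z - y|) <= 2 * (c * `|d|) by rewrite ler_wpM2l.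
by rewrite !mulrA mulrBr mulr1 divff// -[X in X - 1]/(1 + 1) addrK mul1r.
Qed.

(** Points of the closure are replaced by points of [Q] at distance at most [d], with images at most
    [d] apart; the total error is [(2 + 2 * C) * d = e]. *)
Lemma uniform_local_injectivity_closure x : closure Q x ->
  exists2 r : R, 0 < r & \forall k \near \oo,
    forall y z, closure Q y -> closure Q z -> `|x - y| < r -> `|x - z| < r ->
      eta_ k z = eta_ k y -> z = y.
Proof.
move=> /uniform_local_injectivity[C [r [C0 r0 HC]]]; exists r => //.
apply: filterS HC => k kP y z cly clz xy xz etazy.
apply/eqP; rewrite -subr_eq0 -normr_le0; apply/ler_addgt0Pr => e ep.
rewrite add0r.
have D0 : 0 < 2 + 2 * C by rewrite ltr_pwDl// mulr_ge0.
pose d := e / (2 + 2 * C).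
have d0 : 0 < d by rewrite divr_gt0.
have cu (w : 'rV[R]_n) : closure Q w ->
    eta_ k v @[v --> within Q (nbhs w)] --> eta_ k w.
  move=> clw; have [[cetak _ _] _] := eta_k_nd k.
  have := (subspace_continuousP _ _).1 cetak w clw.
  move=> /cvg_withinP cw; apply/cvg_withinP => a /cw[b b0 bP];
    exists b => // v Qv.
  by apply: bP; exact: subset_closure.
have near_pt w : closure Q w -> `|x - w| < r ->
  exists w', [/\ Q w', `|x - w'| < r,
    `|w - w'| <= d & `|eta_ k w - eta_ k w'| <= d].
  move=> clw xw; have q0 : 0 < Num.min d (r - `|x - w|) by rewrite lt_min d0
    subr_gt0.
  have [v [Qv wv ev]] := within_limit_near clw (cu w clw) d0 q0.
  move: wv; rewrite lt_min => /andP[wv1 wv2]; exists v; split=> //;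
    try exact: ltW.
  apply: le_lt_trans (ler_distD w _ _) _.
  by rewrite addrC -ltrBrDr.
have [y' [Qy' xy' yy' ey']] := near_pt y cly xy.
have [z' [Qz' xz' zz' ez']] := near_pt z clz xz.
have := kP y' z' Qy' Qz' xy' xz' => H.
have eta_le : `|eta_ k z' - eta_ k y'| <= d + d.
  apply: le_trans (ler_distD (eta_ k z) _ _) _; apply: lerD;
    first by rewrite distrC.
  by rewrite etazy.
have -> : e = d + (C * (d + d) + d).
  have -> : e = (2 + 2 * C) * d by rewrite /d mulrC divfK// gt_eqF.
  by ring.
apply: le_trans (ler_distD z' _ _) _; apply: lerD => //.
apply: le_trans (ler_distD y' _ _) _; apply: lerD; last by rewrite distrC.
by apply: le_trans H _; rewrite ler_wpM2l.
Qed.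

End local_injectivity.

Section contact_set_stability.
Variables (R : realType) (n : nat) (alpha beta : R) (Q Omega : set 'rV[R]_n).
Hypotheses (alpha_gt0 : 0 < alpha) (beta_gt0 : 0 < beta).
Hypothesis Q_ref : reference_configuration alpha Q.
Implicit Types (x y z : 'rV[R]_n).
Variables (eta_ : nat -> 'rV[R]_n -> 'rV[R]_n) (eta : 'rV[R]_n -> 'rV[R]_n).
Variable e0 : R.
Hypotheses (e0_gt0 : 0 < e0).
Hypothesis eta_k_nd : forall k, nondegenerate beta Q e0 (eta_ k).
Hypotheses (eta_nd : nondegenerate beta Q e0 eta) (eta_cvg : cvg_C1 Q eta_ eta).

Let closed_away (K : set 'rV[R]_n) x : closed K -> ~ K x ->
  exists2 r : R, 0 < r & forall y, `|x - y| < r -> ~ K y.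
Proof.
move=> cK nK; have oK : open (~` K) by rewrite openC.
exact: (nbhs_normP _ _).1 (open_nbhs_nbhs (conj oK nK)).
Qed.

(** Self-contact of a point near [x] is excluded with nearby points by uniform local injectivity,
    and with far points because [eta x] has positive distance from the compact image of the far part
    of the closure. Contact with the boundary of [Omega], a closed set, is excluded likewise. *)
Lemma contact_set_stable x : ~ contact_set Q Omega eta x ->
  exists2 r : R, 0 < r & \forall k \near \oo,
    forall y, `|x - y| < r -> ~ contact_set Q Omega (eta_ k) y.
Proof.
move=> ncx; have ccl : closed (closure Q) by exact: closed_closure.
have [clx|nclx] := pselect (closure Q x); last first.
  have [r r0 rP] := closed_away ccl nclx.
  by exists r => //; near=> k => y /rP ncl [].
have nOmega : ~ bdry Omega (eta x) by move=> bO; apply: ncx; split=> //; left.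
have preim : [set y | closure Q y /\ eta y = eta x] = [set x].
  by apply: contrapT => np; apply: ncx; split=> //; right.
have ceta : {within closure Q, continuous eta} by have [[]] := eta_nd.
have [r1 r10 inj] := uniform_local_injectivity_closure alpha_gt0 beta_gt0 Q_ref
  e0_gt0 eta_k_nd eta_nd eta_cvg clx.
pose far := closure Q `\` [set y | `|x - y| < r1].
have cfar : compact far.
  apply: (subclosed_compact _ (reference_compact_closure Q_ref));
    last by move=> y [].
  by rewrite /far setDE; apply: closedI => //; rewrite closedC;
    exact: open_norm_ball.
have [d d0 dP] : exists2 d : R, 0 < d & forall z, far z ->
  d <= `|eta x - eta z|.
  have : closed (eta @` far).
    apply: compact_closed; first exact: norm_hausdorff.
    by apply: continuous_compact cfar; apply: continuous_subspaceW ceta => y [].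
  move=> /closed_away => /(_ (eta x))[|d d0 dP].
    move=> [z [clz nz] etaz]; have : [set x] z by rewrite -preim.
    by move=> zx; apply: nz; rewrite /= zx subrr normr0.
  exists d => // z fz; rewrite leNgt; apply/negP => /dP; apply.
  by exists z.
have [d3 d30 d3P] := closed_away (@bdry_closed _ _ Omega) nOmega.
(* [eta_ k y] is within [m + m] of [eta x]: one [m] for moving the point, one for changing the
   deformation. A far point costs a third [m]. *)
pose m := Num.min (d / 3) (d3 / 2).
have m0 : 0 < m by rewrite lt_min !divr_gt0.
have md : m + m + m <= d.
  have : m <= d / 3 by rewrite ge_min lexx.
  lra.
have md3 : m + m <= d3.
  have : m <= d3 / 2 by rewrite ge_min lexx orbT.
  lra.
have [r2 r20 r2P] := within_continuous_ball ceta clx m0.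
exists (Num.min r1 r2); first by rewrite lt_min r10.
have := cvg_C1_closure beta_gt0 eta_k_nd eta_nd eta_cvg m0.
apply: filterS2 inj => k injk etak y; rewrite lt_min => /andP[xy1 xy2].
move=> [cly]; have xky : `|eta x - eta_ k y| < m + m.
  apply: le_lt_trans (ler_distD (eta y) _ _) _; apply: ltr_leD.
    exact: r2P.
  by rewrite distrC; have [] := etak y cly.
case=> [bO|ns].
  by apply: d3P bO; exact: lt_le_trans xky md3.
apply: ns; apply/seteqP; split=> [z [clz etaz]|_ ->]; last by [].
rewrite /=; apply: contrapT => zy.
have [xz|xz] := ltP `|x - z| r1; first by apply: zy; exact: injk.
have fz : far z by split=> //= xz'; rewrite ltNge xz in xz'.
have : `|eta x - eta z| < m + m + m.
  apply: le_lt_trans (ler_distD (eta_ k y) _ _) _; apply: ltr_leD => //.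
  by rewrite -etaz; have [] := etak z clz.
by rewrite ltNge (le_trans md (dP z fz)).
Unshelve. all: by end_near. Qed.

End contact_set_stability.

(** * Vector measures and contact forces *)

Section vector_measures.
Variables (R : realType) (n : nat).
Local Notation T := (borel_rV R n).
Implicit Types (nu : {charge set T -> \bar R}) (sigma : vmeasure R n)
  (A D K U : set T).

(** [P] and [N] are the Hahn sets behind [charge_integral]. The bound involves [nu] only through its
    values on two disjoint sets, as [vmeasure_norm] can control them. *)
Lemma charge_integral_bound nu : exists P N : set T,
  [/\ measurable P, measurable N, P `&` N = set0 &
    forall D (f : T -> R) (M : R), measurable D -> measurable_fun D f ->
      (forall x, D x -> `|f x| <= M) ->
      `|charge_integral nu D f| <=
        M * (`|fine (nu (D `&` P))| + `|fine (nu (D `&` N))|)].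
Proof.
rewrite /charge_integral/=.
set h := svalP (cid (svalP (cid (Hahn_decomposition nu)))).
have [[mP _] [mN _] _ PN] := h.
exists (sval (cid (Hahn_decomposition nu))),
  (sval (cid (svalP (cid (Hahn_decomposition nu))))); split=> // D f M mD mf fM.
have pE : jordan_pos h D = nu (D `&` sval (cid (Hahn_decomposition nu))).
  by rewrite jordan_posE cjordan_posE /crestr0 mem_set.
have nE : jordan_neg h D =
    (- nu (D `&` sval (cid (svalP (cid (Hahn_decomposition nu))))))%E.
  by rewrite jordan_negE cjordan_negE /crestr0 mem_set.
rewrite mulrDr; apply: le_trans (ler_normB _ _) _; apply: lerD.
  apply: le_trans (@le_Rintegral_bound _ _ _ (jordan_pos h) D f M mD mf fM) _.
  by rewrite -pE [`|fine _|]ger0_norm// fine_ge0.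
apply: le_trans (@le_Rintegral_bound _ _ _ (jordan_neg h) D f M mD mf fM) _.
by rewrite -[`|fine (nu _)|]normrN -fineN -nE [`|fine _|]ger0_norm// fine_ge0.
Qed.

Lemma vmeasure_norm_ge sigma c A B : measurable A -> measurable B ->
  A `&` B = set0 ->
  ((`|fine (sigma c A)| + `|fine (sigma c B)|)%:E <= vmeasure_norm sigma)%E.
Proof.
move=> mA mB AB; pose F (i : 'I_2) := if i == 0 then A else B.
apply: (@le_trans _ _ (\sum_i enorm (vmeasure_at sigma (F i)))%:E); last first.
  apply: ereal_sup_ubound; exists 2%N, F; split=> //.
    by move=> i; rewrite /F; case: ifP.
  move=> i j _ _ [x []]; rewrite /F.
  have nAB : A x -> B x -> False by move=> Ax Bx; rewrite -[False]/(set0 x) -AB.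
  case: i => [[|[|//]] i]; case: j => [[|[|//]] j] /= h1 h2;
    first exact/val_inj.
  - by case: (nAB h1 h2).
  - by case: (nAB h2 h1).
  - exact/val_inj.
rewrite lee_fin big_ord_recl big_ord1 /F/=.
apply: lerD; [have := coord_le_enorm (vmeasure_at sigma A) c|
              have := coord_le_enorm (vmeasure_at sigma B) c];
  by rewrite mxE.
Qed.

Lemma vmeasure_integral_bound sigma D (phi : 'rV[R]_n -> 'rV[R]_n) (M C : R) :
  measurable D -> (forall c, measurable_fun D (component phi c : T -> R)) ->
  0 <= M -> (forall x, D x -> `|phi x| <= M) ->
  (vmeasure_norm sigma <= C%:E)%E ->
  `|vmeasure_integral sigma D phi| <= n%:R * (M * C).
Proof.
move=> mD mphi M0 phiM sC; apply: le_trans (ler_norm_sum _ _ _) _.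
apply: le_trans (_ : _ <= \sum_(c < n) M * C) _; last first.
  by rewrite sumr_const card_ord mulr_natl.
apply: ler_sum => c _.
have [P [N [mP mN PN bd]]] := charge_integral_bound (sigma c).
apply: le_trans (bd D _ M mD (mphi c) _) _.
  by move=> x Dx; apply: le_trans (phiM x Dx); exact: coord_le_norm.
rewrite ler_wpM2l// -lee_fin; apply: le_trans sC; apply: vmeasure_norm_ge.
- exact: measurableI.
- exact: measurableI.
- by rewrite setIACA PN setI0.
Qed.

(** Asked of all measurable subsets, because positive and negative parts may cancel on [U] itself:
    this is vanishing total variation. *)
Definition vmeasure_null sigma U :=
  forall c A, measurable A -> A `<=` U -> sigma c A = 0%E.

Lemma vmeasure_nullU sigma U V : measurable U -> vmeasure_null sigma U ->
  vmeasure_null sigma V -> vmeasure_null sigma (U `|` V).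
Proof.
move=> mU nU nV c A mA AUV; rewrite (chargeDI _ mA mU).
rewrite (nU c (A `&` U)) ?(nV c (A `\` U)) ?adde0//.
- exact: measurableD.
- by move=> x [/AUV[]].
- exact: measurableI.
Qed.

Lemma supp_vmeasure_null sigma (x : 'rV[R]_n) : ~ vmeasure_supp sigma x ->
  exists U : set 'rV[R]_n, [/\ open U, U x & vmeasure_null sigma U].
Proof.
move=> /existsNP[U /not_implyP[oU /not_implyP[Ux nA]]].
exists U; split=> // c A mA AU.
have /rowP/(_ c) : vmeasure_at sigma A = 0.
  by apply/eqP; apply: contrapT => /negP A0; apply: nA; exists A.
rewrite !mxE => f0.
by rewrite -[LHS]fineK ?f0// fin_num_measure.
Qed.

(** Each point off the support has an open null neighbourhood, and finitely many of these cover
    [K]. *)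
Lemma compact_vmeasure_null sigma (K : set 'rV[R]_n) : compact K ->
  (forall x, K x -> ~ vmeasure_supp sigma x) -> vmeasure_null sigma K.
Proof.
move=> cK Ks.
have /choice[U UP] (x : 'rV[R]_n) : exists U : set 'rV[R]_n,
    K x -> [/\ open U, U x & vmeasure_null sigma U].
  have [/Ks/supp_vmeasure_null[U UP]|nK] := pselect (K x); first by exists U.
  by exists set0.
move: cK; rewrite compact_cover => /(_ _ K U)[x Kx|x Kx|E EK KE].
- by have [] := UP x Kx.
- by exists x => //; have [] := UP x Kx.
- have /finite_seqP[t Et] := finite_fset E; rewrite Et in KE.
  have tK x : x \in t -> K x.
    move=> xt; apply/set_mem/EK.
    by have : [set` t] x by []; rewrite -Et.
  suff nU : vmeasure_null sigma (cover [set` t] U).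
    by move=> c A mA AK; apply: nU => // y /AK/KE.
  rewrite /cover bigcup_seq big_seq; elim/big_rec : _ => [|x V xt nV].
    by move=> c A _; rewrite subset0 => ->; rewrite charge0.
  have [oU _ nU] := UP x (tK x xt).
  by apply: vmeasure_nullU => //; exact: open_measurable_rV.
Qed.

Lemma vmeasure_integral_null sigma K D (phi : 'rV[R]_n -> 'rV[R]_n) (M : R) :
  measurable K -> measurable D -> vmeasure_null sigma K ->
  (forall c, measurable_fun D (component phi c : T -> R)) ->
  (forall x, D x -> `|phi x| <= M) ->
  (forall x, D x -> ~ K x -> phi x = 0) ->
  vmeasure_integral sigma D phi = 0.
Proof.
move=> mK mD nK mphi phiM phi0; rewrite /vmeasure_integral big1// => c _.
have -> : charge_integral (sigma c) D (component phi c) =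
    charge_integral (sigma c) (D `&` K) (component phi c).
  rewrite /charge_integral/=; congr (_ - _);
  rewrite Rintegral_mkcondr; apply: eq_Rintegral => x; rewrite inE => Dx;
  rewrite patchE; case: ifPn => //; rewrite notin_setE => nKx;
  by rewrite /component phi0// mxE.
apply/eqP; rewrite -normr_le0.
have [P [N [mP mN PN bd]]] := charge_integral_bound (sigma c).
apply: le_trans (bd (D `&` K) _ M (measurableI _ _ mD mK) _ _) _.
- by apply: measurable_funS (mphi c) => // x [].
- move=> x [Dx _]; apply: le_trans (phiM x Dx); exact: coord_le_norm.
- rewrite !nK ?normr0 ?addr0 ?mulr0//.
  + by apply: measurableI => //; exact: measurableI.
  + by move=> x [[]].
  + by apply: measurableI => //; exact: measurableI.
  + by move=> x [[]].
Qed.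

End vector_measures.

Lemma Rintegral_sum d (T : measurableType d) (R : realType)
    (mu : {measure set T -> \bar R}) (D : set T) I (r : seq I) (f : I -> T ->
      R) :
  measurable D -> (forall i, mu.-integrable D (EFin \o f i)) ->
  \int[mu]_(x in D) (\sum_(i <- r) f i x) =
  \sum_(i <- r) \int[mu]_(x in D) f i x.
Proof.
move=> mD intf; elim: r => [|i r IH].
  rewrite big_nil; under eq_Rintegral do rewrite big_nil.
  by rewrite Rintegral_cst// mul0r.
rewrite big_cons -IH -RintegralD//.
  by apply: eq_Rintegral => x _; rewrite big_cons.
have := integrable_sum mD r (P := xpredT) (fun i _ => intf i).
by apply: eq_integrable => // x _ /=; rewrite sumEFin.
Qed.

Section densities.
Variables (R : realType) (n : nat) (mu : {finite_measure set (borel_rV R n) ->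
  \bar R}).
Variables (S : set (borel_rV R n)) (g : 'rV[R]_n -> 'rV[R]_n) (G : R).
Hypothesis mS : measurable S.
Hypothesis mg : forall c, measurable_fun S (component g c : borel_rV R n -> R).
Hypothesis gG : forall x, S x -> `|g x| <= G.
Local Notation T := (borel_rV R n).

Let gS c : T -> R := (component g c : T -> R) \_ S.

Let gcG c x : S x -> `|component g c x| <= G.
Proof. by move=> Sx; exact: le_trans (coord_le_norm (g x) 0 c) (gG Sx). Qed.

Let m_gS c : measurable_fun [set: T] (gS c).
Proof. exact: (measurable_restrictT _ mS).1 (mg c). Qed.

Let gS_le c x : `|gS c x| <= `|G|.
Proof.
rewrite /gS patchE; case: ifPn => [/set_mem Sx|_]; last by rewrite normr0.
exact: le_trans (gcG c Sx) (ler_norm _).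
Qed.

Let int_gS c : mu.-integrable [set: T] (EFin \o gS c).
Proof. by apply: bounded_integrable => // x _; exact: gS_le. Qed.

(** The measure [g mu] on [S], with [g] extended by zero. The second clause, absolute continuity
    with respect to [mu] on [S], transfers null sets of [mu] to [sigma] when the support is
    located. *)
Lemma density_vmeasure : exists sigma : vmeasure R n,
  [/\ vmeasure_on S sigma,
      forall c A, measurable A -> mu (A `&` S) = 0%E -> sigma c A = 0%E &
      forall (phi : 'rV[R]_n -> 'rV[R]_n) (M : R),
        (forall c, measurable_fun S (component phi c : T -> R)) ->
        (forall x, S x -> `|phi x| <= M) ->
        vmeasure_integral sigma S phi = \int[mu]_(x in S) dotrV (phi x) (g x)].
Proof.
pose sigma c := [the {charge set T -> \bar R} of induced_charge (int_gS c)].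
have sigmaE c A : measurable A -> sigma c A = (\int[mu]_(x in A) (gS c x)%:E)%E
  by [].
have null c A : measurable A -> mu (A `&` S) = 0%E -> sigma c A = 0%E.
  move=> mA muAS; rewrite sigmaE//.
  have -> : (\int[mu]_(x in A) (gS c x)%:E = \int[mu]_(x in A `&` S) (gS c
    x)%:E)%E.
    rewrite integral_mkcondr; apply: eq_integral => x _; rewrite patchE.
    by case: ifPn => //; rewrite /gS patchE => /negbTE ->.
  apply: null_set_integral => //; first exact: measurableI.
  exact/measurable_EFinP/measurable_funTS.
exists sigma; split=> //.
  by move=> c A mA AS; apply: null => //; rewrite AS measure0.
move=> phi M mphi phiM.
have mphig c : measurable_fun S (fun x : T =>
  component phi c x * component g c x).
  exact: measurable_funM.
have phicM c x : S x -> `|component phi c x| <= M.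
  by move=> Sx; exact: le_trans (coord_le_norm (phi x) 0 c) (phiM x Sx).
rewrite /dotrV (@Rintegral_sum _ _ _ mu S 'I_n (index_enum _)
  (fun c x => phi x 0 c * g x 0 c))//; last first.
  move=> c; apply: (@bounded_integrable _ _ _ mu S _ (M * G)) => [||x Sx] //;
    first exact: (mphig c).
  by rewrite /= normrM; apply: ler_pM => //; [exact: phicM|exact: gcG].
apply: eq_bigr => c _.
apply: (@charge_integral_density _ _ _ mu S (component phi c) (component g c) M
  G) => //.
- by move=> x; exact: phicM.
- by move=> x; exact: gcG.
move=> A mA AS; rewrite sigmaE//; congr fine; apply: eq_integral => x.
by rewrite inE => /AS Sx; rewrite /gS patchE mem_set.
Qed.

End densities.

Section weak_limits.
Variables (R : realType) (n : nat) (K : set 'rV[R]_n).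
Hypothesis cK : compact K.
Local Notation T := (borel_rV R n).

Lemma compact_measurable_rV : measurable (K : set T).
Proof.
apply: closed_measurable_rV; apply: compact_closed => //; exact: norm_hausdorff.
Qed.

Lemma weak_limit_uniform (mu_ : nat -> {finite_measure set T -> \bar R})
    (mu : {finite_measure set T -> \bar R}) (C : R)
    (f_ : nat -> 'rV[R]_n -> R) (f : 'rV[R]_n -> R) :
  (forall k, fine (mu_ k K) <= C) ->
  \int[mu_ k]_(x in K) f x @[k --> \oo] --> \int[mu]_(x in K) f x ->
  (forall k, {within K, continuous (f_ k)}) -> {within K, continuous f} ->
  (forall e, 0 < e -> \forall k \near \oo, forall x, K x ->
    `|f_ k x - f x| <= e) ->
  \int[mu_ k]_(x in K) f_ k x @[k --> \oo] --> \int[mu]_(x in K) f x.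
Proof.
move=> muC mu_f cf_ cf fu.
have mK := compact_measurable_rV.
have C0 : 0 <= C by apply: le_trans (muC 0%N); exact: fine_ge0.
have intK (m : {finite_measure set T -> \bar R}) (h : 'rV[R]_n -> R) :
    {within K, continuous h} -> m.-integrable K (EFin \o (h : T -> R)).
  move=> ch; have [B B0 hB] := compact_within_bounded cK (@subset_refl _ K) ch.
  exact: (bounded_integrable m mK (within_continuous_measurable mK ch) hB).
apply/cvgrPdist_le => e e0; have e20 : 0 < e / 2 by rewrite divr_gt0.
have e'0 : 0 < e / 2 / (C + 1) by rewrite divr_gt0// ltr_wpDl.
move/cvgrPdist_le : mu_f => /(_ _ e20) H1.
move: H1 (fu _ e'0); apply: filterS2 => k h1 h2.
apply: le_trans (ler_distD (\int[mu_ k]_(x in K) f x) _ _) _.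
rewrite [leRHS]splitr; apply: lerD => //.
rewrite -RintegralB//; [|exact: intK|exact: intK].
apply: le_trans (@le_Rintegral_bound _ _ _ (mu_ k) K _ (e / 2 / (C + 1)) mK _
  _) _.
- by apply: measurable_funB; exact: within_continuous_measurable.
- by move=> x Kx; rewrite distrC; exact: h2.
- rewrite mulrAC ler_pdivrMr ?ltr_wpDl// ler_wpM2l ?(ltW e20)//.
  by rewrite (le_trans (muC k))// lerDl.
Qed.

End weak_limits.

Lemma split_modulus (R : realFieldType) (N e : R) : 0 <= N -> 0 < e ->
  N * (e / (2 * N + 1)) <= e / 2.
Proof.
move=> N0 e0; have N1 : 0 < 2 * N + 1 by rewrite ltr_wpDl// mulr_ge0.
rewrite mulrA ler_pdivrMr//.
have -> : e / 2 * (2 * N + 1) = N * e + e / 2 by field.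
by rewrite lerDl divr_ge0// ltW.
Qed.

Lemma near_subsequence (s : nat -> nat) (P : nat -> Prop) :
  {homo s : i j / (i < j)%N} -> (\forall k \near \oo, P k) ->
  \forall k \near \oo, P (s k).
Proof.
move=> s_incr [N _ NP]; exists N => // k /= Nk; apply: NP.
apply: leq_trans Nk _; elim: k => // k IH.
exact: leq_ltn_trans IH (s_incr _ _ (ltnSn k)).
Qed.

(** * Compactness of contact forces *)

Section contact_force_compactness.
Variables (R : realType) (n : nat) (alpha beta : R) (Q Omega : set 'rV[R]_n).
Hypotheses (alpha_gt0 : 0 < alpha) (beta_gt0 : 0 < beta).
Hypothesis Q_ref : reference_configuration alpha Q.
Variables (eta_ : nat -> 'rV[R]_n -> 'rV[R]_n) (eta : 'rV[R]_n -> 'rV[R]_n).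
Variables (e0 C : R) (sigma_ : nat -> vmeasure R n).
Hypotheses (e0_gt0 : 0 < e0).
Hypothesis eta_k_nd : forall k, nondegenerate beta Q e0 (eta_ k).
Hypotheses (eta_nd : nondegenerate beta Q e0 eta) (eta_cvg : cvg_C1 Q eta_ eta).
Hypothesis sigma_force : forall k, contact_force Q Omega (eta_ k) (sigma_ k).
Hypothesis sigma_bounded : forall k, (vmeasure_norm (sigma_ k) <= C%:E)%E.
Local Notation T := (borel_rV R n).
Local Notation S := (bdry Q).
Local Notation normal u := (deformed_normal Q u).
Implicit Types (phi : 'rV[R]_n -> 'rV[R]_n).

Let cS : compact S. Proof. exact: reference_compact_bdry Q_ref. Qed.

Let mS : measurable (S : set T). Proof. exact: compact_measurable_rV. Qed.

Let normal_continuous u : nondegenerate beta Q e0 u ->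
  {within S, continuous (normal u)}.
Proof. exact: (deformed_normal_continuous alpha_gt0 beta_gt0 Q_ref e0_gt0). Qed.

Let normal_le1 u x : nondegenerate beta Q e0 u -> S x -> `|normal u x| <= 1.
Proof. exact: (deformed_normal_le1 beta_gt0 Q_ref e0_gt0). Qed.

Lemma within_continuous_component phi c (K : set 'rV[R]_n) :
  {within K, continuous phi} -> {within K, continuous (component phi c)}.
Proof.
move=> cphi; apply/subspace_continuousP => x Kx.
by apply: cvg_coord; exact: (subspace_continuousP _ _).1 cphi x Kx.
Qed.

Lemma within_continuous_dotrV phi psi (K : set 'rV[R]_n) :
  {within K, continuous phi} -> {within K, continuous psi} ->
  {within K, continuous (fun x => dotrV (phi x) (psi x))}.
Proof.
move=> cphi cpsi; apply/subspace_continuousP => x Kx.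
by apply: cvg_dotrV; [exact: (subspace_continuousP _ _).1 cphi x Kx|
                      exact: (subspace_continuousP _ _).1 cpsi x Kx].
Qed.

Let m_component phi c : {within S, continuous phi} ->
  measurable_fun (S : set T) (component phi c : T -> R).
Proof.
by move=> cphi; apply: within_continuous_measurable mS _;
  exact: within_continuous_component.
Qed.

Lemma contact_mass_bound u sigma (mu : {finite_measure set T -> \bar R}) :
  nondegenerate beta Q e0 u -> (vmeasure_norm sigma <= C%:E)%E ->
  (forall phi, {within S, continuous phi} -> vmeasure_integral sigma S phi =
     \int[mu]_(x in S) dotrV (phi x) (normal u x)) ->
  fine (mu S) <= n%:R * (1 * C).
Proof.
move=> ndu sC muE; have cn := normal_continuous ndu.
have -> : fine (mu S) = vmeasure_integral sigma S (normal u).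
  rewrite muE// -[LHS]mul1r -Rintegral_cst//; apply: eq_Rintegral => x.
  by rewrite inE => Sx; rewrite (deformed_normal_unit beta_gt0 Q_ref e0_gt0 ndu
    Sx).
apply: le_trans (ler_norm _) _.
apply: vmeasure_integral_bound => //; first by move=> c; exact: m_component.
by move=> x; exact: normal_le1.
Qed.

Theorem contact_forces_compact :
  exists (s : nat -> nat) (sigma : vmeasure R n),
    [/\ {homo s : i j / (i < j)%N},
        vmeasure_on S sigma,
        contact_force Q Omega eta sigma &
        forall (phi_ : nat -> 'rV[R]_n -> 'rV[R]_n) phi,
          (forall k, {within S, continuous (phi_ k)}) ->
          {within S, continuous phi} ->
          (forall e, 0 < e -> \forall k \near \oo, forall x, S x ->
             `|phi_ k x - phi x| <= e) ->
          vmeasure_integral (sigma_ (s k)) S (phi_ k) @[k --> \oo]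
            --> vmeasure_integral sigma S phi].
Proof.
have /choice[mu_ mu_P] k : exists mu : {finite_measure set T -> \bar R},
    forall phi, {within S, continuous phi} ->
      vmeasure_integral (sigma_ k) S phi =
      \int[mu]_(x in S) dotrV (phi x) (normal (eta_ k) x).
  by have [_ _ [mu [_ muP]]] := sigma_force k; exists mu.
have massb k : fine (mu_ k S) <= n%:R * (1 * C).
  exact: contact_mass_bound (eta_k_nd k) (sigma_bounded k) (mu_P k).
have [s [mu [s_incr mu0 mu_cvg]]] := finite_measures_weakly_compact cS massb.
have subseq P := @near_subsequence s P s_incr.
have cn := normal_continuous eta_nd.
have [sigma [sigma_on sigma_null sigmaE]] :=
  density_vmeasure mu mS (fun c => m_component c cn) (fun x =>
    normal_le1 eta_nd (x := x)).
have sigma_int phi : {within S, continuous phi} ->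
  vmeasure_integral sigma S phi =
    \int[mu]_(x in S) dotrV (phi x) (normal eta x).
  move=> cphi; have [B B0 phiB] := compact_within_bounded cS (@subset_refl _ S)
    cphi.
  by apply: (sigmaE _ B) => // c; exact: m_component.
have conv (phi_ : nat -> 'rV[R]_n -> 'rV[R]_n) phi :
    (forall k, {within S, continuous (phi_ k)}) -> {within S, continuous phi} ->
    (forall e, 0 < e -> \forall k \near \oo, forall x, S x ->
       `|phi_ k x - phi x| <= e) ->
    vmeasure_integral (sigma_ (s k)) S (phi_ k) @[k --> \oo]
      --> vmeasure_integral sigma S phi.
  move=> cphi_ cphi phiu; rewrite sigma_int//.
  under eq_fun do rewrite mu_P//.
  have cdot := within_continuous_dotrV cphi cn.
  have cdot_ k : {within S, continuous
      (fun x => dotrV (phi_ k x) (normal (eta_ (s k)) x))}.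
    exact: within_continuous_dotrV (cphi_ k) (normal_continuous (eta_k_nd (s
      k))).
  have W := @weak_limit_uniform _ _ S cS (fun k => mu_ (s k)) mu _
    (fun k x => dotrV (phi_ k x) (normal (eta_ (s k)) x))
    (fun x => dotrV (phi x) (normal eta x))
    (fun k => massb (s k)) (mu_cvg _ cdot) cdot_ cdot.
  apply: W.
  move=> e ep; have [B B0 phiB] := compact_within_bounded cS (@subset_refl _ S)
    cphi.
  (* The error of the dot products is at most [n * d] from the test functions plus [n * B * d] from
     the normals; the factor [n * (B + 1)] dominates both. *)
  have nB0 : 0 < 2 * (n%:R * (B + 1)) + 1.
    by rewrite ltr_wpDl// !mulr_ge0// addr_ge0.
  have d0 : 0 < e / (2 * (n%:R * (B + 1)) + 1) by rewrite divr_gt0.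
  set d := e / _ in d0.
  have nd : n%:R * (B + 1) * d <= e / 2.
    by apply: split_modulus; rewrite ?mulr_ge0 ?addr_ge0.
  have nd' : n%:R * d <= e / 2.
    apply: le_trans nd; rewrite ler_wpM2r ?(ltW d0)// ler_peMr//.
    by rewrite lerDr.
  have := subseq _ (deformed_normal_uniform alpha_gt0 beta_gt0 Q_ref e0_gt0
    eta_k_nd eta_nd eta_cvg d0).
  move: (phiu d d0); apply: filterS2 => k h1 h2 x Sx.
  have -> : dotrV (phi_ k x) (normal (eta_ (s k)) x) - dotrV (phi x) (normal
    eta x) =
      dotrV (phi_ k x - phi x) (normal (eta_ (s k)) x) +
      dotrV (phi x) (normal (eta_ (s k)) x - normal eta x).
    by rewrite dotrVBl dotrVBr addrA subrK.
  apply: le_trans (ler_normD _ _) _; rewrite [leRHS]splitr; apply: lerD.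
    apply: le_trans (dotrV_le _ _) _; apply: le_trans nd'.
    rewrite -mulrA ler_wpM2l// -[leRHS]mulr1; apply: ler_pM => //;
      first exact: h1.
    exact: normal_le1.
  apply: le_trans (dotrV_le _ _) _; apply: le_trans nd.
  rewrite -!mulrA ler_wpM2l//; apply: ler_pM => //; last exact/ltW/h2.
  by rewrite (le_trans (phiB x Sx))// lerDl.
exists s, sigma; split=> //; split=> //; last first.
  exists mu; split=> // A mA AS; apply/eqP; rewrite -measure_le0 -mu0.
  apply: le_measure; rewrite ?inE//; first exact: measurableC.
  by move=> x Ax Sx; have : (A `&` S) x by []; rewrite AS.
move=> x suppx; apply: contrapT => ncx.
have [r r0 ball_r] := contact_set_stable alpha_gt0 beta_gt0 Q_ref e0_gt0
  eta_k_nd eta_nd eta_cvg ncx.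
pose U := [set y : 'rV[R]_n | `|x - y| < r / 2].
have oU : open U by exact: open_norm_ball.
have mU : measurable (U : set T) by exact: open_measurable_rV.
have r20 : 0 < r / 2 by rewrite divr_gt0.
have [|A [mA AU]] := suppx U oU; first by rewrite /U/= subrr normr0.
move/eqP; apply; apply/rowP => c; rewrite !mxE.
(* Since [sigma] is absolutely continuous with respect to [mu], it is enough that the scalar measure
   vanishes near [x], which a non-negative bump function detects. *)
suff muUS : mu (S `&` U) = 0%E.
  rewrite sigma_null//; apply/eqP; rewrite -measure_le0 -muUS.
  apply: le_measure; rewrite ?inE.
  - exact: measurableI.
  - exact: measurableI.
  - by move=> y [/AU].
have [psi [cpsi psi_r psi_U psi0]] := bump_function x r0.
pose K := S `&` [set y | `|x - y| <= 3 / 4 * r].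
have cK : compact K.
  apply: (subclosed_compact _ cS); last by move=> y [].
  by apply: closedI; [exact: bdry_closed|exact: closed_norm_ball].
have cpsiS : {within S, continuous psi} by exact: continuous_subspaceT.
(* The normals are unit vectors, so the integral of [psi] against [mu_ (s k)] is that of [psi *: N]
   against [sigma_ (s k)]. It vanishes for large [k]: [psi] is zero on the boundary outside the
   compact set [K], which misses the contact set of [eta_ (s k)] and thus the support. *)
have int_psi0 : \int[mu]_(y in S) psi y = 0.
  apply: (@cvg_unique _ (@Rhausdorff R) _ _ _ _ (mu_cvg _ cpsiS)).
  apply: cvg_near_cst; move: (subseq _ ball_r); apply: filterS => k ball_k.
  set N := normal (eta_ (s k)).
  have cN : {within S, continuous N} by exact: normal_continuous.
  have cpsiN : {within S, continuous (fun y => psi y *: N y)}.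
    apply/subspace_continuousP => y Sy.
    by apply: cvgZ; [exact: (subspace_continuousP _ _).1 cpsiS y Sy|
                     exact: (subspace_continuousP _ _).1 cN y Sy].
  have -> : \int[mu_ (s k)]_(y in S) psi y =
      vmeasure_integral (sigma_ (s k)) S (fun y => psi y *: N y).
    rewrite mu_P//; apply: eq_Rintegral => y; rewrite inE => Sy.
    by rewrite dotrVZl (deformed_normal_unit beta_gt0 Q_ref e0_gt0 (eta_k_nd _)
      Sy) mulr1.
  apply: (@vmeasure_integral_null _ _ _ K _ _ (2 * r)) => //.
  - exact: compact_measurable_rV.
  - apply: compact_vmeasure_null => // y [Sy yr] ysupp.
    have [_ supp_k _] := sigma_force (s k).
    apply: ball_k (supp_k y ysupp); apply: le_lt_trans yr _.
    by rewrite gtr_pMl// ltr_pdivrMr// mul1r ltr_nat.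
  - by move=> d; exact: m_component.
  - move=> y Sy; have /andP[p0 p1] := psi_r y.
    rewrite normrZ ger0_norm// -[leRHS]mulr1; apply: ler_pM => //.
    exact: normal_le1.
  - move=> y Sy nKy; rewrite psi0 ?scale0r//.
    by rewrite leNgt; apply/negP => yr; apply: nKy; split=> //=; exact: ltW.
have mSU : measurable (S `&` U : set T) by exact: measurableI.
have : r / 2 * fine (mu (S `&` U)) <= 0.
  rewrite -int_psi0 -Rintegral_cst// Rintegral_mkcondr.
  have mpsi := within_continuous_measurable mS cpsiS.
  apply: le_Rintegral => //.
  - apply: (@bounded_integrable _ _ _ mu S _ (r / 2)) => //.
      apply/measurable_funTS/(measurable_restrictT _ mU); exact: measurable_cst.
    move=> y Sy; rewrite patchE; case: ifPn => _; last by rewrite normr0 ltW.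
    by rewrite ger0_norm// ltW.
  - apply: (@bounded_integrable _ _ _ mu S _ (2 * r)) => // y Sy.
    by have /andP[p0 p1] := psi_r y; rewrite ger0_norm.
  - move=> y Sy; rewrite patchE; case: ifPn => [/set_mem/psi_U//|_].
    by have /andP[] := psi_r y.
rewrite pmulr_rle0// => mu_le0; apply/eqP; rewrite -measure_le0.
by rewrite -[leLHS]fineK ?lee_fin// fin_num_measure.
Qed.

End contact_force_compactness.

Theorem theorem3p8 (R : realType) (n : nat) (n_gt0 : (0 < n)%N)
  (alpha : R) (alpha_gt0 : 0 < alpha) (alpha_le1 : alpha <= 1)
  (p : R) (p_gt_n : n%:R < p)
  (Q Omega Gamma : set 'rV[R]_n)
  (Q_ref : reference_configuration alpha Q)
  (Omega_dom : C1alpha_domain alpha Omega)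
  (Gamma_sub : Gamma `<=` bdry Q)
  (Gamma_meas : (hausdorff n.-1).-caratheodory Gamma)
  (eta0 : 'rV[R]_n -> 'rV[R]_n)
  (eta0_adm : admissible Q Omega Gamma p eta0 eta0)
  (eta0_inj : set_inj Gamma eta0)
  (eta0_bdry : (eta0 @` Gamma) `&` bdry Omega = set0)
  (E : ('rV[R]_n -> 'rV[R]_n) -> \bar R)
  (DE : ('rV[R]_n -> 'rV[R]_n) -> ('rV[R]_n -> 'rV[R]_n) -> R)
  (Emin : R) (E_energy : elastic_energy Q Gamma p E DE Emin)
  (eta_ : nat -> 'rV[R]_n -> 'rV[R]_n) (eta : 'rV[R]_n -> 'rV[R]_n) (E0 : R)
  (eta_k_adm : forall k, admissible Q Omega Gamma p eta0 (eta_ k))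
  (eta_adm : admissible Q Omega Gamma p eta0 eta)
  (eta_cvg : cvg_C1 Q eta_ eta)
  (eta_k_energy : forall k, (E (eta_ k) <= E0%:E)%E)
  (eta_energy : (E eta <= E0%:E)%E)
  (sigma_ : nat -> vmeasure R n)
  (sigma_force : forall k, contact_force Q Omega (eta_ k) (sigma_ k))
  (sigma_bounded :
     exists C : R, forall k, (vmeasure_norm (sigma_ k) <= C%:E)%E) :
  exists (s : nat -> nat) (sigma : vmeasure R n),
    [/\ {homo s : i j / (i < j)%N},
        vmeasure_on (bdry Q) sigma,
        weak_star_cvg (bdry Q) (fun k => sigma_ (s k)) sigma,
        contact_force Q Omega eta sigma &
        (forall k, action_reaction Q Omega (eta_ (s k)) (sigma_ (s k))) ->
        action_reaction Q Omega eta sigma].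
Proof.
have p_gt0 : 0 < p by apply: le_lt_trans p_gt_n.
have beta_gt0 : 0 < 1 - n%:R / p by rewrite subr_gt0 ltr_pdivrMr// mul1r.
have Emin_le : Emin <= E0.
  rewrite -lee_fin; apply: le_trans eta_energy.
  exact: (energy_ge E_energy (adm_W2p eta_adm)).
have [e0 e0_gt0 det_ge] := energy_det E_energy Emin_le.
have eta_k_nd k : nondegenerate (1 - n%:R / p) Q e0 (eta_ k).
  have adm := eta_k_adm k; split; first exact: adm_rep adm.
  exact: det_ge (adm_W2p adm) (adm_rep adm) (eta_k_energy k).
have eta_nd : nondegenerate (1 - n%:R / p) Q e0 eta.
  split; first exact: adm_rep eta_adm.
  exact: det_ge (adm_W2p eta_adm) (adm_rep eta_adm) eta_energy.
have [C sigmaC] := sigma_bounded.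
have [s [sigma [s_incr sigma_on sigma_f conv]]] :=
  contact_forces_compact alpha_gt0
  beta_gt0 Q_ref e0_gt0 eta_k_nd eta_nd eta_cvg sigma_force sigmaC.
have within_bdry u : nondegenerate (1 - n%:R / p) Q e0 u ->
    {within bdry Q, continuous u}.
  by move=> [[cu _ _] _]; apply: continuous_subspaceW cu => x [].
exists s, sigma; split=> //.
  (* Weak-star convergence is the case of a constant sequence of test functions. *)
  move=> phi cphi; apply: conv => // e e_gt0.
  by near=> k => x _; rewrite subrr normr0 ltW.
move=> act phi cphi suppphi.
have cphiu u : nondegenerate (1 - n%:R / p) Q e0 u ->
    {within bdry Q, continuous (phi \o u)}.
  move=> /within_bdry cu; apply/subspace_continuousP => x bx.
  apply: (cvg_comp u phi _ (cphi (u x))).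
  exact: (subspace_continuousP _ _).1 cu x bx.
have c_etaS : compact (eta @` bdry Q).
  apply: continuous_compact (reference_compact_bdry Q_ref).
  exact: within_bdry.
(* The test functions [phi \o eta_ (s k)] vary with [k]; their uniform convergence on the boundary
   lets [conv] pass to the limit in integrals that are all zero. *)
have unif e : 0 < e -> \forall k \near \oo, forall x, bdry Q x ->
    `|(phi \o eta_ (s k)) x - (phi \o eta) x| <= e.
  move=> e_gt0; have [d d0 phid] := compact_within_unif_continuous c_etaS
    (@subsetT _ _) (continuous_subspaceT cphi) e_gt0.
  have d20 : 0 < d / 2 by rewrite divr_gt0.
  have := near_subsequence s_incr (cvg_C1_closure beta_gt0 eta_k_nd eta_nd
    eta_cvg d20).
  apply: filterS => k etak x bx; rewrite distrC.
  apply/ltW/(phid (eta x) (eta_ (s k) x)) => //.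
  have [etad _] := etak x bx.1; rewrite distrC (le_lt_trans etad)//.
  by rewrite ltr_pdivrMr// ltr_pMr// ltr1n.
have := conv _ _ (fun k => cphiu _ (eta_k_nd (s k))) (cphiu _ eta_nd) unif.
have -> : (fun k => vmeasure_integral (sigma_ (s k)) (bdry Q) (phi \o eta_ (s
  k)))
    = cst 0 by apply/funext => k; exact: act.
move=> lim0; rewrite -(cvg_lim (@Rhausdorff R) lim0).
exact: (lim_cst (@Rhausdorff R)).
Unshelve. all: by end_near. Qed.
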